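(* Let $G$ be a graph with toughness $\tau(G)>1$, with $n$ vertices and minimum degree $\delta$. If $\delta\ge (n-5)/2$, then either $G$ is hamiltonian or $G$ is (isomorphic to) the Petersen graph.
   Context: All graphs are finite, undirected, without loops or multiple edges. For $S\subseteq V(G)$, $G\backslash S$ is the subgraph of $G$ induced by $V(G)\backslash S$, and $s(G)$ denotes the number of connected components of a graph $G$. A graph $G$ is $t$-tough if $|S|\ge t\,s(G\backslash S)$ for every $S\subseteq V(G)$ with $s(G\backslash S)>1$. The toughness $\tau(G)$ is the maximum value of $t$ for which $G$ is $t$-tough, with the convention $\tau(K_n)=\infty$ for all $n\ge1$. A cycle of length $t$ is a sequence $v_1v_2\dots v_tv_1$ of distinct vertices $v_1,\dots,v_t$ with $v_iv_{i+1}\in E(G)$ for each $i\in\{1,\dots,t\}$, where $v_{t+1}=v_1$. By convention, a single vertex is regarded as a cycle of length $1$ and a single edge as a cycle of length $2$. A graph on $n$ vertices is hamiltonian if it contains a Hamilton cycle, i.e. a cycle of length $n$ (so $K_1$ and $K_2$ count as hamiltonian). *)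

(* Defs.v *)
From HB Require Import structures.
From mathcomp Require Import all_boot all_order all_algebra.
From mathcomp Require Import boolp classical_sets reals constructive_ereal.

Set Implicit Arguments.
Unset Strict Implicit.
Unset Printing Implicit Defensive.

Import Order.TTheory GRing.Theory Num.Theory.
Local Open Scope ring_scope.

Record sgraph := SGraph {
  vertex :> finType;
  edge : rel vertex;
  edge_sym : symmetric edge;
  edge_irrefl : irreflexive edge }.

Section Deletion.
Variables (G : sgraph) (S : {set G}).

Definition delete_edge : rel {x : G | x \notin S} :=
  fun x y => edge (val x) (val y).

Lemma delete_edge_sym : symmetric delete_edge.
Proof. by move=> x y; apply: edge_sym. Qed.

Lemma delete_edge_irrefl : irreflexive delete_edge.
Proof. by move=> x; apply: edge_irrefl. Qed.

(* The graph G \ S, on the vertices outside S. *)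
Definition delete : sgraph := SGraph delete_edge_sym delete_edge_irrefl.

End Deletion.

Definition ncomponents (G : sgraph) : nat := n_comp (@edge G) G.

Definition tough (R : realType) (t : R) (G : sgraph) : Prop :=
  forall S : {set G}, (1 < ncomponents (delete S))%N ->
    t * (ncomponents (delete S))%:R <= #|S|%:R.

Definition is_complete (G : sgraph) : bool :=
  [forall x : G, forall y : G, (x != y) ==> edge x y].

(* For a graph that is not complete the supremum is a maximum, see
   [toughness_max] below. *)
Definition toughness (R : realType) (G : sgraph) : \bar R :=
  if is_complete G then +oo%E else (sup [set t : R | tough t G]%classic)%:E.

Definition degree (G : sgraph) (x : G) : nat := #|[set y : G | edge x y]|.

(* Every degree is smaller than #|G|, so that the default value is never
   reached when G has a vertex. *)
Definition min_degree (G : sgraph) : nat :=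
  \big[minn/#|G|]_(x : G) degree x.

(* Since [cycle] closes the sequence up, it means adjacency for a sequence of
   two vertices; it fails on one vertex and holds on the empty sequence. *)
Definition is_cycle (G : sgraph) (c : seq G) : bool :=
  [&& (0 < size c)%N, uniq c & (size c == 1%N) || cycle (@edge G) c].

Definition hamiltonian (G : sgraph) : Prop :=
  exists c : seq G, is_cycle c /\ size c = #|G|.

Definition isomorphic (G H : sgraph) : Prop :=
  exists f : G -> H, bijective f /\ forall x y, edge (f x) (f y) = edge x y.

Definition petersen_edge : rel {A : {set 'I_5} | #|A| == 2%N} :=
  fun A B => [disjoint val A & val B].

Lemma petersen_edge_sym : symmetric petersen_edge.
Proof. by move=> A B; apply: disjoint_sym. Qed.

Lemma petersen_edge_irrefl : irreflexive petersen_edge.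
Proof.
move=> [A /= cA]; apply/negbTE; rewrite /petersen_edge /= -finset.setI_eq0 finset.setIid.
by rewrite -cards_eq0 (eqP cA).
Qed.

(* The Petersen graph as the Kneser graph K(5, 2). *)
Definition petersen : sgraph := SGraph petersen_edge_sym petersen_edge_irrefl.

Lemma noncomplete_cut (G : sgraph) : ~~ is_complete G ->
  exists S : {set G}, (1 < ncomponents (delete S))%N.
Proof.
rewrite negb_forall => /existsP[x]; rewrite negb_forall => /existsP[y].
rewrite negb_imply => /andP[xy nexy].
exists (~: [set x; y]).
have px : x \notin ~: [set x; y] by rewrite !inE eqxx.
have py : y \notin ~: [set x; y] by rewrite !inE eqxx orbT.
pose H := delete (~: [set x; y]).
have noedge (u v : H) : edge u v = false.
  case: u v => [u pu] [v pv]; rewrite /= /delete_edge /=.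
  move: pu pv; rewrite !inE !negbK => /orP[]/eqP-> /orP[]/eqP->.
  - exact: edge_irrefl.
  - exact: negbTE.
  - by rewrite edge_sym; apply: negbTE.
  - exact: edge_irrefl.
have rt (u : H) : u \in roots (@edge H).
  apply/eqP; have /connectP[[|v p]] // := connect_root (@edge H) u.
  by case/andP; rewrite noedge.
rewrite /ncomponents -/H; apply/card_gt1P.
exists (Sub x px : H), (Sub y py : H).
by split; [apply/andP; split; first exact: rt.. | rewrite -val_eqE].
Qed.

Lemma toughness_max (R : realType) (G : sgraph) : ~~ is_complete G ->
  exists t : R, [/\ toughness R G = t%:E, tough t G &
    forall u : R, tough u G -> u <= t].
Proof.
move=> ncG; rewrite /toughness (negbTE ncG).
set X := [set t : R | tough t G]%classic.
have ubS (S : {set G}) : (1 < ncomponents (delete S))%N ->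
    ubound X (#|S|%:R / (ncomponents (delete S))%:R).
  move=> S1 t /(_ S S1) tS; rewrite ler_pdivlMr //.
  by rewrite ltr0n; apply: leq_trans S1.
have X0 : (X !=set0)%classic by exists 0 => S _; rewrite mul0r ler0n.
have supX : has_sup X.
  by split=> //; have [S S1] := noncomplete_cut ncG; exists (#|S|%:R / (ncomponents (delete S))%:R); exact: ubS.
exists (sup X); split=> //.
  move=> S S1; rewrite -ler_pdivlMr; last by rewrite ltr0n; apply: leq_trans S1.
  by apply: ge_sup => //; exact: ubS.
by move=> u uG; apply: ub_le_sup => //; case: supX.
Qed.

(* Main.v *)
Require Import Defs.
From mathcomp Require Import all_boot all_order all_algebra.
From mathcomp Require Import reals constructive_ereal.
From mathcomp Require Import zify.

Set Implicit Arguments.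
Unset Strict Implicit.
Unset Printing Implicit Defensive.

(** Suppose that a graph with toughness above one and [#|G| <= 2 * d + 5], where [d]
    is the minimum degree, is not hamiltonian. It is not complete, and toughness gives
    [3 <= d]. The proof consists of exchange arguments on a longest cycle [C].
    Toughness enters them mainly through one principle, [segments_linked]: if a set of
    vertices of [C], no two of them consecutive, contains the whole neighbourhood of a
    component outside [C], then the segments into which it cuts [C] are linked to each
    other in more than one way.

    First, every longest cycle is dominating, that is, no edge joins two vertices
    outside it ([no_outside_edge]). For a component [H] with two or more vertices, the
    degrees of the successors of two of its neighbours on [C] give a lower bound on
    the order ([two_successors]), while crossing links make [C] long compared with
    the number of neighbours of [H] ([long_cycle]). With the degrees inside [H], the
    numbers admit one configuration on 13 vertices, which a computation excludes.

    Now let [x] be a vertex outside [C] and [S] its neighbourhood, a subset of [C]. The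
    singles, vertices of [C] with both cycle neighbours in [S], can replace [x], so that
    their neighbours behave like elements of [S] ([hub_next], [hub_succ], [hub_pred]).
    Toughness then shows that [C] has at least three more vertices than twice the
    number of these hubs ([few_extras]). The order of the graph leaves a tight
    situation: [S] has exactly [d] elements, [C] has length [2 * d + 3] or [2 * d + 4],
    at least three of the segments between elements of [S] have more than one vertex,
    and the singles are adjacent to all of [S].

    If [5 <= d], there is a single. The first vertex of some long segment is adjacent
    to the last vertex of another one ([exists_first_last]), and with the help of the
    single this edge confines the neighbours of a suitable third vertex to fewer than
    [d] places ([large_contra]).

    If [d] is 3 or 4, there are few possibilities for [S], and an exhaustive search
    over the remaining edges decides each of them ([explore], with soundness in
    [explore_sound]). The search prunes with the length of [C] and branches with the
    degrees and with the toughness at [S] and at [S] with one more vertex. A single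
    graph survives, the Petersen graph, with [d = 3] and [C] of length 9. *)

Ltac arith_hyp T := lazymatch T with
  | is_true (leq _ _) => idtac | is_true (andb _ _) => idtac | is_true (orb _ _) => idtac
  | is_true (negb (leq _ _)) => idtac | is_true (negb (andb _ _)) => idtac
  | @eq bool (andb _ _) false => idtac
  | is_true (negb (@eq_op ?E _ _)) => unify (Equality.sort E) nat
  | is_true (@eq_op ?E _ _) => unify (Equality.sort E) nat
  | or _ _ => idtac | @eq ?E _ _ => unify E nat end.

(** [lia] with only the arithmetic hypotheses in the context, and with one form
    for the type of each list whose size occurs. *)
Ltac nlia :=
  repeat match goal with H : ?T |- _ =>
    match type of T with Prop => tryif arith_hyp T then fail else clear H end end;
  repeat match goal with H : ?T |- _ => match type of T with Prop => revert H end end;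
  repeat match goal with |- context [@size ?A ?s] => match goal with
    |- context [@size ?B s] => tryif constr_eq A B then fail else
      change (@size B s) with (@size A s) end end;
  lia.

(** * Longest cycles and rerouting *)

Section Rerouting.
Variable G : sgraph.
Implicit Types (C L P Q R s : seq G).

Definition longest C := [/\ uniq C, cycle (@edge G) C &
  forall s, uniq s -> cycle (@edge G) s -> size s <= size C].

(** A stretch of consecutive indices, with the direction in which it is run
    through: [up i j] goes from [i] to [j] and [dn j i] goes back from [j] to
    [i]; both ends are included and [i <= j] is meant. *)
Definition stretch : Type := bool * (nat * nat).
Definition up i j : stretch := (true, (i, j)).
Definition dn j i : stretch := (false, (i, j)).
Definition lo (p : stretch) := p.2.1.
Definition hi (p : stretch) := p.2.2.
Definition from (p : stretch) := if p.1 then lo p else hi p.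
Definition upto (p : stretch) := if p.1 then hi p else lo p.
Definition walk (p : stretch) : seq nat :=
  let s := iota (lo p) (hi p - lo p).+1 in if p.1 then s else rev s.

Lemma size_walk (p : stretch) : size (walk p) = (hi p - lo p).+1.
Proof. by rewrite /walk; case: p.1; rewrite ?size_rev size_iota. Qed.

Lemma mem_walk (p : stretch) k : lo p <= hi p -> (k \in walk p) = (lo p <= k <= hi p).
Proof.
move=> le; rewrite /walk; case: p.1; rewrite ?mem_rev mem_iota;
  by rewrite addnS subnKC // ltnS.
Qed.

Lemma walk_uniq (p : stretch) : uniq (walk p).
Proof. by rewrite /walk; case: p.1; rewrite ?rev_uniq iota_uniq. Qed.

Lemma walk_path (r : rel nat) (p : stretch) : symmetric r -> lo p <= hi p ->
    (forall k, lo p <= k < hi p -> r k k.+1) ->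
  exists t, [/\ walk p = from p :: t, path r (from p) t & last (from p) t = upto p].
Proof.
case: p => d [a b]; rewrite /walk /from /upto /lo /hi /= => rC leab h.
have {h leab} [h1 h2] : path r a (iota a.+1 (b - a)) /\ last a (iota a.+1 (b - a)) = b.
  move: (b - a) (subnKC leab) h => n <- {b leab}.
  elim: n a => [|n IH] a h /=; first by rewrite addn0.
  have [|-> ->] := IH a.+1; first by move=> k hk; apply: h; lia.
  by rewrite h; [split=> //; lia | lia].
case: d => /=; first by exists (iota a.+1 (b - a)).
have eqr : rev (a :: iota a.+1 (b - a)) = b :: rev (belast a (iota a.+1 (b - a))).
  by rewrite lastI h2 rev_rcons.
exists (rev (belast a (iota a.+1 (b - a)))); split=> //.
  have := rev_path r a (iota a.+1 (b - a)); rewrite h2 => ->.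
  by rewrite (eq_path (e' := r)).
by rewrite -[LHS]/(last b (b :: rev (belast a (iota a.+1 (b - a))))) -eqr rev_cons last_rcons.
Qed.

(** A plan of disjoint stretches of the list [L], run through in cyclic order,
    spells out a cycle of the graph. Every exchange argument below is an instance,
    so that the new cycle is never written down: only the numbers are checked. *)
Lemma reroute C L x0 (ps : seq stretch) : longest C -> uniq L ->
    all (fun p => lo p <= hi p < size L) ps ->
    (forall p, p \in ps -> forall k, lo p <= k < hi p ->
       edge (nth x0 L k) (nth x0 L k.+1)) ->
    pairwise (fun p q => (hi p < lo q) || (hi q < lo p)) ps ->
    cycle (fun p q => edge (nth x0 L (upto p)) (nth x0 L (from q))) ps ->
  sumn [seq (hi p - lo p).+1 | p <- ps] <= size C.
Proof.
move=> [_ _ maxC] uL szL solid disj cyc.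
pose ks := flatten [seq walk p | p <- ps].
have uks : uniq ks.
  rewrite {}/ks; elim: ps szL disj {solid cyc} => //= p ps IH /andP[hp szL] /andP[/allP dp u].
  rewrite cat_uniq walk_uniq IH // andbT; apply/hasPn => k /flattenP[s /mapP[q qps ->]].
  rewrite !mem_walk; [|lia|by move/(allP szL): qps; lia].
  by move=> hk; move: (dp _ qps) hk; lia.
have ltks k : k \in ks -> k < size L.
  move=> /flattenP[s /mapP[q /(allP szL) hq ->]]; rewrite mem_walk; lia.
have eqsz : sumn [seq (hi p - lo p).+1 | p <- ps] = size ks.
  rewrite size_flatten /shape -map_comp; congr sumn.
  by apply: eq_map => p; rewrite /= size_walk.
rewrite eqsz -(size_map (nth x0 L)); apply: maxC.
  by rewrite map_inj_in_uniq // => i j /ltks hi /ltks hj /eqP; rewrite nth_uniq // => /eqP.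
pose r : rel nat := fun i j => edge (nth x0 L i) (nth x0 L j).
have rC : symmetric r by move=> i j; apply: edge_sym.
suff: cycle r ks by rewrite cycle_map; apply: sub_cycle.
rewrite /ks; clear ks uks ltks eqsz; case: ps cyc solid szL {disj} => // p0 ps cyc solid /allP szL.
have le p : p \in p0 :: ps -> lo p <= hi p by move/szL/andP=> [].
have chain : forall (ps' : seq stretch) q, (forall p, p \in ps' -> p \in p0 :: ps) ->
    path (fun p q => r (upto p) (from q)) q ps' ->
    path r (upto q) (flatten [seq walk p | p <- ps']) /\
    last (upto q) (flatten [seq walk p | p <- ps']) = upto (last q ps').
  elim=> //= p ps' IH q sub /andP[e /IH [|h1 h2]].
    by move=> u hu; apply: sub; rewrite inE hu orbT.
  have pin : p \in p0 :: ps by apply: sub; rewrite mem_head.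
  have [t [-> h3 h4]] := walk_path rC (le _ pin) (solid _ pin).
  by rewrite /= e cat_path last_cat h3 h4.
have [t [eqt h3 h4]] := walk_path rC (le _ (mem_head _ _)) (solid _ (mem_head _ _)).
rewrite /= eqt /= rcons_cat cat_path h3 h4 /=.
move: cyc; rewrite /= rcons_path => /andP[h5 h6].
have [|h7 h8] := chain ps p0 _ h5; first by move=> p hp; rewrite inE hp orbT.
by rewrite rcons_path h7 h8.
Qed.

(** The form used below: the walks run inside three blocks, usually [Q] is the
    cycle cut open and [P], [R] are paths outside it. *)
Lemma reroute3 C Q P R x0 (ps : seq stretch) : longest C ->
    uniq (Q ++ P ++ R) -> sorted (@edge G) Q -> sorted (@edge G) P -> sorted (@edge G) R ->
    all (fun p => (lo p <= hi p) && [|| hi p < size Q,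
      (size Q <= lo p) && (hi p < size Q + size P)
      | (size Q + size P <= lo p) && (hi p < size Q + size P + size R)]) ps ->
    pairwise (fun p q => (hi p < lo q) || (hi q < lo p)) ps ->
    cycle (fun p q => edge (nth x0 (Q ++ P ++ R) (upto p)) (nth x0 (Q ++ P ++ R) (from q))) ps ->
  sumn [seq (hi p - lo p).+1 | p <- ps] <= size C.
Proof.
move=> lC uL sQ sP sR blk disj cyc.
apply: (reroute lC uL _ _ disj cyc).
  by apply: sub_all blk => p; rewrite !size_cat; lia.
move=> p /(allP blk)/andP[_ hp] k hk.
have {}hp : [|| k.+1 < size Q, (size Q <= k) && (k.+1 < size Q + size P)
      | (size Q + size P <= k) && (k.+1 < size Q + size P + size R)] by lia.
have st s i : sorted (@edge G) s -> i.+1 < size s -> edge (nth x0 s i) (nth x0 s i.+1).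
  by move=> ss lt; apply: (sortedP x0 ss).
clear disj cyc blk lC uL; rewrite !nth_cat; case/or3P: hp => [hp|/andP[h1 h2]|/andP[h1 h2]].
- by rewrite hp (ltnW hp); apply: st.
- rewrite !(leq_gtF h1) (leq_gtF (leqW h1)) subSn //.
  have h3 : (k - size Q).+1 < size P by clear -h1 h2; lia.
  by rewrite h3 (ltnW h3); apply: st.
- have h3 : size Q <= k by clear -h1; lia.
  have h4 : size P <= k - size Q by clear -h1; lia.
  rewrite !(leq_gtF h3) (leq_gtF (leqW h3)) subSn // !(leq_gtF h4) (leq_gtF (leqW h4)) subSn //.
  by apply: st => //; clear -h1 h2; lia.
Qed.

End Rerouting.

(** Discharges the arithmetic side conditions of a rerouting. *)
Ltac nums := rewrite /= /hi /lo /=; repeat (apply/andP; split) => //; nlia.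

(** * Toughness and vertex labels *)

Section Toughness.
Variable G : sgraph.
Implicit Types (C R : seq G) (T : {set G}).

(** Toughness is a maximum over finitely many cuts, so that toughness above one
    makes the bound strict. *)
Definition tough_over1 := forall T : {set G},
  1 < ncomponents (delete T) -> ncomponents (delete T) < #|T|.

Hypothesis tough : tough_over1.

(** A labelling that is constant along the edges outside [T] is constant on
    components: the labels bound the number of components from below, and no
    component has to be described. *)
Lemma tough_labels (I : finType) T (lab : G -> I) :
    (forall u v, u \notin T -> v \notin T -> edge u v -> lab u = lab v) ->
    1 < #|lab @: ~: T| -> #|lab @: ~: T| < #|T|.
Proof.
move=> labE; pose D := delete T.
have symD : connect_sym (@edge D) by apply: sym_connect_sym; apply: edge_sym.
have labC (u v : D) : connect (@edge D) u v -> lab (val u) = lab (val v).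
  case/connectP=> p; elim: p u => [|w p IH] u /=; first by move=> _ ->.
  case/andP=> uw pw vE; rewrite -(IH w pw vE); exact: labE (valP u) (valP w) uw.
have le : #|lab @: ~: T| <= ncomponents D.
  rewrite /ncomponents /n_comp_mem.
  apply: leq_trans (leq_imset_card (fun r : D => lab (val r)) _).
  apply/subset_leq_card/subsetP => i /imsetP[u]; rewrite inE => uT ->.
  pose u' : D := Sub u uT.
  apply/imsetP; exists (fingraph.root (@edge D) u').
    by rewrite !inE /= roots_root.
  by rewrite -(labC u') ?connect_root.
by move=> gt1; apply: leq_ltn_trans le (tough (leq_trans gt1 le)).
Qed.

Definition off C : rel G := fun y z => [&& y \notin C, z \notin C & edge y z].

Lemma off_sym C : connect_sym (off C).
Proof.
by apply: sym_connect_sym => y z; rewrite /off edge_sym andbCA.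
Qed.

Lemma off_notin C y z : y \notin C -> connect (off C) y z -> z \notin C.
Proof.
move=> yC /connectP[p]; elim: p y yC => [|w p IH] y yC /=; first by move=> _ ->.
by case/andP=> /and3P[_ wC _]; apply: IH.
Qed.

Definition reach C u y := [exists z, [&& edge u z, z \notin C & connect (off C) z y]].

(** Adjacent, or joined by a path outside [C]. *)
Definition linked C u w := edge u w || [exists y, reach C u y && edge y w].

Lemma reach_linked C u w y : reach C u y -> reach C w y -> linked C u w.
Proof.
case/existsP=> z /and3P[uz zC zy] /existsP[t /and3P[wt tC ty]].
apply/orP; right; apply/existsP; exists t; rewrite edge_sym wt andbT.
apply/existsP; exists z; rewrite uz zC /=; apply: connect_trans zy _.
by rewrite off_sym.
Qed.

Lemma linked_sym C u w : linked C u w = linked C w u.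
Proof.
suff h a b : linked C a b -> linked C b a by apply/idP/idP; apply: h.
case/orP=> [ab|/existsP[y /andP[ry yb]]]; first by rewrite /linked edge_sym ab.
have yC : y \notin C by case/existsP: ry => z /and3P[_ zC zy]; apply: off_notin zC zy.
apply: (@reach_linked C b a y) => //; apply/existsP; exists y.
by rewrite edge_sym yb yC connect0.
Qed.

Lemma linkedP C u w : linked C u w ->
  exists R, [/\ uniq R, {in R, forall y, y \notin C} & path (@edge G) u (rcons R w)].
Proof.
case/orP=> [uw|/existsP[y /andP[/existsP[z /and3P[uz zC zy]] yw]]].
  by exists [::]; rewrite /= uw.
case/connectP: zy => p0 /shortenP[p zp up _] eqy.
exists (z :: p); split=> //.
  move=> v; rewrite inE => /orP[/eqP->//|vp].
  case/splitPr: vp zp => p1 p2; rewrite cat_path => /andP[_ /= /andP[]].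
  by case/and3P.
rewrite /= uz rcons_path -eqy yw andbT.
by apply: sub_path zp => a b /and3P[].
Qed.

Lemma off_path C y z : y \notin C -> connect (off C) y z ->
  exists R, [/\ uniq (y :: R), {in y :: R, forall v, v \notin C},
    {in y :: R, forall v, connect (off C) y v}, path (@edge G) y R & last y R = z].
Proof.
move=> yC /connectP[p0 /shortenP[p yp up _] eqz]; exists p.
have conn : {in y :: p, forall v, connect (off C) y v}.
  by move=> v hv; apply: (path_connect yp).
split=> //; first by move=> v /conn; apply: off_notin.
by apply: sub_path yp => a b /and3P[].
Qed.

(** Deleting the set [T] of cycle vertices leaves the component of [x] apart from
    the pieces of the cycle, the classes of [lab]. If links merge at most the two
    classes [a] and [b], there are at least as many components as classes, and
    toughness makes this number smaller than [#|T|]. *)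
Lemma merge_bound C x T (I : finType) (lab : G -> I) (a b : I) :
    x \notin C -> {subset T <= C} ->
    (forall y v, connect (off C) x y -> v \in C -> edge y v -> v \in T) ->
    (forall u w, u \in C -> u \notin T -> w \in C -> w \notin T -> linked C u w ->
       lab u != lab w ->
       (lab u == a) && (lab w == b) || (lab u == b) && (lab w == a)) ->
    1 < #|lab @: [set v in C | v \notin T]| ->
  #|lab @: [set v in C | v \notin T]| < #|T|.
Proof.
set A := [set v in C | _] => xC TC xT merge gt1.
pose g i := if i == b then a else i.
pose lab' y := if y \in C then Some (g (lab y)) else
  if [pick u | (u \in A) && reach C u y] is Some u then Some (g (lab u)) else None.
have gE u w : u \in A -> w \in A -> linked C u w -> g (lab u) = g (lab w).
  rewrite !inE => /andP[uC uT] /andP[wC wT] uw.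
  have [->//|ne] := eqVneq (lab u) (lab w).
  move: (merge _ _ uC uT wC wT uw ne); rewrite /g.
  by case/orP => /andP[/eqP-> /eqP->]; rewrite eqxx; case: eqP => // ->.
have inout u v : u \in C -> u \notin T -> v \notin C -> edge u v -> lab' u = lab' v.
  move=> uC uT vC uv; rewrite /lab' uC (negbTE vC).
  have ruv : reach C u v by apply/existsP; exists v; rewrite uv vC connect0.
  case: pickP => [w /andP[wA rwv]|/(_ u)]; last by rewrite !inE uC uT ruv.
  by rewrite (gE u w) // ?inE ?uC //; apply: reach_linked ruv rwv.
have labE u v : u \notin T -> v \notin T -> edge u v -> lab' u = lab' v.
  move=> uT vT uv; case uC: (u \in C); case vC: (v \in C).
  - by rewrite /lab' uC vC (gE u v) // ?inE ?uC ?vC // /linked uv.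
  - by apply: inout; rewrite ?vC.
  - by apply/esym/inout; rewrite ?uC // edge_sym.
  - rewrite /lab' uC vC; rewrite (eq_pick (Q := fun w => (w \in A) && reach C w v)) //.
    move=> w; congr andb; apply/existsP/existsP => -[z /and3P[wz zC zy]]; exists z;
      rewrite wz zC /=; apply: connect_trans zy (connect1 _); rewrite /off uC vC //=.
    by rewrite edge_sym.
have le : #|lab @: A| <= #|lab' @: ~: T|.
  have xN : None \in lab' @: ~: T.
    apply/imsetP; exists x; first by rewrite inE; apply: contra xC; apply: TC.
    rewrite /lab' (negbTE xC); case: pickP => // u /andP[+ /existsP[z /and3P[uz zC zx]]].
    rewrite inE => /andP[uC /negP[]]; apply: (xT z) => //; last by rewrite edge_sym.
    by rewrite off_sym.
  have sub : Some @: (g @: (lab @: A)) \subset lab' @: ~: T.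
    apply/subsetP => _ /imsetP[_ /imsetP[_ /imsetP[u uA ->] ->] ->].
    move: uA; rewrite inE => /andP[uC uT]; apply/imsetP; exists u; first by rewrite inE.
    by rewrite /lab' uC.
  have leg : #|lab @: A| <= #|g @: (lab @: A)|.+1.
    apply: leq_trans (_ : #|b |: g @: (lab @: A)| <= _).
      apply/subset_leq_card/subsetP => i iA; rewrite !inE.
      have [//|ne] := eqVneq i b; apply/imsetP; exists i => //.
      by rewrite /g (negbTE ne).
    by rewrite cardsU1; case: (_ \notin _).
  apply: leq_trans leg _.
  have /subset_leq_card : None |: Some @: (g @: (lab @: A)) \subset lab' @: ~: T.
    by rewrite subUset sub1set xN.
  rewrite cardsU1 (card_imset _ (@Some_inj _)) => /(leq_trans _); apply.
  by rewrite (_ : None \notin _) //; apply/imsetP => -[].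
exact: leq_ltn_trans le (tough_labels labE (leq_trans gt1 le)).
Qed.

End Toughness.

(** * Segments of a cycle *)

Section Segments.
Variables (G : sgraph) (C : seq G) (x0 : G) (T : {set G}).
Local Notation "c_( k )" := (nth x0 C k).
Local Notation c := (size C).

(** The number of the segment, between two consecutive vertices of [T], that
    contains the index [k]. *)
Definition seg k := count [in T] (take k.+1 C).

Lemma segS k : k.+1 < c -> seg k.+1 = seg k + (c_(k.+1) \in T).
Proof. by move=> kc; rewrite /seg (take_nth x0 kc) -cats1 count_cat /= addn0. Qed.

Lemma leq_seg j k : j <= k -> seg j <= seg k.
Proof.
move=> jk; rewrite /seg -(cat_take_drop j.+1 (take k.+1 C)) count_cat take_takel //.
by rewrite leq_addr.
Qed.

Lemma ltn_seg j t k : j < t -> t <= k -> k < c -> c_(t) \in T -> seg j < seg k.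
Proof.
move=> jt tk kc tT; apply: leq_trans (leq_seg tk).
case: t jt tk tT => // t jt tk tT.
by rewrite segS ?tT ?addn1 ?ltnS ?leq_seg //; nlia.
Qed.

Lemma seg_inj j k : j <= k -> k < c -> (forall t, j < t <= k -> c_(t) \notin T) -> seg j = seg k.
Proof.
elim: k => [|k IH] jk kc noT; first by move: jk; rewrite leqn0 => /eqP->.
have [->//|ne] := eqVneq j k.+1.
rewrite segS // (negbTE (noT k.+1 _)) ?addn0; last by nlia.
by apply: IH => [||t ht]; [nlia|nlia|apply: noT; nlia].
Qed.

Lemma seg_lt j k : seg j < seg k -> k < c -> exists2 t, j < t <= k & c_(t) \in T.
Proof.
move=> lt kc; have jk : j < k by rewrite ltnNge; apply/negP => /leq_seg; nlia.
have [/hasP[t]|no] := boolP (has (fun t => c_(t) \in T) (iota j.+1 (k - j))).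
  by rewrite mem_iota => ht tT; exists t => //; nlia.
move: lt; rewrite (@seg_inj j k) ?ltnn //; first by nlia.
by move=> t ht; apply: (hasPn no); rewrite mem_iota; nlia.
Qed.

Hypotheses (tough : tough_over1 G) (uC : uniq C) (TC : {subset T <= C}).
Hypothesis T_end : c_(c.-1) \notin T.
Hypothesis T_succ : forall k, k.+1 < c -> c_(k) \in T -> c_(k.+1) \notin T.

(** There are as many segments as vertices of [T], too many for [merge_bound]: the
    links cannot be confined to a single pair of segments. With that pair as a
    parameter, a second application produces a link of another pair. *)
Lemma segments_linked x (a b : nat) : 1 < #|T| -> x \notin C ->
    (forall y v, connect (off C) x y -> v \in C -> edge y v -> v \in T) ->
  exists u w, [/\ u < c, w < c, c_(u) \notin T, c_(w) \notin T & linked C c_(u) c_(w)] /\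
    [/\ seg u != seg w, ~~ ((seg u == a) && (seg w == b)) &
        ~~ ((seg u == b) && (seg w == a))].
Proof.
move=> T2 xC xT.
pose lab v : 'I_c.+1 := inord (seg (index v C)).
have seg_le k : seg k <= c by apply: leq_trans (count_size _ _) _; rewrite size_take; case: ltnP => // /ltnW.
have labE k : k < c -> lab c_(k) = seg k :> nat.
  by move=> kc; rewrite /lab index_uniq // inordK // ltnS.
have ltT : #|T| <= #|lab @: [set v in C | v \notin T]|.
  pose f v := lab c_((index v C).+1).
  have next v : v \in T -> (index v C).+1 < c /\ c_((index v C).+1) \notin T.
    move=> vT; have vC : index v C < c by rewrite index_mem TC.
    have vc : (index v C).+1 < c.
      rewrite ltn_neqAle vC andbT; apply: contra T_end => /eqP e.
      by rewrite -e /= nth_index // TC.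
    by split=> //; apply: T_succ => //; rewrite nth_index // TC.
  have finj : {in T &, injective f}.
    have wl v w : v \in T -> w \in T -> index v C < index w C -> f v <> f w.
      move=> vT wT vw /(congr1 val); rewrite /f /=.
      have [[v1 v2] [w1 w2]] := (next v vT, next w wT).
      rewrite !labE // => e.
      suff : seg (index v C).+1 < seg (index w C).+1 by rewrite e ltnn.
      have cw : c_(index w C) = w by rewrite nth_index // TC.
      apply: (@ltn_seg _ (index w C)) => //; last by rewrite cw.
      rewrite ltn_neqAle vw andbT; apply/eqP => e'.
      by move: v2; rewrite e' cw wT.
    move=> v w vT wT e; have [lt|lt|eqi] := ltngtP (index v C) (index w C).
    - by case: (wl v w vT wT lt).
    - by case: (wl w v wT vT lt).
    - by rewrite -(nth_index x0 (TC vT)) eqi nth_index // TC.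
  rewrite -(card_in_imset finj); apply/subset_leq_card/subsetP => _ /imsetP[v vT ->].
  have [v1 v2] := next v vT; apply/imsetP; exists c_((index v C).+1) => //.
  by rewrite inE mem_nth.
have gt1 := leq_trans T2 ltT.
pose bad (uw : 'I_c * 'I_c) := let: (u, w) := uw in
  [&& c_(u) \notin T, c_(w) \notin T, linked C c_(u) c_(w), seg u != seg w,
    ~~ ((seg u == a) && (seg w == b)) & ~~ ((seg u == b) && (seg w == a))].
have [[u w] /= /and5P[h1 h2 h3 h4 /andP[h5 h6]]|no] := pickP bad.
  by exists u, w.
suff : #|lab @: [set v in C | v \notin T]| < #|T| by nlia.
have [a' [b' merge]] : exists a' b' : 'I_c.+1, forall u w, u \in C -> u \notin T ->
    w \in C -> w \notin T -> linked C u w -> lab u != lab w ->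
    (lab u == a') && (lab w == b') || (lab u == b') && (lab w == a').
  have red u w : u \in C -> u \notin T -> w \in C -> w \notin T -> linked C u w ->
      lab u != lab w -> ((lab u : nat) == a) && ((lab w : nat) == b) ||
                        ((lab u : nat) == b) && ((lab w : nat) == a).
    move=> uC' uT wC' wT uw ne.
    have iu : index u C < c by rewrite index_mem.
    have iw : index w C < c by rewrite index_mem.
    have := no (Ordinal iu, Ordinal iw); rewrite /bad /= !nth_index // uT wT uw /=.
    move: ne; rewrite -val_eqE /= -(nth_index x0 uC') -(nth_index x0 wC') !labE //.
    rewrite !nth_index // => -> /= /negbT.
    by rewrite negb_and !negbK.
  case: (ltnP a c.+1) => ac; last first.
    exists ord0, ord0 => u w h1 h2 h3 h4 h5 h6; move: (red u w h1 h2 h3 h4 h5 h6).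
    by move: (ltn_ord (lab u)) (ltn_ord (lab w)); nlia.
  case: (ltnP b c.+1) => bc; last first.
    exists ord0, ord0 => u w h1 h2 h3 h4 h5 h6; move: (red u w h1 h2 h3 h4 h5 h6).
    by move: (ltn_ord (lab u)) (ltn_ord (lab w)); nlia.
  by exists (Ordinal ac), (Ordinal bc).
exact: (merge_bound tough xC TC xT merge gt1).
Qed.

End Segments.

(** * Components outside a longest cycle *)

Section Components.
Variable G : sgraph.
Implicit Types (C P R : seq G) (H : {set G}).

(** What is used of a component of the graph outside [C]. The vertex set [H] stays
    a component when the cycle is rotated. *)
Definition component C H := [/\ {in H, forall y, y \notin C},
  forall u v, u \in H -> v \notin C -> edge u v -> v \in H &
  forall u v, u \in H -> v \in H -> exists R, [/\ uniq (u :: R),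
    {subset u :: R <= H}, path (@edge G) u R & last u R = v]].

Lemma component_connect C x : x \notin C -> component C [set y | connect (off C) x y].
Proof.
move=> xC; split.
- by move=> y; rewrite inE; apply: off_notin.
- move=> u v; rewrite !inE => xu vC uv; apply: (connect_trans xu (connect1 _)).
  by rewrite /off (off_notin xC xu) vC.
- move=> u v; rewrite !inE => xu xv.
  have [|R [uR _ cR pR lR]] := @off_path G C u v (off_notin xC xu).
    by apply: connect_trans xv; rewrite off_sym.
  by exists R; split=> // w /cR uw; rewrite inE; apply: connect_trans uw.
Qed.

(** A detour from [u] to [w] through the component; the number of its vertices is
    what a rerouted cycle gains. *)
Definition bridge H k (u w : G) := exists y P, [/\ uniq (y :: P), {subset y :: P <= H},
  edge u y, path (@edge G) y P & edge (last y P) w /\ k <= (size P).+1].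

Lemma bridge_sym H k u w : bridge H k u w -> bridge H k w u.
Proof.
case=> y [P [uP sP uy pP [Pw kP]]].
exists (last y P), (rev (belast y P)).
have eqr : last y P :: rev (belast y P) = rev (y :: P) by rewrite (lastI y P) rev_rcons.
rewrite eqr rev_uniq edge_sym; split=> //.
- by move=> v; rewrite mem_rev; apply: sP.
- by rewrite rev_path; apply: sub_path pP => a b; rewrite edge_sym.
rewrite size_rev size_belast; split=> //.
suff -> : last (last y P) (rev (belast y P)) = y by rewrite edge_sym.
by rewrite -[LHS]/(last y (last y P :: rev (belast y P))) eqr rev_cons last_rcons.
Qed.

Definition attached H (v : G) := [exists y, (y \in H) && edge v y].

Lemma bridge1 C H u w : component C H -> attached H u -> attached H w -> bridge H 1 u w.
Proof.
case=> _ _ conn /existsP[y /andP[yH uy]] /existsP[z /andP[zH wz]].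
have [R [h1 h2 h3 h4]] := conn _ _ yH zH.
by exists y, R; rewrite h4 [edge z w]edge_sym.
Qed.

Lemma bridge2 C H u w y z : component C H -> y \in H -> z \in H -> y != z ->
  edge u y -> edge w z -> bridge H 2 u w.
Proof.
move=> [_ _ conn] yH zH yz uy wz; have [R [h1 h2 h3 h4]] := conn _ _ yH zH.
exists y, R; rewrite h4 [edge z w]edge_sym; do !split=> //.
by case: R h4 {h1 h2 h3} => //= eqyz; rewrite eqyz eqxx in yz.
Qed.

Lemma linked_avoid C H u w : component C H -> ~~ attached H u -> linked C u w ->
  exists R, [/\ uniq R, {in R, forall y, y \notin C /\ y \notin H} &
    path (@edge G) u (rcons R w)].
Proof.
move=> [_ closed _] auN /linkedP[R [h1 h2 h3]]; exists R; split=> //.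
have {}h3 : path (@edge G) u R by move: h3; rewrite rcons_path => /andP[].
have first y : edge u y -> y \notin H.
  by move=> uy; apply: contra auN => yH; apply/existsP; exists y; rewrite yH.
suff : {in R, forall y, y \notin H} by move=> h y yR; split; [apply: h2|apply: h].
elim: R u first h2 h3 {h1 auN} => //= z R IH u first h2 /andP[uz pR] y.
have zH := first _ uz.
rewrite inE => /orP[/eqP->//|]; apply: (IH z) => //.
  by move=> t zt; apply: contra zH => tH; apply: (closed t); rewrite ?h2 ?mem_head // edge_sym.
by move=> t tR; apply: h2; rewrite inE tR orbT.
Qed.

Section Crossing.
Variables (C : seq G) (x0 : G) (H : {set G}).
Hypotheses (longC : longest C) (compH : component C H).
Local Notation "c_( k )" := (nth x0 C k).
Local Notation c := (size C).

Lemma cycle_sorted : sorted (@edge G) C.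
Proof.
case: longC => _ + _; case: C => //= y s.
by rewrite rcons_path => /andP[].
Qed.

Lemma cycle_close : 0 < c -> edge c_(c.-1) c_(0).
Proof.
by case: longC => _ + _; case: C => //= y s; rewrite rcons_path nth_last => /andP[].
Qed.

Lemma block_uniq y P R : uniq (y :: P) -> {subset y :: P <= H} -> uniq R ->
  {in R, forall z, z \notin C /\ z \notin H} -> uniq (C ++ (y :: P) ++ R).
Proof.
case: longC compH => uC _ _ [HC _ _] uP PH uR RCH.
rewrite 2!cat_uniq uC uP uR !andTb andbT; apply/andP; split.
  apply/hasPn => z; rewrite mem_cat => /orP[/PH /HC//|/RCH[]//].
by apply/hasPn => z /RCH[_]; apply: contra => /PH.
Qed.

(** The common form of all the reroutings below: [P] is a path inside the
    component, [R] a path outside both. *)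
Lemma block_reroute y P R (ps : seq stretch) :
    uniq (y :: P) -> {subset y :: P <= H} -> path (@edge G) y P -> uniq R ->
    {in R, forall z, z \notin C /\ z \notin H} -> sorted (@edge G) R ->
    all (fun p => (lo p <= hi p) && [|| hi p < c,
      (c <= lo p) && (hi p < c + (size P).+1) | (c + (size P).+1 <= lo p) && (hi p < c + (size P).+1 + size R)]) ps ->
    pairwise (fun p q => (hi p < lo q) || (hi q < lo p)) ps ->
    cycle (fun p q => edge (nth x0 (C ++ (y :: P) ++ R) (upto p))
                           (nth x0 (C ++ (y :: P) ++ R) (from q))) ps ->
  sumn [seq (hi p - lo p).+1 | p <- ps] <= c.
Proof.
move=> h1 h2 h3 h4 h5 h6; apply: (reroute3 (P := y :: P) longC) => //.
  exact: block_uniq.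
exact: cycle_sorted.
Qed.

Lemma block_nthC y P R k : k < c -> nth x0 (C ++ (y :: P) ++ R) k = c_(k).
Proof. by move=> kc; rewrite nth_cat kc. Qed.

Lemma block_nthP0 y P R : nth x0 (C ++ (y :: P) ++ R) c = y.
Proof. by rewrite nth_cat ltnn subnn. Qed.

Lemma block_nthP1 y P R : nth x0 (C ++ (y :: P) ++ R) (c + size P) = last y P.
Proof.
rewrite nth_cat (leq_gtF (leq_addr _ _)) addKn nth_cat /= ltnSn.
by rewrite -[size P]/((size (y :: P)).-1) nth_last.
Qed.

Lemma block_nthR0 y P z R : nth x0 (C ++ (y :: P) ++ z :: R) (c + (size P).+1) = z.
Proof.
by rewrite nth_cat (leq_gtF (leq_addr _ _)) addKn nth_cat /= ltnn subnn.
Qed.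

Lemma block_nthR1 y P z R :
  nth x0 (C ++ (y :: P) ++ z :: R) (c + (size P).+1 + size R) = last z R.
Proof.
rewrite nth_cat (leq_gtF _); last by rewrite -addnA leq_addr.
rewrite -addnA addKn nth_cat /= (leq_gtF (leq_addr _ _)) addKn.
by rewrite -[size R]/((size (z :: R)).-1) nth_last.
Qed.

Definition block_nth := (block_nthP0, block_nthP1, block_nthR0, block_nthR1).

Lemma block_reroute0 y P (ps : seq stretch) :
    uniq (y :: P) -> {subset y :: P <= H} -> path (@edge G) y P ->
    all (fun p => (lo p <= hi p) && [|| hi p < c,
      (c <= lo p) && (hi p < c + (size P).+1) | (c + (size P).+1 <= lo p) && (hi p < c + (size P).+1 + 0)]) ps ->
    pairwise (fun p q => (hi p < lo q) || (hi q < lo p)) ps ->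
    cycle (fun p q => edge (nth x0 (C ++ (y :: P) ++ [::]) (upto p))
                           (nth x0 (C ++ (y :: P) ++ [::]) (from q))) ps ->
  sumn [seq (hi p - lo p).+1 | p <- ps] <= c.
Proof. by move=> h1 h2 h3; apply: (block_reroute h1 h2 h3 (R := [::])). Qed.

Ltac walks0 h1 h2 h3 ps es :=
  have : sumn [seq (hi p - lo p).+1 | p <- ps] <= c by
    [apply: (block_reroute0 h1 h2 h3);
     [nums | nums
     | rewrite /= /from /upto /hi /lo /= ?block_nth ?block_nthC ?es //; nlia]];
  rewrite /= /hi /lo /=.

Ltac walks h1 h2 h3 h4 h5 h6 ps es :=
  have : sumn [seq (hi p - lo p).+1 | p <- ps] <= c by
    [apply: (block_reroute h1 h2 h3 h4 h5 h6);
     [nums | nums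
     | rewrite /= /from /upto /hi /lo /= ?block_nth ?block_nthC ?es //; nlia]];
  rewrite /= /hi /lo /=.

(** A longest cycle does not get longer when the arc between two attached vertices
    is replaced by the bridge. *)
Lemma gap_le a b k : a < b < c -> bridge H k c_(a) c_(b) -> a + k < b.
Proof.
move=> abc [y [P [h1 h2 ay h4 [bP kP]]]].
have cl : edge c_(c.-1) c_(0) by apply: cycle_close; nlia.
walks0 h1 h2 h4 [:: up 0 a; up c (c + size P); up b c.-1] (ay, bP, cl); nlia.
Qed.

Lemma gap_ge a b k : a < b < c -> bridge H k c_(a) c_(b) -> b - a + k < c.
Proof.
move=> abc /bridge_sym[y [P [h1 h2 ay h4 [bP kP]]]].
walks0 h1 h2 h4 [:: up a b; up c (c + size P)] (ay, bP); nlia.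
Qed.

(** Two crossing chords, one through the component and one, possibly through
    [R], outside it: the rerouted cycle skips the vertices strictly between
    [a] and [u] and strictly between [b] and [w]. *)
Lemma cross_succ a u b w k R : a < u -> u <= b -> b < w -> w < c ->
    bridge H k c_(a) c_(b) -> uniq R -> {in R, forall z, z \notin C /\ z \notin H} ->
    path (@edge G) c_(u) (rcons R c_(w)) ->
  k + size R <= (u - a.+1) + (w - b.+1).
Proof.
move=> au ub bw wc [y [P [h1 h2 ay h3 [bP kP]]]] h4 h5.
have cl : edge c_(c.-1) c_(0) by apply: cycle_close; nlia.
case: R h4 h5 => [|z R] h4 h5 /=.
  rewrite andbT => uw.
  walks0 h1 h2 h3 [:: dn b u; up w c.-1; up 0 a; up c (c + size P)] (ay, bP, cl, uw); nlia.
rewrite rcons_path => /and3P[uz h6 Rw].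
walks h1 h2 h3 h4 h5 h6 [:: dn b u;
  up (c + (size P).+1) (c + (size P).+1 + size R); up w c.-1; up 0 a; up c (c + size P)]
  (ay, bP, cl, uz, Rw); nlia.
Qed.

(** The mirror image. The index [b = c] stands for the vertex [0], reached at the
    end of the round. *)
Lemma cross_pred u a w b k R : u < a -> a <= w -> w < b -> b <= c ->
    bridge H k c_(a) c_(b %% c) -> uniq R ->
    {in R, forall z, z \notin C /\ z \notin H} ->
    path (@edge G) c_(u) (rcons R c_(w)) ->
  k + size R <= (a - u.+1) + (b - w.+1).
Proof.
move=> ua aw wb bc /bridge_sym.
have cl : edge c_(0) c_(c.-1) by rewrite edge_sym; apply: cycle_close; nlia.
have [->|bn] := eqVneq b c.
  rewrite modnn => -[y [P [h1 h2 ay h3 [bP kP]]]] h4 h5.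
  case: R h4 h5 => [|z R] h4 h5 /=.
    rewrite andbT edge_sym => uw.
    walks0 h1 h2 h3 [:: up a w; dn u 0; up c (c + size P)] (ay, bP, cl, uw); nlia.
  rewrite rcons_path edge_sym => /and3P[uz h6]; rewrite edge_sym => Rw.
  walks h1 h2 h3 h4 h5 h6 [:: up a w;
    dn (c + (size P).+1 + size R) (c + (size P).+1); dn u 0; up c (c + size P)]
    (ay, bP, cl, uz, Rw); nlia.
rewrite modn_small => [[y [P [h1 h2 ay h3 [bP kP]]]] h4 h5|]; last by nlia.
case: R h4 h5 => [|z R] h4 h5 /=.
  rewrite andbT edge_sym => uw.
  walks0 h1 h2 h3 [:: up a w; dn u 0; dn c.-1 b; up c (c + size P)] (ay, bP, cl, uw); nlia.
rewrite rcons_path edge_sym => /and3P[uz h6]; rewrite edge_sym => Rw.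
walks h1 h2 h3 h4 h5 h6 [:: up a w;
  dn (c + (size P).+1 + size R) (c + (size P).+1); dn u 0; dn c.-1 b; up c (c + size P)]
  (ay, bP, cl, uz, Rw); nlia.
Qed.

(** The next three facts drive the degree count. The vertices [c.-1] and [b] are
    attached; their successors [0] and [b.+1] are not joined outside the component,
    and on each arc the neighbours of the one keep away from those of the other. *)
Lemma succ_nonadj b k R : b < c.-1 -> bridge H k.+1 c_(c.-1) c_(b) ->
    uniq R -> {in R, forall z, z \notin C /\ z \notin H} ->
  ~~ path (@edge G) c_(0) (rcons R c_(b.+1)).
Proof.
move=> bc [y [P [h1 h2 ay h3 [bP kP]]]] h4 h5; apply/negP.
have {}bP : edge (last y P) c_(b) by [].
case: R h4 h5 => [|z R] h4 h5 /=.
  rewrite andbT => uw.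
  walks0 h1 h2 h3 [:: dn b 0; up b.+1 c.-1; up c (c + size P)] (ay, bP, uw); nlia.
rewrite rcons_path => /and3P[uz h6 Rw].
walks h1 h2 h3 h4 h5 h6 [:: dn b 0; up (c + (size P).+1) (c + (size P).+1 + size R);
  up b.+1 c.-1; up c (c + size P)] (ay, bP, uz, Rw); nlia.
Qed.

Lemma far_right b u w k : b < u -> u < w -> w < c -> bridge H k c_(c.-1) c_(b) ->
  edge c_(0) c_(u) -> edge c_(b.+1) c_(w) -> u + k < w.
Proof.
move=> bu uw wc [y [P [h1 h2 ay h3 [bP kP]]]] eu ew.
walks0 h1 h2 h3 [:: dn b 0; dn u b.+1; up w c.-1; up c (c + size P)] (ay, bP, eu, ew); nlia.
Qed.

Lemma far_left b u w k : u < w -> w <= b -> b < c.-1 -> bridge H k c_(c.-1) c_(b) ->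
  edge c_(b.+1) c_(u) -> edge c_(0) c_(w) -> u + k < w.
Proof.
move=> uw wb bc /bridge_sym[y [P [h1 h2 ay h3 [bP kP]]]] eu ew.
walks0 h1 h2 h3 [:: dn c.-1 b.+1; dn u 0; up w b; up c (c + size P)] (ay, bP, eu, ew); nlia.
Qed.

End Crossing.
End Components.

(** * Degree sums of two successors *)

(** Shifted by one, [X] is disjoint from [Y], and next to each element of [S] both
    miss an index. The partial sums may run ahead by one unit: an index in [S] and
    in [X] is paid for by the next one, which then lies in none of the sets. *)
Lemma arc_count (X Y S : pred nat) n :
    (forall u w, u < w <= n -> X u -> Y w -> u + 2 < w) ->
    (forall t, t < n -> S t -> ~~ X t.+1 /\ ~~ Y t.+1) ->
    (forall t, t < n -> S t -> ~~ S t.+1) -> (0 < n -> ~~ S n.-1) -> ~~ Y 0 ->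
  \sum_(i < n.+1) X i + \sum_(i < n.+1) Y i + \sum_(i < n) S i <= n.+1.
Proof.
move=> XY SXY SS SN Y0.
suff h j : j <= n ->
    \sum_(i < j) (X i + Y i.+1 + S i) <= j + [&& 0 < j, S j.-1 & X j.-1].
  rewrite big_ord_recr [X in _ + X + _]big_ord_recl /= (negbTE Y0) add0n.
  have -> : \sum_(i < n) Y (bump 0 i) = \sum_(i < n) Y i.+1 by apply: eq_bigr.
  move: (h n (leqnn n)); rewrite !big_split /=.
  rewrite (_ : [&& _, _ & _] = false) ?addn0; last by case: (posnP n) SN => [->|n0 /(_ isT)/negbTE->] //; rewrite andbF.
  case: (X n); lia.
elim: j => [|j IH] jn; first by rewrite big_ord0.
have step (x y s p : bool) m : (x -> ~~ y) -> (s -> ~~ y) -> (p -> [/\ ~~ x, ~~ s & ~~ y]) ->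
    m <= j + p -> m + (x + y + s) <= j.+1 + (s && x).
  by case: x; case: y; case: s; case: p => //= h1 h2 h3; try (by case: h3);
    try (by move: (h1 isT)); try (by move: (h2 isT)); lia.
rewrite big_ord_recr /=; apply: step (IH (ltnW jn)).
- by move=> Xj; apply/negP => /(XY j j.+1 _ Xj); rewrite ltnS leqnn jn => /(_ isT); lia.
- by case/(SXY j jn).
- case: j jn {IH} => //= j jn /andP[Sj Xj]; have [h1 _] := SXY j (ltnW jn) Sj.
  split=> //; first exact: SS (ltnW jn) Sj.
  by apply/negP => /(XY j j.+2 _ Xj); rewrite jn ltnS leqnSn => /(_ isT); lia.
Qed.

Section TwoSuccessors.
Variable G : sgraph.
Implicit Types (C P R : seq G) (H : {set G}).

Lemma sum_nth C x0 (p : pred G) : \sum_(i < size C) p (nth x0 C i) = count p C.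
Proof.
rewrite -sum1_count [RHS]big_mkcond /= [RHS](big_nth x0) big_mkord.
by apply: eq_bigr => i _; case: p.
Qed.

Lemma card_cycle C (p : pred G) : uniq C -> #|[set v in C | p v]| = count p C.
Proof.
move=> uC; rewrite -size_filter -(card_uniqP (filter_uniq p uC)).
by apply: eq_card => v; rewrite inE mem_filter andbC.
Qed.

Lemma longest_rot i C : longest C -> longest (rot i C).
Proof. by case=> uC cC mC; split; rewrite ?rot_uniq ?rot_cycle // size_rot. Qed.

Lemma component_rot i C H : component C H -> component (rot i C) H.
Proof.
by case=> h1 h2 h3; split=> // [y yH|u v uH]; rewrite mem_rot; [apply: h1|apply: h2].
Qed.

Lemma rot_head C v : v \in C -> exists i (s : seq G), rot i C = v :: s :> seq G.
Proof. by case/rot_to=> i s e; exists i, s. Qed.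

Lemma rot_end C v : v \in C -> exists i (s : seq G), rot i C = rcons s v :> seq G.
Proof.
move=> vC; have vi : index v C < size C by rewrite index_mem.
exists (index v C).+1, (drop (index v C).+1 C ++ take (index v C) C).
by rewrite /rot (take_nth v vi) nth_index // -rcons_cat.
Qed.

(** The successors of [v] and [w] have no common neighbour outside the cycle and no
    neighbour in [H]. On the cycle their degrees are bounded by [arc_count] on both
    arcs, where the two neighbourhoods exchange their roles; every attachment other
    than [v] and [w] saves one more vertex. *)
Lemma two_successors C H d v w : (forall x : G, d <= degree x) ->
    longest C -> component C H -> v \in C -> w \in C -> v != w -> bridge H 2 v w ->
  d.*2 + #|H| + #|[set u in C | attached H u]| <= #|G| + 2.
Proof.
move=> deg longC compH vC wC vw br.
have [i [s eqC]] := rot_end vC.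
have {longC} longC := longest_rot i longC; have {compH} compH := component_rot i compH.
have -> : [set u in C | attached H u] = [set u in rot i C | attached H u].
  by apply/setP => u; rewrite !inE mem_rot.
have {wC} : w \in rot i C by rewrite mem_rot.
rewrite {}eqC in longC compH *; move: (rcons s v) (last_rcons v s v) longC compH => {vC} {}C.
move=> endC longC compH wC {s i}.
have [b bc cw] : exists2 b, b < size C & nth v C b = w.
  by exists (index w C); rewrite ?index_mem ?nth_index.
have cv : nth v C (size C).-1 = v by rewrite nth_last.
have bc' : b < (size C).-1.
  suff : b != (size C).-1 by nlia.
  by apply: contraNneq vw => eqb; rewrite -cw -[X in X == _]cv eqb.
have [uC _ _] := longC.
have [n eqc] : exists n, size C = b.+1 + n.+1.
  by exists ((size C).-1 - b.+1); nlia.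
have attE : bridge H 2 v w -> attached H v /\ attached H w.
  case=> y [P [_ sub vy _ [yw _]]]; split; apply/existsP.
    by exists y; rewrite vy sub ?mem_head.
  by exists (last y P); rewrite edge_sym yw sub ?mem_last.
have {attE} [av aw] := attE br.
have hR : {in [::], forall z : G, z \notin C /\ z \notin H} by [].
have br1 j k : attached H (nth v C j) -> attached H (nth v C k) ->
  bridge H 1 (nth v C j) (nth v C k) by apply: bridge1 compH.
have noS j : j.+1 < size C -> attached H (nth v C j) -> ~~ attached H (nth v C j.+1).
  by move=> jc aj; apply/negP => /(br1 j _ aj)/(gap_le longC compH); rewrite ltnSn jc => /(_ isT); nlia.
have no0 j : j < (size C).-1 -> attached H (nth v C j) -> ~~ edge (nth v C 0) (nth v C j.+1).
  move=> jc aj; have := br1 (size C).-1 j; rewrite cv => /(_ av aj) brj.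
  by have := @succ_nonadj _ _ v _ longC compH j 0 [::] jc; rewrite cv /= andbT; apply.
have nob j k : j < k -> k.+1 < size C -> attached H (nth v C j) -> attached H (nth v C k) ->
    ~~ edge (nth v C j.+1) (nth v C k.+1).
  move=> jk kc aj ak; apply/negP => e.
  have := @cross_succ _ _ v _ longC compH j j.+1 k k.+1 1 [::] (ltnSn j) jk (ltnSn k) kc.
  by rewrite /= andbT !subnn addn0 => /(_ (br1 _ _ aj ak) isT hR e).
pose X j := edge (nth v C 0) (nth v C j); pose Y j := edge (nth v C b.+1) (nth v C j).
pose S j := attached H (nth v C j).
have left : \sum_(j < b.+1) Y j + \sum_(j < b.+1) X j + \sum_(j < b) S j <= b.+1.
  apply: arc_count => [j k /andP[jk kb] Yj Xk|t tb St|t tb|b0|].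
  - by apply: (far_left longC compH jk kb bc' _ Yj Xk); rewrite cv cw.
  - split; last by apply: no0 => //; nlia.
    by rewrite /Y edge_sym; apply: nob => //; rewrite ?cw //; nlia.
  - by apply: noS; nlia.
  - by apply/negP => Sb; have := noS b.-1 _ Sb; rewrite prednK // cw aw => /(_ bc).
  - by rewrite /X edge_irrefl.
have right : \sum_(j < n.+1) X (b.+1 + j) + \sum_(j < n.+1) Y (b.+1 + j)
    + \sum_(j < n) S (b.+1 + j) <= n.+1.
  apply: (@arc_count (fun j => X (b.+1 + j)) (fun j => Y (b.+1 + j)) (fun j => S (b.+1 + j))).
  - move=> j k /andP[jk kb] Xj Yk.
    suff : b.+1 + j + 2 < b.+1 + k by nlia.
    by apply: (far_right longC compH _ _ _ _ Xj Yk); rewrite ?cv ?cw //; nlia.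
  - move=> t tb St; rewrite addnS; split; first by apply: no0 => //; nlia.
    by apply: nob => //; rewrite ?cw //; nlia.
  - by move=> t tb St; rewrite addnS; apply: noS => //; nlia.
  - move=> n0; apply/negP => Sb; have bn : (b.+1 + n.-1).+1 < size C by nlia.
    have := noS _ bn Sb; rewrite (_ : (b.+1 + n.-1).+1 = (size C).-1) ?cv ?av //; nlia.
  - by rewrite addn0 /Y edge_irrefl.
have split p : count p C = \sum_(j < b.+1) p (nth v C j) + \sum_(j < n.+1) p (nth v C (b.+1 + j)).
  by rewrite -(sum_nth C v) eqc big_split_ord.
have cS : #|[set u in C | attached H u]| = \sum_(j < b) S j + 1 + (\sum_(j < n) S (b.+1 + j) + 1).
  rewrite card_cycle // split !big_ord_recr /= cw aw.
  by rewrite (_ : b.+1 + n = (size C).-1) ?cv ?av //; nlia.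
pose out x := #|[set y | edge x y] :\: [set y in C]|.
have degE x : degree x = count (edge x) C + out x.
  rewrite /degree -(cardsID [set y in C]) -card_cycle //; congr (#|pred_of_set _| + _).
  by apply/setP => y; rewrite !inE andbC.
have outs : out (nth v C 0) + out (nth v C b.+1) + #|H| + size C <= #|G|.
  have b1c : b.+1 < size C by nlia.
  have dis (A B : {set G}) : [disjoint A & B] -> #|A| + #|B| = #|A :|: B|.
    by move=> /disjoint_setI0 AB; rewrite cardsU AB cards0 subn0.
  rewrite /out dis; last first.
    rewrite -setI_eq0; apply/eqP/setP => y; rewrite !inE; apply/negbTE/negP.
    case/andP => /andP[yC ey] /andP[_ ey'].
    have yH : {in [:: y], forall z, z \notin C /\ z \notin H}.
      move=> z; rewrite inE => /eqP ->; split=> //; apply/negP => yH.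
      have : attached H (nth v C b) by rewrite cw.
      by move/(noS _ b1c)/existsP; case; exists y; rewrite yH.
    have := @succ_nonadj _ _ v _ longC compH b 1 [:: y] bc'; rewrite cv cw.
    by move=> /(_ br isT yH); rewrite /= ey [edge y _]edge_sym ey'.
  rewrite dis; last first.
    rewrite -setI_eq0; apply/eqP/setP => y; rewrite !inE; apply/negbTE/negP.
    case/andP => /orP[]/andP[_ ey] yH.
      have c0 : 0 < size C by nlia.
      have a0 : attached H (nth v C 0) by apply/existsP; exists y; rewrite yH.
      have := br1 0 (size C).-1 a0; rewrite cv => /(_ av).
      move=> br0; have := @gap_ge _ _ v _ longC compH 0 (size C).-1 1.
      by rewrite cv => /(_ _ br0); nlia.
    have : attached H (nth v C b) by rewrite cw.
    by move/(noS _ b1c)/existsP; case; exists y; rewrite yH.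
  have -> : size C = #|[set y in C]| by rewrite cardsE; apply/esym/card_uniqP.
  rewrite dis ?max_card // -setI_eq0; apply/eqP/setP => y; rewrite !inE.
  apply/negbTE/negP => /andP[+ yC]; rewrite yC /= => yH.
  by case: compH => /(_ _ yH); rewrite yC.
have := deg (nth v C 0); have := deg (nth v C b.+1); rewrite !degE !split cS.
move: left right outs; rewrite {}/X {}/Y eqc.
clear; move: (out _) (out _) => o1 o2; nlia.
Qed.

End TwoSuccessors.

(** * Gaps between the attachments of a component *)

Lemma spaced_count (E : pred nat) s p n : 0 < s ->
    (forall i j, p <= i < j -> j <= p + n -> E i -> E j -> i + s <= j) ->
    E (p + n) -> count E (iota p n) * s <= n.
Proof.
move=> s0; elim: n {-2}n (leqnn n) p => [|N IH] n nN p sp En.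
  by move: nN; rewrite leqn0 => /eqP ->.
case: n nN sp En => [|n] nN sp En //=.
have [Ep|nEp] := boolP (E p); last first.
  rewrite add0n; apply: leqW; apply: IH; [nlia| |by rewrite addSnnS].
  by move=> i j h1 h2; apply: sp; nlia.
have sn : s <= n.+1.
  have : p + s <= p + n.+1 by apply: sp => //; nlia.
  by nlia.
have -> : iota p.+1 n = iota p.+1 s.-1 ++ iota (p + s) (n.+1 - s).
  by rewrite (_ : p + s = p.+1 + s.-1) -?iotaD; [congr iota|]; nlia.
rewrite count_cat (_ : count E (iota p.+1 s.-1) = 0); last first.
  apply/eqP; rewrite -leqn0 leqNgt -has_count; apply/hasPn => j; rewrite mem_iota => hj.
  apply/negP => Ej; have : p + s <= j by apply: sp => //; nlia.
  by nlia.
have IHn : count E (iota (p + s) (n.+1 - s)) * s <= n.+1 - s.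
  apply: IH; [nlia| |by rewrite (_ : p + s + _ = p + n.+1) //; nlia].
  by move=> i j h1 h2; apply: sp; nlia.
by rewrite add0n mulnDl mul1n; nlia.
Qed.

Section Spacing.
Variables (G : sgraph) (C : seq G) (x0 : G) (H : {set G}).
Hypotheses (longC : longest C) (compH : component C H).
Local Notation "c_( k )" := (nth x0 C k).
Local Notation c := (size C).
Local Notation S := [set u in C | attached H u].

Lemma hR : {in [::], forall z, z \notin C /\ z \notin H}. Proof. by []. Qed.

(** Two vertices are bad if they see at most one vertex of [H] between them, the
    same one; all other pairs of attachments are joined through two vertices. *)
Definition bad u v := [exists x, (x \in H) &&
  [forall y, (y \in H) && (edge u y || edge v y) ==> (y == x)]].

Lemma badP u v : reflect (exists2 x, x \in H &
  forall y, y \in H -> edge u y || edge v y -> y = x) (bad u v).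
Proof.
apply: (iffP existsP) => [[x /andP[xH /forallP h]]|[x xH h]]; exists x => //.
  by move=> y yH e; apply/eqP; move: (h y); rewrite yH e.
by rewrite xH; apply/forallP => y; apply/implyP => /andP[yH e]; apply/eqP/h.
Qed.

Lemma bad_sym u v : bad u v = bad v u.
Proof. by apply/badP/badP => -[x xH h]; exists x => // y yH e; apply: h; rewrite // orbC. Qed.

Lemma bad_trans u v w : attached H v -> bad u v -> bad v w -> bad u w.
Proof.
case/existsP=> z /andP[zH vz] /badP[x xH h] /badP[y yH h'].
have eqxy : x = y by rewrite -(h z zH) ?vz ?orbT // -(h' z zH) ?vz.
apply/badP; exists x => // t tH /orP[e|e]; first by apply: h; rewrite ?e.
by rewrite eqxy; apply: h'; rewrite ?e ?orbT.
Qed.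

Lemma not_bad_bridge u v : attached H u -> attached H v -> ~~ bad u v -> bridge H 2 u v.
Proof.
case/existsP=> y /andP[yH uy] /existsP[z /andP[zH vz]] /badP nb.
have [eqyz|ne] := eqVneq y z; last exact: bridge2 compH yH zH ne uy vz.
subst z.
have [/existsP[t /and3P[tH e ty]]|no] :=
    boolP [exists t, [&& t \in H, edge u t || edge v t & t != y]].
  case/orP: e => e; first exact: bridge2 compH tH yH ty e vz.
  by apply: bridge2 compH yH tH _ uy e; rewrite eq_sym.
case: nb; exists y => // t tH e; apply/eqP; apply: contraR no => ty.
by apply/existsP; exists t; rewrite tH e.
Qed.

Hypothesis c2 : 1 < c.
Hypothesis att0 : attached H c_(0).
(** Indices run modulo the length: [c] is the vertex [0] again, so that the arcs
    before and after an index are treated alike. *)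
Let E k := attached H c_(k %% c).

Lemma E_lt k : k < c -> E k = attached H c_(k). Proof. by move=> kc; rewrite /E modn_small. Qed.
Lemma E_end : E c. Proof. by rewrite /E modnn. Qed.

Lemma spacing p q k : p < q <= c -> (p == 0) && (q == c) = false ->
  bridge H k c_(p %% c) c_(q %% c) -> p + k < q.
Proof.
move=> pqc pq br; have [eqc|qc] := eqVneq q c.
  have p0 : 0 < p < c by move: pq; rewrite eqc eqxx andbT; nlia.
  move: br; rewrite eqc modnn modn_small; last by nlia.
  by move/bridge_sym/(gap_ge longC compH p0); nlia.
by apply: (@gap_le _ _ x0 _ longC compH); [nlia|move: br; rewrite !modn_small; nlia || done].
Qed.

Lemma card_attached : #|S| = count E (iota 0 c).
Proof.
case: longC => uC _ _; rewrite card_cycle // -[in LHS](mkseq_nth x0 C) count_map.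
by apply: eq_in_count => i; rewrite mem_iota => /andP[_ ic]; rewrite /= E_lt.
Qed.

Lemma mem_attached k : k < c -> (c_(k) \in S) = attached H c_(k).
Proof. by move=> kc; rewrite inE mem_nth. Qed.

Lemma prev_attached u : u < c -> exists a, [/\ a <= u, E a & forall k, a < k <= u -> ~~ E k].
Proof.
elim: u => [|u IH] uc; first by exists 0; split=> //; [rewrite E_lt|move=> k; lia].
have [Eu|nE] := boolP (E u.+1); first by exists u.+1; split=> // k; nlia.
have [a [h1 h2 h3]] := IH (ltnW uc); exists a; split=> //; first exact: leqW.
by move=> k hk; have [->//|ne] := eqVneq k u.+1; apply: h3; nlia.
Qed.

Lemma next_attached u : u < c ->
  exists a, [/\ u < a <= c, E a & forall k, u < k < a -> ~~ E k].
Proof.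
move=> uc; pose P a := (u < a <= c) && E a.
have exP : exists a, P a by exists c; rewrite /P uc leqnn E_end.
case: (ex_minnP exP) => a /andP[h1 h2] h3; exists a; split=> // k hk.
by apply/negP => Ek; have := h3 k; rewrite /P Ek; nlia.
Qed.

(** The gaps between attachments have at least [k] vertices, which gives
    [k.+1 * #|S|]. Toughness links two segments, and the link crosses the bridge of
    the attachments before its ends as well as that of the attachments after
    them: both crossings together leave two more vertices in the two segments. *)
Lemma long_cycle k x : tough_over1 G -> 0 < k -> 1 < #|S| ->
    x \in H -> x \notin C -> (forall y, connect (off C) x y -> y \in H) ->
    (forall u v, u \in S -> v \in S -> u != v -> bridge H k u v) ->
  k.+1 * #|S| + 2 <= c.
Proof.
move=> tough k0 S2 xH xC connH br.
have uC : uniq C by case: longC.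
have SC : {subset S <= C} by move=> v; rewrite inE => /andP[].
have brE p q : p < q <= c -> (p == 0) && (q == c) = false -> E p -> E q ->
    bridge H k c_(p %% c) c_(q %% c).
  move=> pqc pq Ep Eq; have lt j : j %% c < c by rewrite ltn_mod; nlia.
  apply: br; rewrite ?mem_attached //.
  rewrite nth_uniq //; have [e|qc] := eqVneq q c.
    by move: pq; rewrite e modnn modn_small ?eqxx ?andbT; nlia.
  by rewrite !modn_small; nlia.
have spk p q : p < q <= c -> (p == 0) && (q == c) = false -> E p -> E q -> p + k < q.
  by move=> h1 h2 h3 h4; apply: spacing => //; apply: brE.
have S1 p : p.+1 < c -> c_(p) \in S -> c_(p.+1) \notin S.
  move=> pc; rewrite !mem_attached // ?(ltnW pc) // -!E_lt ?(ltnW pc) // => Ep.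
  apply/negP => Eq; have : p + k < p.+1 by apply: spk => //; nlia.
  nlia.
have T_end : c_(c.-1) \notin S.
  have cc : c.-1 < c by nlia.
  rewrite mem_attached // -E_lt //.
  apply/negP => Ep; have : c.-1 + k < c by apply: spk; rewrite ?E_end //; nlia.
  nlia.
have [|] := @segments_linked G C x0 S tough uC SC T_end S1 x 0 0 S2 xC _.
  move=> y v xy vC yv; rewrite inE vC /=; apply/existsP; exists y.
  by rewrite (connH _ xy) edge_sym.
move=> u0 [w0 [[u0c w0c u0S w0S uw0] [ne _ _]]].
have [u [w [uw wc uS wS [lk segs]]]] : exists u w, [/\ u < w, w < c, c_(u) \notin S, c_(w) \notin S &
    linked C c_(u) c_(w) /\ seg C S u < seg C S w].
  have [lt|lt|e] := ltngtP (seg C S u0) (seg C S w0); last by rewrite e eqxx in ne.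
    by exists u0, w0; split=> //; rewrite ltnNge; apply/negP => /(leq_seg C S); nlia.
  exists w0, u0; split=> //; first by rewrite ltnNge; apply/negP => /(leq_seg C S); nlia.
  by rewrite linked_sym.
have [a [au Ea aN]] := prev_attached (ltn_trans uw wc).
have [a' [a'u Ea' a'N]] := next_attached (ltn_trans uw wc).
have [b [bw Eb bN]] := prev_attached wc.
have [b' [b'w Eb' b'N]] := next_attached wc.
have nE j : j < c -> c_(j) \notin S -> ~~ E j by move=> jc; rewrite mem_attached // -E_lt.
have nEu := nE u (ltn_trans uw wc) uS; have nEw := nE w wc wS.
have [t utw tS] := seg_lt x0 segs wc.
have Et : E t by rewrite E_lt -?mem_attached //; nlia.
have ltau : a < u by rewrite ltn_neqAle au andbT; apply: contraNneq nEu => <-.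
have ltbw : b < w by rewrite ltn_neqAle bw andbT; apply: contraNneq nEw => <-.
have ltb'w : w < b' by case/andP: b'w.
have a't : a' <= t by rewrite leqNgt; apply/negP => h; move: Et; apply/negP/a'N; nlia.
have tb : t <= b by rewrite leqNgt; apply/negP => h; move: Et; apply/negP/bN; nlia.
have tw : t < w by nlia.
have uNH : ~~ attached H c_(u) by rewrite -E_lt //; nlia.
have [R [uR RCH pR]] := linked_avoid compH uNH lk.
have cr1 : k + size R <= (u - a.+1) + (w - b.+1).
  apply: (cross_succ longC compH ltau _ ltbw wc _ uR RCH pR); first by nlia.
  have : bridge H k c_(a %% c) c_(b %% c) by apply: brE => //; nlia.
  by rewrite !modn_small //; nlia.
have cr2 : k + size R <= (a' - u.+1) + (b' - w.+1).
  apply: (cross_pred longC compH _ _ ltb'w _ _ uR RCH pR); try nlia.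
  have : bridge H k c_(a' %% c) c_(b' %% c) by apply: brE => //; nlia.
  by rewrite (@modn_small a') //; nlia.
have one p q : p < q -> E p -> (forall j, p < j < q -> ~~ E j) -> count E (iota p (q - p)) = 1.
  move=> pq Ep no; rewrite -(subnSK pq) /= Ep.
  rewrite (_ : count _ _ = 0) // -[RHS](count_pred0 (iota p.+1 (q - p.+1))).
  by apply: eq_in_count => j; rewrite mem_iota => hj; apply/negbTE/no; nlia.
have sp p q : p <= q <= c -> (p == 0) && (q == c) = false -> E q ->
    count E (iota p (q - p)) * k.+1 <= q - p.
  move=> pq pq0 Eq; apply: spaced_count => //; last by rewrite subnKC //; nlia.
  move=> i j h1 h2 Ei Ej; rewrite addnS; apply: spk => //; first by nlia.
  by move: pq0; nlia.
rewrite card_attached (_ : iota 0 c = iota 0 (a - 0) ++ iota a (a' - a) ++ iota a' (b - a') ++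
    iota b (b' - b) ++ iota b' (c - b')); last first.
  have cat p q r : p <= q <= r -> iota p (q - p) ++ iota q (r - q) = iota p (r - p).
    by move=> pqr; rewrite (_ : r - p = (q - p) + (r - q)) ?iotaD ?subnKC //; nlia.
  by rewrite !cat ?subn0 //; nlia.
have onea : count E (iota a (a' - a)) = 1.
  apply: one => // [|j hj]; first by nlia.
  by have [ju|ju] := leqP j u; [apply: aN|apply: a'N]; nlia.
have oneb : count E (iota b (b' - b)) = 1.
  apply: one => // [|j hj]; first by nlia.
  by have [jw|jw] := leqP j w; [apply: bN|apply: b'N]; nlia.
have sp1 : count E (iota 0 (a - 0)) * k.+1 <= a - 0 by apply: sp => //; nlia.
have sp2 : count E (iota a' (b - a')) * k.+1 <= b - a' by apply: sp => //; nlia.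
have sp3 : count E (iota b' (c - b')) * k.+1 <= c - b' by apply: sp; rewrite ?E_end //; nlia.
rewrite !count_cat onea oneb mulnC !mulnDl; move: sp1 sp2 sp3; move: (count _ _ * _) (count _ _ * _) (count _ _ * _).
by move=> n1 n2 n3; nlia.
Qed.

Lemma count_split (p : pred nat) a b d : a <= b <= d ->
  count p (iota a (d - a)) = count p (iota a (b - a)) + count p (iota b (d - b)).
Proof.
by move=> abd; rewrite -count_cat (_ : d - a = (b - a) + (d - b)) ?iotaD ?subnKC //; nlia.
Qed.

Lemma gap2 p q : p < q <= c -> (p == 0) && (q == c) = false -> E p -> E q -> p + 1 < q.
Proof. by move=> h1 h2 Ep Eq; apply: spacing => //; apply: bridge1 compH Ep Eq. Qed.

Lemma gap3 p q : p < q <= c -> (p == 0) && (q == c) = false -> E p -> E q ->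
  ~~ bad c_(p %% c) c_(q %% c) -> p + 2 < q.
Proof. by move=> h1 h2 Ep Eq nb; apply: spacing => //; apply: not_bad_bridge. Qed.

Lemma count_one p q : p < q -> E p -> (forall j, p < j < q -> ~~ E j) ->
  count E (iota p (q - p)) = 1.
Proof.
move=> pq Ep no; rewrite -(subnSK pq) /= Ep.
rewrite (_ : count _ _ = 0) // -[RHS](count_pred0 (iota p.+1 (q - p.+1))).
by apply: eq_in_count => j; rewrite mem_iota => hj; apply/negbTE/no; nlia.
Qed.

Lemma even_arc p q : 0 < p -> p <= q <= c -> E q -> 2 * count E (iota p (q - p)) <= q - p.
Proof.
move=> p0 pq Eq; rewrite mulnC; apply: spaced_count => //; last by rewrite subnKC //; nlia.
move=> i j h1 h2 Ei Ej; have : i + 1 < j by apply: gap2 => //; nlia.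
by nlia.
Qed.

(** Going around an arc whose ends are not bad, badness has to fail at some
    pair of consecutive attached vertices, and there the gap is at least 3. *)
Lemma odd_arc p q : p < q <= c -> (p == 0) && (q == c) = false -> E p -> E q ->
    ~~ bad c_(p %% c) c_(q %% c) ->
  2 * count E (iota p (q - p)) + 1 <= q - p.
Proof.
have [n] := ubnP (q - p); elim: n p => // n IH p qn pq pq0 Ep Eq nb.
have pc : p < c by nlia.
have [a [pa Ea aN]] := next_attached pc.
have aq : a <= q by rewrite leqNgt; apply/negP => qa; move: Eq; apply/negP/aN; nlia.
rewrite (@count_split E p a q) ?(count_one _ Ep aN); try nlia.
have [eqaq|neaq] := eqVneq a q.
  by have := gap3 pq pq0 Ep Eq nb; rewrite eqaq subnn /=; nlia.
have pa0 : (p == 0) && (a == c) = false by nlia.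
have [ba|nba] := boolP (bad c_(p %% c) c_(a %% c)).
  have paq : p + 1 < a by apply: gap2 => //; nlia.
  have : 2 * count E (iota a (q - a)) + 1 <= q - a.
    apply: IH => //; try nlia.
    by apply: contra nb => /(bad_trans Ea ba).
  by nlia.
have paq : p + 2 < a by apply: gap3.
have : 2 * count E (iota a (q - a)) <= q - a by apply: even_arc => //; nlia.
by nlia.
Qed.

(** Badness is transitive, so that both arcs between a pair that is not bad contain
    a gap with a third vertex. *)
Lemma two_long_gaps b : 0 < b < c -> E b -> ~~ bad c_(0) c_(b) -> 2 * #|S| + 2 <= c.
Proof.
move=> bc Eb nb; rewrite card_attached -[X in iota 0 X]subn0 (@count_split E 0 b c); last by nlia.
have E0 : E 0 by rewrite E_lt //; nlia.
have : 2 * count E (iota 0 (b - 0)) + 1 <= b - 0.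
  by apply: odd_arc => //; [nlia|nlia|rewrite mod0n modn_small //; nlia].
have : 2 * count E (iota b (c - b)) + 1 <= c - b.
  apply: odd_arc; rewrite ?E_end //; try nlia.
  by rewrite modnn bad_sym modn_small //; nlia.
by nlia.
Qed.

Lemma half_arc p q : p < q <= c -> (p == 0) && (q == c) = false -> E p -> E q ->
    (forall i j, p <= i < j -> j <= q -> ~~ ((i == p) && (j == q)) -> E i -> E j ->
       ~~ bad c_(i %% c) c_(j %% c)) ->
  3 * count E (iota p (q - p)) <= q - p \/
  count E (iota p (q - p)) = 1 /\ p + 1 < q.
Proof.
move=> pq pq0 Ep Eq nb; have pc : p < c by nlia.
have [a [pa Ea aN]] := next_attached pc.
have [qa|aq] := leqP q a.
  by right; split; [apply: count_one => // [|j hj]; [|apply: aN]; nlia|apply: gap2].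
left; rewrite mulnC; apply: spaced_count => //; last by rewrite subnKC //; nlia.
have g3 i j : p <= i < j -> j <= q -> ~~ ((i == p) && (j == q)) -> E i -> E j -> i + 2 < j.
  by move=> h1 h2 h3 Ei Ej; apply: gap3; rewrite ?nb //; nlia.
move=> i j h1 h2 Ei Ej; have [/andP[/eqP-> /eqP->]|ne] := boolP ((i == p) && (j == q)).
  have : p + 2 < a by apply: g3 => //; nlia.
  have : a + 2 < q by apply: g3 => //; nlia.
  by nlia.
have : i + 2 < j by apply: g3 => //; nlia.
by nlia.
Qed.

(** A bad pair of consecutive attachments costs one vertex of one gap; as there is
    a third attachment, the pair is not consecutive on both sides. *)
Lemma one_bad_pair b : 0 < b < c -> E b -> 2 < #|S| ->
    (forall i j, i < j < c -> ~~ ((i == 0) && (j == b)) -> E i -> E j -> ~~ bad c_(i) c_(j)) ->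
  3 * #|S| <= c + 1.
Proof.
move=> bc Eb; rewrite card_attached -[X in iota 0 X]subn0 (@count_split E 0 b c); last by nlia.
move=> S3 nb; have E0 : E 0 by rewrite E_lt //; nlia.
have [] : 3 * count E (iota 0 (b - 0)) <= b - 0 \/
    count E (iota 0 (b - 0)) = 1 /\ 0 + 1 < b.
- apply: half_arc => //; try nlia; move=> i j h1 h2 h3 Ei Ej.
  by rewrite !modn_small; [apply: nb => //; nlia|nlia|nlia].
- have [] : 3 * count E (iota b (c - b)) <= c - b \/
      count E (iota b (c - b)) = 1 /\ b + 1 < c.
  + apply: half_arc; rewrite ?E_end //; try nlia; move=> i j h1 h2 h3 Ei Ej.
    have [ejc|njc] := eqVneq j c.
      rewrite ejc modnn modn_small; last by nlia.
      by rewrite bad_sym; apply: nb => //; nlia.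
    by rewrite !modn_small; [apply: nb => //; nlia|nlia|nlia].
  + by nlia.
  + by nlia.
- have [] : 3 * count E (iota b (c - b)) <= c - b \/
      count E (iota b (c - b)) = 1 /\ b + 1 < c.
  + apply: half_arc; rewrite ?E_end //; try nlia; move=> i j h1 h2 h3 Ei Ej.
    have [ejc|njc] := eqVneq j c.
      rewrite ejc modnn modn_small; last by nlia.
      by rewrite bad_sym; apply: nb => //; nlia.
    by rewrite !modn_small; [apply: nb => //; nlia|nlia|nlia].
  + by nlia.
  + by nlia.
Qed.

End Spacing.

(** * Exhaustive search for graphs without long cycles *)

(** The small cases are settled by computation. A partial graph on the vertices
    [0, 1, ..] is kept as adjacency lists [P] of the edges that are present together
    with a list [U] of undecided pairs; all other pairs are known not to be edges.
    Two adjacent ends of a path with [c] edges would close a cycle longer than [c].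
    The search drops the undecided pairs that do so, and branches over a list of
    undecided pairs one of which has to be an edge, by the degree of a vertex or by
    the toughness at a cut. *)
Definition nbrs (P : seq (seq nat)) u := nth [::] P u.

(** Depth-first search for a path with at least [k] more edges from [u] to [v] that
    avoids [vis]. The conditionals keep the evaluation lazy. *)
Fixpoint far fuel (P : seq (seq nat)) k vis v u :=
  if u == v then k == 0 else
  if fuel is f.+1 then
    (fix some ws := if ws is w :: ws' then
       if w \in vis then some ws' else
       if far f P k.-1 (w :: vis) v w then true else some ws'
     else false) (nbrs P u)
  else false.

(** Labels for the components outside [T] of the graph of the present edges. Nothing
    has to be proved about them, since [splits] tests the result. *)
Definition merge_labels (P : seq (seq nat)) (T : seq nat) :=
  foldl (fun l v => if v \in T then l else
    foldl (fun l w => if w \in T then l else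
      let a := nth 0 l v in let b := nth 0 l w in
      [seq if i == b then a else i | i <- l]) l (nbrs P v))
  (iota 0 (size P)) (iota 0 (size P)).

Section Choices.
Variables (n d : nat) (cuts : seq (seq nat)).
Implicit Types (P : seq (seq nat)) (U es : seq (nat * nat)) (T : seq nat).

Definition incident U u : seq (nat * nat) := [seq e <- U | (e.1 == u) || (e.2 == u)].

Definition splits P T l :=
  let out := [seq v <- iota 0 n | v \notin T] in
  let k := size (undup [seq nth 0 l v | v <- out]) in
  [&& 1 < k, size T <= k, all (fun a => a < n) l &
   all (fun u => all (fun v => (v \in T) || (nth 0 l u == nth 0 l v)) (nbrs P u)) out].

Definition crossing U T (l : seq nat) : seq (nat * nat) :=
  [seq e <- U | [&& e.1 \notin T, e.2 \notin T & nth 0 l e.1 != nth 0 l e.2]].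

Definition cut_edges P U T :=
  let l := merge_labels P T in if splits P T l then Some (crossing U T l) else None.

Definition choices P U :=
  [seq incident U u | u <- iota 0 n & size (nbrs P u) < d] ++ pmap (cut_edges P U) cuts.

Definition shorter es es' : seq (nat * nat) := if size es < size es' then es else es'.

Definition add_edge P (e : nat * nat) :=
  [seq (if u == e.1 then e.2 :: nbrs P u else if u == e.2 then e.1 :: nbrs P u else nbrs P u)
  | u <- iota 0 (size P)].

Variables (c : nat) (leaf : seq (seq nat) -> seq (nat * nat) -> bool).

(** The [i]-th branch adds the [i]-th pair of the list as an edge and excludes the
    pairs before it. *)
Fixpoint explore fuel P U :=
  if fuel is f.+1 then
    let U := [seq e <- U | ~~ far n P c [:: e.1] e.2 e.1] in
    if choices P U is es :: ess then
      let es := foldr shorter es ess in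
      all (fun i => explore f (add_edge P (nth (0, 0) es i)) [seq e <- U | e \notin take i.+1 es])
        (iota 0 (size es))
    else leaf P U
  else false.

End Choices.

Definition next_to c i j :=
  [|| (i.+1 == j) && (j < c), (j.+1 == i) && (i < c), (i == 0) && (j.+1 == c) | (j == 0) && (i.+1 == c)].

(** The initial knowledge: the edges of a cycle on the vertices below [c], and the
    full neighbourhoods of the vertices listed in [rows]. *)
Definition status c (rows : seq (nat * seq nat)) i j : option bool :=
  if [seq r <- rows | r.1 == i] is r :: _ then Some (j \in r.2) else
  if [seq r <- rows | r.1 == j] is r :: _ then Some (i \in r.2) else
  if next_to c i j then Some true else None.

Definition settled n c rows : seq (seq nat) :=
  [seq [seq v <- iota 0 n | status c rows u v == Some true] | u <- iota 0 n].

Definition unsettled n c rows : seq (nat * nat) :=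
  [seq e <- [seq (u, v) | u <- iota 0 n, v <- iota 0 n] | (e.1 < e.2) && (status c rows e.1 e.2 == None)].

(** Deleting [S], the neighbours of a vertex or of an adjacent pair, separates these
    from the cycle; further deletion of single vertices settles all cases. *)
Definition cuts n (S : seq nat) := S :: [seq v :: S | v <- iota 0 n & v \notin S].

Definition solve n d c rows S leaf :=
  (* Exceeding the depth bound [30] would make the result false. *)
  explore n d (cuts n S) c leaf 30 (settled n c rows) (unsettled n c rows).

(** * Soundness of the search *)

Section Soundness.
Variables (G : sgraph) (d c : nat) (x0 : G) (L : seq G).
Hypotheses (tough : tough_over1 G) (deg : forall x : G, d <= degree x).
Hypotheses (c0 : 0 < c) (bound : forall s, uniq s -> cycle (@edge G) s -> size s <= c).
Hypotheses (uL : uniq L) (allL : forall v : G, v \in L).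
Local Notation n := (size L).
Local Notation "l_( k )" := (nth x0 L k).
Implicit Types (P : seq (seq nat)) (U es : seq (nat * nat)) (T : seq nat).

(** [L] lists the vertices; [P] and [U] describe the graph through this list. *)
Definition sound P U :=
  [/\ forall u v, v \in nbrs P u -> [/\ u < n, v < n & edge l_(u) l_(v)], size P = n &
   forall u v, u < n -> v < n -> edge l_(u) l_(v) ->
     [|| v \in nbrs P u, (u, v) \in U | (v, u) \in U]].

Lemma far_path fuel P k vis v u : far fuel P k vis v u ->
  exists p, [/\ path (fun a b => b \in nbrs P a) u p, last u p = v, uniq p,
    {in p, forall w, w \notin vis} & k <= size p].
Proof.
elim: fuel k vis u => [|f IH] k vis u /=; first by case: eqP => // -> /eqP->; exists [::].
case: eqP => [-> /eqP->|_]; first by exists [::].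
have : {subset nbrs P u <= nbrs P u} by [].
elim: {1 3}(nbrs P u) => // w ws IHw sub.
have sub' : {subset ws <= nbrs P u} by move=> z zws; apply: sub; rewrite inE zws orbT.
case: ifP => [_|wv]; first exact: IHw.
case: ifP => [|_]; last exact: IHw.
case/IH=> p [pp lp up av sz] _; exists (w :: p); split=> //=.
- by rewrite pp sub ?mem_head.
- by rewrite up andbT; apply/negP => /av; rewrite mem_head.
- move=> z; rewrite inE => /predU1P[->|/av]; first by rewrite wv.
  by rewrite inE negb_or => /andP[].
- by nlia.
Qed.

Lemma far_nonedge fuel P U u v : sound P U -> far fuel P c [:: u] v u -> ~~ edge l_(u) l_(v).
Proof.
case=> sP _ _ /far_path[p [pp lp up av sz]]; apply/negP => uv.
have /allP ltn : all (fun i => i < n) (u :: p).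
  have un : u < n by case: p pp sz {lp up av} => [_|w p /= /andP[/sP[]//]]; rewrite leqNgt c0.
  rewrite /= un /=; elim: p u pp {uv un lp up av sz} => //= w p IH u /andP[/sP[_ -> _]].
  exact: IH.
have upu : uniq (u :: p) by rewrite /= up andbT; apply/negP => /av; rewrite mem_head.
suff : size (map (nth x0 L) (u :: p)) <= c by rewrite size_map /=; nlia.
apply: bound.
  by rewrite map_inj_in_uniq // => i j /ltn il /ltn jl /eqP; rewrite nth_uniq // => /eqP.
rewrite /= rcons_path last_map lp edge_sym uv andbT.
elim: p u pp {uv ltn upu lp up av sz} => //= w p IH u /andP[/sP[_ _ ->]]; exact: IH.
Qed.

Lemma sound_filter P U (f : pred (nat * nat)) : sound P U ->
  (forall e, ~~ f e -> e.1 < n -> e.2 < n -> edge l_(e.1) l_(e.2) ->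
    (e.2 \in nbrs P e.1) && (e.1 \in nbrs P e.2)) ->
  sound P [seq e <- U | f e].
Proof.
case=> sP sz cP fU; split=> // u v un vn uv.
rewrite !mem_filter; case/or3P: (cP u v un vn uv) => [->//|iU|iU]; rewrite iU !andbT.
  by have [_|/fU/(_ un vn uv)/andP[/= ->]//] := boolP (f (u, v)); rewrite orbT.
have [_|/fU/(_ vn un)] := boolP (f (v, u)); first by rewrite !orbT.
by rewrite edge_sym => /(_ uv)/andP[_ ->].
Qed.

Lemma mem_add_edge P e : e.1 < size P -> e.2 < size P ->
  (e.2 \in nbrs (add_edge P e) e.1) && (e.1 \in nbrs (add_edge P e) e.2).
Proof.
case: e => a b /= an bn; rewrite /nbrs /add_edge !(nth_map 0) ?size_iota // !nth_iota //= !add0n.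
by rewrite !eqxx mem_head; case: eqP => [->|_]; rewrite mem_head.
Qed.

Lemma sound_add P U e : e.1 < n -> e.2 < n -> sound P U -> edge l_(e.1) l_(e.2) -> sound (add_edge P e) U.
Proof.
case: e => a b /= an bn [sP sz cP] ab; rewrite /add_edge; split; last 2 first.
- by rewrite size_map size_iota.
- move=> u v un vn uv; move: (cP u v un vn uv).
  rewrite /nbrs (nth_map 0) ?size_iota ?sz // nth_iota ?sz // add0n /=.
  by case: ifP => _; [|case: ifP => _]; rewrite -?/(nbrs P u) ?inE => /or3P[] ->; rewrite ?orbT.
move=> u v; have [un|un] := ltnP u n; last first.
  by rewrite /nbrs nth_default // size_map size_iota sz.
rewrite /nbrs (nth_map 0) ?size_iota ?sz // nth_iota ?sz // add0n /=.
case: eqP => [->|_]; [|case: eqP => [->|_]]; rewrite -?/(nbrs P _) ?inE;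
  try (case/predU1P=> [->|]); try by case/sP.
  by split.
by split=> //; rewrite edge_sym.
Qed.

(** This makes a branching complete. *)
Definition holds es := exists e, [/\ e \in es, e.1 < n, e.2 < n & edge l_(e.1) l_(e.2)].

Lemma index_l (v : G) : index v L < n. Proof. by rewrite index_mem. Qed.

Lemma holds_incident P U u : sound P U -> u < n -> size (nbrs P u) < d -> holds (incident U u).
Proof.
move=> [sP _ cP] un small.
have /subsetPn[v] : ~~ ([set v | edge l_(u) v] \subset [set v in map (nth x0 L) (nbrs P u)]).
  apply: contraL small => /subset_leq_card le; rewrite -leqNgt.
  apply: leq_trans (deg _) (leq_trans le _); rewrite cardsE -(size_map (nth x0 L)).
  exact: card_size.
rewrite !inE => uv vP; have vn := index_l v.
have uv' : edge l_(u) l_(index v L) by rewrite nth_index.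
case/or3P: (cP u _ un vn uv') => [vu|eU|eU].
- by case/negP: vP; rewrite -[v](nth_index x0 (allL v)) map_f.
- by exists (u, index v L); rewrite mem_filter eqxx.
- by exists (index v L, u); rewrite mem_filter eqxx orbT eU edge_sym.
Qed.

Lemma holds_crossing P U T l : sound P U -> splits n P T l -> holds (crossing U T l).
Proof.
move=> [sP _ cP] /and4P[k1 kT /(all_nthP 0) ln /allP pl].
set out := [seq v <- iota 0 n | v \notin T] in k1 kT pl.
have outE v : v \in out = (v < n) && (v \notin T) by rewrite mem_filter mem_iota add0n andbC.
have [/hasP[[a b] abU /and3P[/= an bn ab]]|/hasPn none] :=
    boolP (has (fun e => [&& e.1 < n, e.2 < n & edge l_(e.1) l_(e.2)]) (crossing U T l)).
  by exists (a, b).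
pose T' := [set v in map (nth x0 L) [seq w <- T | w < n]].
pose lab v := l_(nth 0 l (index v L)).
have notT v : v \notin T' -> index v L \notin T.
  by apply: contra => vT; rewrite inE -[v](nth_index x0 (allL v)) map_f // mem_filter index_l.
have lab_nbr u v : u \notin T' -> v \notin T' -> edge u v -> lab u = lab v.
  move=> /notT uT /notT vT uv; congr (l_(_)); apply/eqP.
  have uv' : edge l_(index u L) l_(index v L) by rewrite !nth_index.
  case/or3P: (cP _ _ (index_l u) (index_l v) uv') => [vu|eU|eU].
  - have /pl/allP/(_ _ vu) : index u L \in out by rewrite outE index_l.
    by rewrite (negbTE vT).
  - apply: contraTT uv' => ne; have := none (index u L, index v L).
    by rewrite mem_filter /= uT vT ne eU !index_l; apply.
  - apply: contraTT uv' => ne; have := none (index v L, index u L).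
    by rewrite mem_filter /= uT vT eq_sym ne eU !index_l edge_sym; apply.
have ltl k : nth 0 l k < n.
  have [kl|kl] := ltnP k (size l); first exact: ln.
  by rewrite nth_default //; apply: leq_ltn_trans (index_l x0).
have big : size (undup [seq nth 0 l v | v <- out]) <= #|lab @: ~: T'|.
  rewrite -(size_map (nth x0 L)) -(card_uniqP _).
    apply/subset_leq_card/subsetP => v /mapP[k]; rewrite mem_undup => /mapP[u].
    rewrite outE => /andP[un uT] -> ->; apply/imsetP; exists l_(u); last by rewrite /lab index_uniq.
    rewrite !inE; apply: contra uT => /mapP[w]; rewrite mem_filter => /andP[wn wT] /eqP.
    by rewrite nth_uniq // => /eqP->.
  rewrite map_inj_in_uniq ?undup_uniq // => i j; rewrite !mem_undup => /mapP[u _ ->] /mapP[v _ ->].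
  by move=> /eqP; rewrite nth_uniq // => /eqP.
have := tough_labels tough lab_nbr (leq_trans k1 big).
have szT : #|T'| <= size T.
  by rewrite cardsE; apply: leq_trans (card_size _) _; rewrite size_map size_filter count_size.
by nlia.
Qed.

Lemma holds_shortest es ess : {in es :: ess, forall es', holds es'} ->
  holds (foldr shorter es ess).
Proof.
elim: ess => [|es' ess IH] h /=; first exact/h/mem_head.
rewrite /shorter; case: ifP => _; first by apply: h; rewrite !inE eqxx orbT.
by apply: IH => es'' mem; apply: h; move: mem; rewrite !inE => /orP[]->; rewrite ?orbT.
Qed.

Lemma holds_choice cuts P U : sound P U -> {in choices n d cuts P U, forall es, holds es}.
Proof.
move=> sPU es; rewrite mem_cat => /orP[/mapP[u]|].
  by rewrite mem_filter mem_iota add0n => /andP[small un] ->; apply: holds_incident sPU un small.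
rewrite mem_pmap => /mapP[T _]; rewrite /cut_edges.
by case: ifP => // sp [->]; apply: holds_crossing sPU sp.
Qed.

(** In each list of choices there is a first edge of the graph, and the search
    follows the branch of this edge. *)
Lemma explore_sound cuts leaf fuel P U : explore n d cuts c leaf fuel P U -> sound P U ->
  exists P' U', leaf P' U' /\ sound P' U'.
Proof.
elim: fuel P U => //= f IH P U0.
set U := [seq e <- U0 | _] => ex sPU0.
have {sPU0} sPU : sound P U.
  apply: sound_filter (sPU0) _ => -[a b] /=; rewrite negbK => /(far_nonedge sPU0) + _ _.
  by move/negbTE->.
have choice := @holds_choice cuts _ _ sPU; clearbody U.
case: (choices n d cuts P U) ex choice => [lf _|es0 ess]; first by exists P, U.
move=> /allP + /holds_shortest; set es := foldr _ _ _ => br [e [ees e1 e2 ee]].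
pose isE (e : nat * nat) := [&& e.1 < n, e.2 < n & edge l_(e.1) l_(e.2)].
have hasE : has isE es by apply/hasP; exists e; rewrite // /isE e1 e2.
have ltE : find isE es < size es by rewrite -has_find.
have /and3P[a1 a2 aE] := nth_find (0, 0) hasE.
have {}br := br (find isE es); apply: (IH _ _ (br _)); first by rewrite mem_iota.
apply: sound_filter; first exact: sound_add.
move=> e'; rewrite negbK (take_nth (0, 0)) // mem_rcons inE => /predU1P[->|].
  by move=> *; case: sPU => _ sz _; apply: mem_add_edge; rewrite sz.
case/(nthP (0, 0))=> j; rewrite size_takel; last exact: ltnW.
move=> ji; rewrite nth_take // => <- b1 b2 bE; have := before_find (0, 0) ji.
by rewrite /isE b1 b2 bE.
Qed.

End Soundness.

Section Start.
Variables (G : sgraph) (d : nat) (x0 : G) (C R : seq G).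
Hypotheses (tough : tough_over1 G) (deg : forall x : G, d <= degree x).
Hypotheses (longC : longest C) (uL : uniq (C ++ R)) (allL : forall v : G, v \in C ++ R).
Hypothesis C0 : 0 < size C.
Local Notation n := (size (C ++ R)).
Local Notation c := (size C).
Local Notation "l_( k )" := (nth x0 (C ++ R) k).

Variable rows : seq (nat * seq nat).
Hypothesis rowsE : {in rows, forall r j, j < n -> edge l_(r.1) l_(j) = (j \in r.2)}.

Lemma next_to_edge i j : next_to c i j -> edge l_(i) l_(j).
Proof.
have [_ cyc _] := longC.
have step k : k.+1 < c -> edge l_(k) l_(k.+1).
  by move=> kc; rewrite !nth_cat kc ltnW //; exact: (sortedP x0 (cycle_sorted longC)).
have close : edge l_(c.-1) l_(0).
  by rewrite !nth_cat C0 prednK // leqnn; apply: cycle_close.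
case/or4P=> /andP[/eqP e].
- by rewrite -e; apply: step.
- by rewrite -e edge_sym; apply: step.
- by move/eqP=> jc; rewrite edge_sym e -[j]/(j.+1.-1) jc.
- by move/eqP=> ic; rewrite e -[i]/(i.+1.-1) ic.
Qed.

Lemma status_edge i j b : i < n -> j < n -> status c rows i j = Some b -> edge l_(i) l_(j) = b.
Proof.
move=> ilt jlt; rewrite /status.
have row k r rs : [seq r <- rows | r.1 == k] = r :: rs -> r \in rows /\ r.1 = k.
  by move=> e; have := mem_head r rs; rewrite -e mem_filter => /andP[/eqP].
case Ei: [seq r <- rows | r.1 == i] => [|r rs]; last first.
  by case: (row _ _ _ Ei) => rin <- [<-]; apply: rowsE.
case Ej: [seq r <- rows | r.1 == j] => [|r rs]; last first.
  by case: (row _ _ _ Ej) => rin <- [<-]; rewrite edge_sym; apply: rowsE.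
by case: ifP => // /next_to_edge-> [].
Qed.

Lemma status_unknown i j : status c rows i j = None -> status c rows j i = None.
Proof.
rewrite /status; case: [seq r <- rows | r.1 == i] => //; case: [seq r <- rows | r.1 == j] => //.
suff -> : next_to c i j = next_to c j i by [].
by rewrite /next_to orbA orbA [_ || (_ && (i < c))]orbC -!orbA; do 2 congr (_ || _); rewrite orbC.
Qed.

Lemma solve_sound S leaf : solve n d c rows S leaf -> exists P U, leaf P U /\ sound x0 (C ++ R) P U.
Proof.
have [_ _ bound] := longC.
move=> sol; apply: (explore_sound (x0 := x0) tough deg C0 bound uL allL sol); split.
- move=> u v; have [un|un] := ltnP u n; last by rewrite /nbrs nth_default // size_map size_iota.
  rewrite /nbrs (nth_map 0) ?size_iota // nth_iota // add0n mem_filter mem_iota add0n.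
  by case/and3P=> /eqP st _ vn; split=> //; apply: status_edge st.
- by rewrite size_map size_iota.
move=> u v un vn uv; rewrite /nbrs (nth_map 0) ?size_iota // nth_iota // add0n.
rewrite !mem_filter mem_iota add0n vn andbT /=.
case st: (status c rows u v) => [b|].
  by have := status_edge un vn st; rewrite uv => <-.
rewrite (status_unknown st) /= !allpairs_f ?mem_iota ?un ?vn //= !andbT.
by case: ltngtP uv => // ->; rewrite edge_irrefl.
Qed.

End Start.

(** * Longest cycles are dominating *)

(** For the searches that are to end in a contradiction in every branch. *)
Definition no_leaf (_ : seq (seq nat)) (_ : seq (nat * nat)) := false.

Lemma adjacent_pair_solved : all (fun s => solve 13 4 11 [:: (11, 12 :: s); (12, 11 :: s)] s no_leaf)
  [:: [:: 0; 5; 8]; [:: 0; 3; 8]; [:: 0; 3; 6]; [:: 0; 4; 8]; [:: 0; 4; 7]; [:: 0; 3; 7]].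
Proof. by vm_cast_no_check (erefl true). Qed.

(** The only way, numerically, for a component outside a longest cycle to have more
    than one vertex: two adjacent vertices with the same three neighbours on a cycle
    of length 11. The gaps 5, 3, 3 and 4, 4, 3 in some order are left to the
    search. *)
Lemma adjacent_pair_contra (G : sgraph) (C : seq G) x0 y z p q : tough_over1 G -> (forall x : G, 4 <= degree x) ->
  longest C -> size C = 11 -> #|G| = 13 ->
  y \notin C -> z \notin C -> edge y z -> 3 <= p -> p + 3 <= q -> q + 3 <= 11 ->
  (forall i, i < 11 -> edge y (nth x0 C i) = (i \in [:: 0; p; q])) ->
  (forall i, i < 11 -> edge z (nth x0 C i) = (i \in [:: 0; p; q])) -> False.
Proof.
move=> tough deg longC c11 n13 yC zC yz p3 pq q3 yE zE.
have uC : uniq C by case: longC.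
have yz' : y != z by apply: contraTneq yz => ->; rewrite edge_irrefl.
have uL : uniq (C ++ [:: y; z]).
  by rewrite cat_uniq uC /= (negbTE yC) (negbTE zC) /= inE yz'.
have sL : size (C ++ [:: y; z]) = 13 by rewrite size_cat c11.
have allL v : v \in C ++ [:: y; z].
  have /subset_cardP : #|C ++ [:: y; z]| = #|G| by rewrite (card_uniqP uL) sL.
  by move=> /(_ (subset_predT _)) ->.
have solved : solve 13 4 11 [:: (11, [:: 12; 0; p; q]); (12, [:: 11; 0; p; q])] [:: 0; p; q] no_leaf.
  have /allP := adjacent_pair_solved; apply.
  have : [|| (p == 5) && (q == 8), (p == 3) && (q == 8), (p == 3) && (q == 6),
            (p == 4) && (q == 8), (p == 4) && (q == 7) | (p == 3) && (q == 7)] by nlia.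
  by case/or4P=> [/andP[/eqP-> /eqP->]|/andP[/eqP-> /eqP->]|/andP[/eqP-> /eqP->]|/or3P[]/andP[/eqP-> /eqP->]].
have C0 : 0 < size C by rewrite c11.
rewrite -{1}sL -{1}c11 in solved.
have [|P [U []//]] := solve_sound (x0 := x0) tough deg longC uL allL C0 _ solved.
move=> r; rewrite !inE => /orP[]/eqP-> j; rewrite sL /= => j13.
- rewrite !nth_cat c11 /=; case: ltnP => j11; first by rewrite yE // !inE; nlia.
  have /orP[/eqP->|/eqP->] : (j == 11) || (j == 12) by nlia.
    by rewrite /= edge_irrefl !inE; nlia.
  by rewrite /= yz.
- rewrite !nth_cat c11 /=; case: ltnP => j11; first by rewrite zE // !inE; nlia.
  have /orP[/eqP->|/eqP->] : (j == 11) || (j == 12) by nlia.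
    by rewrite /= edge_sym yz.
  by rewrite /= edge_irrefl !inE; nlia.
Qed.

Section Dominating.
Variables (G : sgraph) (d : nat).
Hypotheses (tough : tough_over1 G) (deg : forall x : G, d <= degree x).
Hypothesis order : #|G| <= d.*2 + 5.

Lemma tough_cut (T B : {set G}) (u v : G) : u \in B -> u \notin T -> v \notin B -> v \notin T ->
    (forall y z, y \in B -> y \notin T -> z \notin T -> edge y z -> z \in B) -> 2 < #|T|.
Proof.
move=> uB uT vB vT closed.
have lab2 : 1 < #|[set z \in B | z in ~: T]|.
  apply/card_gt1P; exists true, false; split=> //; apply/imsetP.
    by exists u; rewrite ?inE.
  by exists v; rewrite ?inE // (negbTE vB).
apply: leq_trans (tough_labels tough _ lab2); first by rewrite ltnS.
move=> y z yT zT yz; apply/idP/idP; last rewrite edge_sym in yz.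
  by move=> yB; apply: closed yB _ _ yz.
by move=> zB; apply: closed zB _ _ yz.
Qed.

(** In a graph on at most four vertices with all degrees at least 2, any two
    vertices are joined by a path with at least three vertices. *)
Lemma bridge3 (C : seq G) (H : {set G}) (u v y z : G) : component C H -> #|H| <= 4 ->
    (forall t, t \in H -> 1 < #|[set s in H | edge t s]|) ->
    y \in H -> z \in H -> y != z -> edge u y -> edge v z -> bridge H 3 u v.
Proof.
move=> compH H4 degH yH zH yz uy vz.
have other t s : t \in H -> exists2 r, r \in H & edge t r && (r != s).
  move=> tH; have /card_gt1P[a [b [aN bN ab]]] := degH t tH.
  move: aN bN; rewrite !inE => /andP[aH ta] /andP[bH tb].
  have [eqas|nas] := eqVneq a s; last by exists a; rewrite ?ta.
  by exists b; rewrite // tb -eqas eq_sym.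
have ne (a b : G) : edge a b -> a != b by apply: contraTneq => ->; rewrite edge_irrefl.
have [t tH /andP[yt tz]] := other y z yH.
have [tz'|ntz] := boolP (edge t z).
  exists y, [:: t; z]; rewrite /= yt tz' [edge z v]edge_sym vz; do !split=> //.
  - by rewrite !inE !negb_or ne // yz tz.
  - by move=> s; rewrite !inE => /or3P[]/eqP->.
have [s sH /andP[zs sy]] := other z y zH.
have [ys|nys] := boolP (edge y s).
  exists y, [:: s; z]; rewrite /= ys [edge s z]edge_sym zs [edge z v]edge_sym vz; do !split=> //.
  - by rewrite !inE !negb_or ne // yz eq_sym ne.
  - by move=> r; rewrite !inE => /or3P[]/eqP->.
have ts : t != s by apply: contraNneq ntz => ->; rewrite edge_sym.
have ts' : edge t s.
  have [r rH /andP[tr ry]] := other t y tH.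
  have [ers|rs] := eqVneq r s; first by rewrite -ers.
  suff /uniq_leq_size h : uniq [:: y; z; t; s; r].
    have /h : {subset [:: y; z; t; s; r] <= enum H}.
      by move=> a; rewrite mem_enum !inE => /or4P[|||/orP[]]/eqP->.
    by rewrite -cardE => h5; have := leq_trans h5 H4.
  rewrite /= !inE !negb_or yz (ne _ _ yt) (eq_sym y) sy (eq_sym y) ry (eq_sym z) tz.
  rewrite (ne _ _ zs) ts (ne _ _ tr) (eq_sym s) rs /= !andbT.
  by apply: contraNneq ntz => ->.
exists y, [:: t; s; z]; rewrite /= yt ts' [edge s z]edge_sym zs [edge z v]edge_sym vz; do !split=> //.
- by rewrite !inE !negb_or ne // yz ts tz eq_sym sy eq_sym ne.
- by move=> r; rewrite !inE => /or4P[]/eqP->.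
Qed.

Section Component.
Variables (C : seq G) (y0 z0 : G).
Hypotheses (longC : longest C) (y0C : y0 \notin C) (z0C : z0 \notin C) (yz0 : edge y0 z0).
Let H := [set y | connect (off C) y0 y].
Local Notation S := [set u in C | attached H u].
Let compH : component C H := component_connect y0C.

Lemma y0H : y0 \in H. Proof. by rewrite inE connect0. Qed.

Lemma card_H : 1 < #|H|.
Proof.
apply/card_gt1P; exists y0, z0; split; rewrite ?y0H //.
  by rewrite inE; apply: connect1; rewrite /off y0C z0C.
by apply: contraTneq yz0 => ->; rewrite edge_irrefl.
Qed.

Lemma c_gt1 : 1 < size C.
Proof.
case: longC => _ _ /(_ [:: y0; z0]); apply; rewrite /= ?inE ?yz0 1?edge_sym ?yz0 //.
by rewrite andbT; apply: contraTneq yz0 => ->; rewrite edge_irrefl.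
Qed.

Lemma H_closed y z : y \in H -> edge y z -> z \in H \/ z \in S.
Proof.
case: compH => HC closed _ yH yz; have [zC|zC] := boolP (z \in C); last first.
  by left; apply: closed zC yz.
by right; rewrite inE zC; apply/existsP; exists y; rewrite yH edge_sym.
Qed.

Lemma HS y : y \in H -> y \notin S.
Proof. by case: compH => HC _ _ /HC yC; rewrite inE (negbTE yC). Qed.

(** Deleting the attachments separates [H] from the rest of the cycle. *)
Lemma card_S : 2 < #|S|.
Proof.
have c2 := c_gt1.
have [v vC vS] : exists2 v, v \in C & v \notin S.
  have [v0S|v0S] := boolP (nth y0 C 0 \in S); last by exists (nth y0 C 0); rewrite ?mem_nth ?(ltnW c2).
  exists (nth y0 C 1); rewrite ?mem_nth ?c2 //; apply/negP => v1S.
  move: v0S v1S; rewrite !inE => /andP[_ a0] /andP[_ a1].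
  have : 0 + 1 < 1 by apply: (gap_le longC compH _ (bridge1 compH a0 a1)); nlia.
  by [].
apply: (@tough_cut S H y0 v) => //; rewrite ?y0H ?HS ?y0H //.
  by apply/negP; case: compH => HC _ _ /HC; rewrite vC.
by move=> y z yH _ zS /(H_closed yH)[//|]; rewrite (negbTE zS).
Qed.

Lemma H_other x : exists2 u, u \in H & u != x.
Proof.
case/card_gt1P: card_H => a [b [aH bH ab]].
have [eax|nax] := eqVneq a x; last by exists a.
by exists b => //; rewrite -eax eq_sym.
Qed.

(** If all pairs of attachments were bad, they would all see the same vertex of [H]
    and no other one, a cut vertex. *)
Lemma pairs_not_bad : exists u v, [/\ u \in S, v \in S, u != v & ~~ bad H u v].
Proof.
have [/existsP[u /existsP[v /and4P[]]]|no] :=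
  boolP [exists u, exists v, [&& u \in S, v \in S, u != v & ~~ bad H u v]].
  by exists u, v.
have all_bad u v : u \in S -> v \in S -> u != v -> bad H u v.
  move=> uS vS uv; apply: contraR no => nb.
  by apply/existsP; exists u; apply/existsP; exists v; rewrite uS vS uv.
have /card_gt1P[v0 [v1 [v0S v1S v01]]] := ltnW card_S.
have /badP[x xH hx] := all_bad _ _ v0S v1S v01.
have only v y : v \in S -> y \in H -> edge v y -> y = x.
  move=> vS yH vy; have [ev|nv] := eqVneq v v0; first by apply: hx; rewrite // -ev vy.
  have /badP[x' x'H hx'] := all_bad _ _ vS v0S nv.
  have [/existsP[t /andP[tH v0t]]] : attached H v0 by move: v0S; rewrite inE => /andP[].
  by rewrite (hx' y) ?vy // -(hx' t) ?v0t ?orbT // (hx t) // v0t.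
have [u uH ux] := H_other x.
suff : 2 < #|[set x]| by rewrite cards1.
apply: (@tough_cut [set x] (H :\ x) u v0); rewrite ?inE ?ux ?eqxx //=.
- by move: uH; rewrite inE.
- by apply/negP => /andP[_ v0H]; move: (HS (y := v0)); rewrite v0S !inE v0H => /(_ isT).
- by apply: contraTneq v0S => ->; apply: HS.
move=> y z; rewrite !inE => /andP[yx yH] _ zx yz; rewrite zx /=.
have {}yH : y \in H by rewrite inE.
have [|zS] := H_closed yH yz; first by rewrite inE.
by move: yx; rewrite (only z y zS yH) ?eqxx // edge_sym.
Qed.

Lemma deg_H y : y \in H -> d <= #|[set s in H | edge y s]| + #|[set s in S | edge y s]|.
Proof.
move=> yH; apply: leq_trans (deg y) _; rewrite /degree -cardsUI.
apply: leq_trans (leq_addr _ _); apply/subset_leq_card/subsetP => z.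
rewrite !inE => yz; have [zH|zS] := H_closed yH yz; first by move: zH; rewrite inE => ->; rewrite yz.
by move: zS; rewrite inE => ->; rewrite yz orbT.
Qed.

Lemma card_nbrs_H y : y \in H -> #|[set s in H | edge y s]| <= #|H|.-1.
Proof.
move=> yH; rewrite (cardsD1 y H) yH; apply/subset_leq_card/subsetP => s.
by rewrite !inE => /andP[sH ys]; rewrite sH andbT; apply: contraTneq ys => ->; rewrite edge_irrefl.
Qed.

Lemma card_nbrs_S y : #|[set s in S | edge y s]| <= #|S|.
Proof. by apply/subset_leq_card/subsetP => s; rewrite inE => /andP[]. Qed.

Lemma card_out : size C + #|H| <= #|G|.
Proof.
have uC : uniq C by case: longC.
have -> : size C = #|[set y in C]| by rewrite cardsE; apply/esym/card_uniqP.
rewrite -cardsUI (_ : _ :&: _ = set0) ?cards0 ?addn0 ?max_card //.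
apply/setP => y; rewrite !inE; apply/negP => /andP[yC yH].
by case: compH => /(_ y); rewrite inE yH yC => /(_ isT).
Qed.

Lemma H_plus_S : d.*2 + #|H| + #|S| <= #|G| + 2.
Proof.
have [u [v [uS vS uv nb]]] := pairs_not_bad.
move: (uS) (vS); rewrite !inE => /andP[uC au] /andP[vC av].
exact: two_successors deg longC compH uC vC uv (not_bad_bridge compH au av nb).
Qed.

Lemma rot_S i : [set u in rot i C | attached H u] = S.
Proof. by apply/setP => u; rewrite !inE mem_rot. Qed.

Lemma even_cycle : 2 * #|S| + 2 <= size C.
Proof.
have [u [v [uS vS uv nb]]] := pairs_not_bad.
move: (uS) (vS); rewrite !inE => /andP[uC au] /andP[vC av].
have [i [s eqC]] := rot_head uC; have rC := longest_rot i longC.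
have rH := component_rot i compH.
have c2 : 1 < size (rot i C) by rewrite size_rot c_gt1.
have v0 : nth y0 (rot i C) 0 = u by rewrite eqC.
have vR : v \in rot i C by rewrite mem_rot.
have vb : nth y0 (rot i C) (index v (rot i C)) = v by rewrite nth_index.
have bc : index v (rot i C) < size (rot i C) by rewrite index_mem.
have := @two_long_gaps _ (rot i C) y0 H rC rH c2 _ (index v (rot i C)).
rewrite rot_S v0 modn_small // vb size_rot; apply=> //.
rewrite -(size_rot i) bc andbT lt0n; apply: contraNneq uv => e.
by rewrite -v0 -vb e.
Qed.

Lemma based u : u \in S -> exists i s, [/\ rot i C = u :: s :> seq G, longest (rot i C),
  component (rot i C) H & attached H (nth y0 (rot i C) 0)].
Proof.
rewrite inE => /andP[uC au]; have [i [s eqC]] := rot_head uC; exists i, s.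
by split; [|apply: longest_rot|apply: component_rot|rewrite eqC].
Qed.

Lemma c_gt1_rot i : 1 < size (rot i C). Proof. by rewrite size_rot c_gt1. Qed.

Lemma bridged_cycle k : 0 < k ->
    (forall u v, u \in S -> v \in S -> u != v -> bridge H k u v) ->
  k.+1 * #|S| + 2 <= size C.
Proof.
move=> k0 br; have S0 : 0 < #|S| by apply: ltn_trans card_S.
case/card_gt0P: S0 => u /based[i [s [_ rC rH a0]]].
have := @long_cycle G (rot i C) y0 H rC rH (c_gt1_rot i) a0 k y0 tough k0.
rewrite rot_S size_rot mem_rot; apply=> //; first exact: ltnW card_S.
  exact: y0H.
move=> y; rewrite inE; rewrite (@eq_connect _ _ (off C)) //.
by move=> a b; rewrite /off !mem_rot.
Qed.

Lemma rot_index i v : v \in C -> nth y0 (rot i C) (index v (rot i C)) = v /\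
  index v (rot i C) < size (rot i C).
Proof. by move=> vC; rewrite nth_index ?index_mem mem_rot. Qed.

(** Let [x] be the only vertex of [H] that the bad pair [u], [v] sees. Then [x] and
    the other attachments form a cut, hence there are at least four attachments, and
    the vertices of [H] other than [x] miss two of them. Counting leaves three
    vertices in [H], four attachments and a cycle of length 10, with [u], [v] as the
    only bad pair; this cycle is too short for [one_bad_pair]. *)
Lemma bad_pair_contra u v : u \in S -> v \in S -> u != v -> bad H u v -> False.
Proof.
move=> uS vS uv /badP[x xH hx].
have fu y : y \in H -> edge y u -> y = x by move=> yH e; apply: hx; rewrite // edge_sym e.
have fv y : y \in H -> edge y v -> y = x.
  by move=> yH e; apply: hx; rewrite // [edge v y]edge_sym e orbT.
have cSuv : #|S :\ u :\ v| = #|S| - 2.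
  by rewrite (cardsD1 u S) uS (cardsD1 v (S :\ u)) !inE eq_sym uv; move: vS; rewrite inE => ->; rewrite /=; lia.
have m4 : 3 < #|S|.
  have [y yH yx] := H_other x.
  have : 2 < #|x |: (S :\ u :\ v)|.
    apply: (@tough_cut _ (H :\ x) y u).
    - by rewrite in_setD1 yx.
    - by rewrite in_setU1 negb_or yx 2!in_setD1 (negbTE (HS yH)) !andbF.
    - by rewrite in_setD1; apply: contraL uS => /andP[_]; apply: HS.
    - rewrite in_setU1 2!in_setD1 eqxx /= andbF orbF.
      by apply: contraTneq uS => ->; apply: HS.
    move=> t z /setD1P[tx tH] _; rewrite in_setU1 negb_or 2!in_setD1 => /andP[zx zS] tz.
    rewrite in_setD1 zx /=; have [//|zS'] := H_closed tH tz; move: zS; rewrite zS' andbT.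
    rewrite negb_and !negbK => /orP[]/eqP ez; rewrite ez in tz.
      by rewrite (fv t tH tz) eqxx in tx.
    by rewrite (fu t tH tz) eqxx in tx.
  rewrite cardsU1 cSuv; case: (_ \notin _); nlia.
have nbrs y : y \in H -> y != x -> [set s in S | edge y s] \subset S :\ u :\ v.
  move=> yH yx; apply/subsetP => s; rewrite inE => /andP[sS ys].
  rewrite 2!in_setD1 sS andbT; apply/andP; split.
    by apply: contraNneq yx => es; apply/eqP/fv; rewrite -?es.
  by apply: contraNneq yx => es; apply/eqP/fu; rewrite -?es.
have ev := even_cycle; have hs := H_plus_S; have out := card_out; have h2 := card_H.
have [y yH yx] := H_other x.
have := deg_H yH; have := card_nbrs_H yH; have := subset_leq_card (nbrs y yH yx).
rewrite cSuv => n1 n2 n3.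
have [d4 [h3 [m4' c10]]] : d = 4 /\ #|H| = 3 /\ #|S| = 4 /\ size C = 10 by move: order; nlia.
have full t s : t \in H -> t != x -> s \in S -> s != u -> s != v -> edge t s.
  move=> tH tx sS su sv.
  have /eqP e : [set s in S | edge t s] == S :\ u :\ v.
    rewrite eqEcard nbrs // cSuv; have := deg_H tH; have := card_nbrs_H tH; nlia.
  suff : s \in [set s in S | edge t s] by rewrite inE => /andP[].
  by rewrite e !in_setD1 su sv sS.
have [z zH /andP[zx zy]] : exists2 z, z \in H & (z != x) && (z != y).
  have : 0 < #|H :\ x :\ y|.
    move: h3; rewrite (cardsD1 x) xH (cardsD1 y (H :\ x)) in_setD1 yx yH /=; nlia.
  case/card_gt0P=> z; rewrite !in_setD1 => /and3P[zy zx zH].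
  by exists z; rewrite // zx zy.
have nb s t : s \in S -> t \in S -> s != u -> s != v -> ~~ bad H s t.
  move=> sS tS su sv; apply/negP => /badP[x' _ hx'].
  have sy : edge s y by rewrite edge_sym full.
  have sz : edge s z by rewrite edge_sym full.
  have ey : y = x' by apply: hx'; rewrite ?sy.
  have ez : z = x' by apply: hx'; rewrite ?sz.
  by move: zy; rewrite ey ez eqxx.
have [i [s [eqC rC rH a0]]] := based uS.
have [vi iv] : nth y0 (rot i C) (index v (rot i C)) = v /\ index v (rot i C) < size (rot i C).
  by apply: rot_index; move: vS; rewrite inE => /andP[].
have c0 : nth y0 (rot i C) 0 = u by rewrite eqC.
have uR : uniq (rot i C) by case: rC.
have sz : size (rot i C) = 10 by rewrite size_rot.
have vS' := vS; move: vS'; rewrite inE => /andP[vC av].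
have iv0 : 0 < index v (rot i C).
  by rewrite lt0n; apply: contraNneq uv => e; rewrite -c0 -vi e.
have : 3 * #|[set u in rot i C | attached H u]| <= size (rot i C) + 1.
  apply: (@one_bad_pair _ _ y0 _ rC rH (c_gt1_rot i) a0 (index v (rot i C))).
  - by rewrite iv0.
  - by rewrite modn_small // vi.
  - by rewrite rot_S card_S.
  move=> p q /andP[pq qs] pq0; have ps := ltn_trans pq qs.
  have s0 := leq_ltn_trans (leq0n p) ps; rewrite !modn_small // => ap aq.
  have mem j : j < size (rot i C) -> attached H (nth y0 (rot i C) j) ->
      nth y0 (rot i C) j \in S.
    by move=> jc; rewrite inE => ->; rewrite andbT -(mem_rot i) mem_nth.
  have pS := mem p ps ap; have qS := mem q qs aq.
  have qu : nth y0 (rot i C) q != u by rewrite -c0 nth_uniq // -lt0n; nlia.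
  have [p0|p0] := eqVneq p 0.
    rewrite bad_sym nb // -vi nth_uniq //.
    by move: pq0; rewrite p0.
  have pu : nth y0 (rot i C) p != u by rewrite -c0 nth_uniq.
  have [e|ne] := eqVneq (nth y0 (rot i C) p) v; last exact: nb.
  have qv : nth y0 (rot i C) q != v by rewrite -e nth_uniq //; nlia.
  by rewrite bad_sym nb.
by rewrite rot_S m4' sz.
Qed.

(** Without bad pairs the cycle has length at least [3 * #|S| + 2]. If [H] has more
    than two vertices, counting degrees shows that any two attachments are joined
    through three of them, and a cycle of length [4 * #|S| + 2] does not fit; two
    vertices leave the configuration of [adjacent_pair_contra]. *)
Lemma edge_outside_contra : False.
Proof.
have br2 u v : u \in S -> v \in S -> u != v -> bridge H 2 u v.
  move=> uS vS uv; move: (uS) (vS); rewrite !inE => /andP[_ au] /andP[_ av].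
  by apply: (not_bad_bridge compH au av); apply/negP => /(bad_pair_contra uS vS uv).
have := bridged_cycle (isT : 0 < 2) br2.
have hs := H_plus_S; have out := card_out; have h2 := card_H; have m3 := card_S.
move=> c32.
have := deg_H y0H; have := card_nbrs_H y0H; have := card_nbrs_S y0 => n1 n2 n3.
have [eqh|neh] := eqVneq #|H| 2; last first.
  have br3 u v : u \in S -> v \in S -> u != v -> bridge H 3 u v.
    move=> uS vS uv; case: (br2 u v uS vS uv) => y [P [uP PH uy pP [Pv szP]]].
    apply: (@bridge3 C H u v y (last y P)) => //; rewrite ?PH ?mem_head ?mem_last //.
    - by move: order; nlia.
    - move=> t tH; have := deg_H tH; have := card_nbrs_S t; move: order; nlia.
    - by case: P szP uP {PH pP Pv} => //= z P _ /andP[+ _]; apply: contraNneq => ->; apply: mem_last.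
    - by rewrite edge_sym.
  have := bridged_cycle (isT : 0 < 3) br3; move: order; nlia.
have [m3' [d4 [c11 n13]]] : #|S| = 3 /\ d = 4 /\ size C = 11 /\ #|G| = 13 by move: order; nlia.
have full y s : y \in H -> s \in S -> edge y s.
  move=> yH sS; suff : s \in [set s in S | edge y s] by rewrite inE => /andP[].
  have /eqP -> // : [set s in S | edge y s] == S.
  rewrite eqEcard; apply/andP; split; first by apply/subsetP => t; rewrite inE => /andP[].
  by have := deg_H yH; have := card_nbrs_H yH; nlia.
have z0H : z0 \in H by rewrite inE; apply: connect1; rewrite /off y0C z0C.
have /card_gt0P[u uS] : 0 < #|S| by rewrite m3'.
have [i [s [eqC rC rH a0]]] := based uS; have c2 := c_gt1_rot i.
pose f := nth y0 (rot i C); pose E k := attached H (f (k %% size (rot i C))).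
have sz : size (rot i C) = 11 by rewrite size_rot.
have E0 : E 0 by rewrite /E mod0n.
have E11 : E 11 by rewrite /E -sz modnn.
have memE k : k < 11 -> E k -> f k \in S.
  move=> k11; rewrite /E modn_small ?sz // inE => ->.
  by rewrite andbT -(mem_rot i) mem_nth ?sz.
have edgeE y k : y \in H -> k < 11 -> edge y (f k) = E k.
  move=> yH k11; apply/idP/idP => [e|/(memE _ k11)/(full _ _ yH)//].
  by rewrite /E modn_small ?sz //; apply/existsP; exists y; rewrite yH edge_sym.
have gap p q : p < q < 11 -> E p -> E q -> p + 2 < q.
  move=> /andP[pq qc] Ep Eq; have pc := ltn_trans pq qc.
  apply: (gap3 rC rH c2 _ _ Ep Eq).
  - by rewrite pq sz ltnW.
  - by rewrite sz [q == 11]ltn_eqF ?andbF.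
  - rewrite !modn_small ?sz //; apply/negP; apply: bad_pair_contra; rewrite ?memE //.
    by rewrite nth_uniq ?sz //; [rewrite ltn_eqF|case: rC].
have gap' p : 0 < p < 11 -> E p -> p + 2 < 11.
  move=> /andP[p0 pc] Ep; apply: (gap3 rC rH c2 _ _ Ep E11).
  - by rewrite pc sz.
  - by rewrite eqn0Ngt p0.
  - rewrite modn_small ?sz // modnn bad_sym; apply/negP; apply: bad_pair_contra; rewrite ?memE //.
    by rewrite nth_uniq ?sz //; [rewrite ltn_eqF|case: rC].
have szL : size (filter E (iota 0 11)) = 3.
  by rewrite size_filter -sz -m3' -(rot_S i) (card_attached y0 H rC).
have sL : sorted ltn (filter E (iota 0 11)).
  by apply: sorted_filter; [apply: ltn_trans|apply: iota_ltn_sorted].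
have memL k : (k \in filter E (iota 0 11)) = (k < 11) && E k by rewrite mem_filter mem_iota andbC.
have h0 : 0 \in filter E (iota 0 11) by rewrite memL E0.
case: (filter E (iota 0 11)) szL sL memL h0 => [|p1 [|p2 [|p3 [|? ?]]]] //= _.
move=> /andP[lt12 /andP[lt23 _]] memL h0.
have p10 : p1 = 0.
  by move: h0; rewrite !inE => /or3P[]/eqP e; move: lt12 lt23; rewrite -?e; nlia.
have [[/andP[l2 E2]] /andP[l3 E3]] : ((p2 < 11) && E p2) /\ ((p3 < 11) && E p3).
  by rewrite -!memL !inE !eqxx !orbT.
have deg4 (v : G) : 4 <= degree v by rewrite -d4.
apply: (adjacent_pair_contra (C := rot i C) (x0 := y0) (y := y0) (z := z0) (p := p2) (q := p3) tough deg4 rC sz n13);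
  rewrite ?mem_rot //.
- by have := gap 0 p2; rewrite E0 E2 l2 -p10 lt12 => /(_ isT isT isT); rewrite p10.
- by have := gap p2 p3; rewrite lt23 l3 E2 E3 => /(_ isT isT isT); nlia.
- by have := gap' p3; rewrite l3 E3 => /(_ _ isT); nlia.
- by move=> k k11; rewrite edgeE ?y0H // -p10 memL k11.
- by move=> k k11; rewrite edgeE // -p10 memL k11.
Qed.

End Component.

Lemma no_outside_edge (C : seq G) y z : longest C -> y \notin C -> z \notin C -> ~~ edge y z.
Proof. by move=> lC yC zC; apply/negP; apply: edge_outside_contra lC yC zC. Qed.

End Dominating.

(** * Nearly longest paths with good ends *)

Section Ends.
Variables (G : sgraph) (C : seq G) (x x0 : G).
Hypothesis longC : longest C.

Definition good_end (Q : seq G) v := edge x v \/ exists k, [/\ 0 < k, k.+1 < size Q,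
  edge x (nth x0 Q k.-1), edge x (nth x0 Q k.+1) & edge v (nth x0 Q k)].

(** A path avoiding [x], not shorter than the longest cycle, would be closed to a
    longer cycle through [x]. An end that is adjacent to the vertex at [k] rather
    than to [x] is as good: [x] has edges to both sides of this vertex. *)
Lemma no_good_ends Q : uniq Q -> sorted (@edge G) Q -> x \notin Q -> size C <= size Q ->
  1 < size Q -> good_end Q (nth x0 Q 0) -> good_end Q (nth x0 Q (size Q).-1) -> False.
Proof.
move=> uQ sQ xQ cQ q1.
pose L := Q ++ [:: x] ++ [::].
have uL : uniq L by rewrite /L cats0 cat_uniq uQ /= orbF xQ.
have nthQ k : k < size Q -> nth x0 L k = nth x0 Q k by move=> kq; rewrite nth_cat kq.
have nthx : nth x0 L (size Q) = x by rewrite nth_cat ltnn subnn.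
set q := size Q in nthQ nthx cQ q1 *.
have walks ps : all (fun p => (lo p <= hi p) && (hi p <= q)) ps ->
    pairwise (fun p q => (hi p < lo q) || (hi q < lo p)) ps ->
    all (fun p => (hi p < q) || (lo p == hi p)) ps ->
    sumn [seq (hi p - lo p).+1 | p <- ps] = q.+1 ->
    cycle (fun p q => edge (nth x0 L (upto p)) (nth x0 L (from q))) ps -> False.
  move=> h1 h2 h3 h4 h5; suff : q.+1 <= size C by move: cQ; rewrite leqNgt => /negP.
  rewrite -h4; apply: (reroute3 (P := [:: x]) (R := [::]) longC uL sQ isT isT _ h2 h5).
  apply/allP => p pps; move: (allP h1 _ pps) (allP h3 _ pps); rewrite /= -/q.
  by clear; nlia.
rewrite /good_end -/q; clearbody q; pose e k := nth x0 L k.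
have adj_x k : k < q -> edge x (nth x0 Q k) -> edge (e q) (e k) && edge (e k) (e q).
  by move=> kq xk; rewrite /e nthx (nthQ k kq) [edge _ x]edge_sym xk.
have adj j k : j < q -> k < q -> edge (nth x0 Q j) (nth x0 Q k) -> edge (e j) (e k) && edge (e k) (e j).
  by move=> jq kq jk; rewrite /e !nthQ // [edge (nth x0 Q k) _]edge_sym jk.
have q0 : 0 < q by nlia.
have qq : q.-1 < q by nlia.
clear uQ sQ xQ; case=> [/(adj_x _ q0)/andP[a1 a2]|[k [k0 kq h1 h2 /(adj _ _ q0 (ltnW kq))/andP[a1 a2]]]];
  last have /andP[b1 b2] := adj_x _ (leq_ltn_trans (leq_pred _) (ltnW kq)) h1;
  last have /andP[c1 c2] := adj_x _ kq h2;
  case=> [/(adj_x _ qq)/andP[d1 d2]|[l [l0 lq h3 h4 /(adj _ _ qq (ltnW lq))/andP[d1 d2]]]];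
  try have /andP[f1 f2] := adj_x _ (leq_ltn_trans (leq_pred _) (ltnW lq)) h3;
  try have /andP[g1 g2] := adj_x _ lq h4.
- apply: (walks [:: up 0 q.-1; up q q]); rewrite /= /from /upto /lo /hi /= -?/(e _) ?a1 ?d2 //; nlia.
- apply: (walks [:: up 0 l; dn q.-1 l.+1; up q q]);
    rewrite /= /from /upto /lo /hi /= -?/(e _) ?a1 ?d2 ?g2 //; nlia.
- apply: (walks [:: dn k.-1 0; up k q.-1; up q q]);
    rewrite /= /from /upto /lo /hi /= -?/(e _) ?a1 ?d2 ?b1 //; nlia.
- have [kl|lk|ekl] := ltngtP k l.
  + apply: (walks [:: dn k.-1 0; up k l; dn q.-1 l.+1; up q q]);
      rewrite /= /from /upto /lo /hi /= -?/(e _) ?a1 ?d2 ?g2 ?b1 //; nlia.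
  + apply: (walks [:: dn l.-1 0; up k q.-1; up l k.-1; up q q]);
      rewrite /= /from /upto /lo /hi /= -?/(e _) ?a1 ?d1 ?b2 ?f1 //; nlia.
  + subst l; apply: (walks [:: up 0 k.-1; up q q; up k.+1 q.-1; up k k]);
      rewrite /= /from /upto /lo /hi /= -?/(e _) ?a2 ?b2 ?c1 ?d1 //; nlia.
Qed.

End Ends.

(** * Singles and hubs *)

Section NextPrev.
Variables (T : eqType) (C : seq T) (x0 : T).
Hypothesis uC : uniq C.

Lemma next_at k : k.+1 < size C -> next C (nth x0 C k) = nth x0 C k.+1.
Proof.
move=> kc; rewrite next_nth mem_nth ?(ltnW kc) // index_uniq ?(ltnW kc) //.
by case: C kc => //= y p kp; apply: set_nth_default.
Qed.

Lemma next_last : 0 < size C -> next C (nth x0 C (size C).-1) = nth x0 C 0.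
Proof.
move=> c0; have kc : (size C).-1 < size C by rewrite ltn_predL.
rewrite next_nth mem_nth // index_uniq //.
by case: C => //= y p; rewrite nth_default.
Qed.

Lemma prev_at k : k.+1 < size C -> prev C (nth x0 C k.+1) = nth x0 C k.
Proof. by move=> kc; rewrite -next_at // prev_next. Qed.

Lemma prev_first : 0 < size C -> prev C (nth x0 C 0) = nth x0 C (size C).-1.
Proof. by move=> c0; rewrite -next_last // prev_next. Qed.

End NextPrev.

Section Hubs.
Variables (G : sgraph) (C : seq G) (x : G).
Hypotheses (longC : longest C) (xC : x \notin C).
Hypothesis dom : forall C' (y z : G), longest C' -> y \notin C' -> z \notin C' -> ~~ edge y z.

(** Exchanging a single with [x] gives another longest cycle. Hence singles resemble
    [x], and the hubs, adjacent to [x] or to a single, resemble neighbours of [x]: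
    they satisfy the same exchange properties, although there may be more of
    them. *)
Definition single w := [&& w \in C, edge x (prev C w) & edge x (next C w)].
Definition hub v := (v \in C) && (edge x v || [exists w, single w && edge v w]).

Let uC : uniq C. Proof. by case: longC. Qed.

Lemma linked_single u w : linked C u w ->
  edge u w \/ exists z, [/\ z \notin C, edge u z & edge z w].
Proof.
case/orP=> [|/existsP[y /andP[/existsP[z /and3P[uz zC zy]] yw]]]; first by left.
right; exists z; split=> //; case/connectP: zy => -[|t p] /=; first by move=> _ <-.
by case/andP=> /and3P[_ tC zt]; rewrite (negbTE (dom longC zC tC)) in zt.
Qed.

Lemma turn v : v \in C -> exists C' : seq G, [/\ longest C', C' =i C, size C' = size C,
  next C' =1 next C & prev C' =1 prev C] /\
  [/\ 0 < size C, nth x C' (size C).-1 = v & nth x C' 0 = next C v].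
Proof.
move=> vC; have [i [s eqC]] := rot_end vC; exists (rot i C).
have c0 : 0 < size C by case: C vC.
have eqv : nth x (rot i C) (size C).-1 = v by rewrite -(size_rot i) nth_last eqC last_rcons.
split; split=> //.
- exact: longest_rot.
- exact: mem_rot.
- exact: size_rot.
- exact: next_rot.
- exact: prev_rot.
- by rewrite -{1}eqv -(next_rot i uC) -(size_rot i) next_last ?rot_uniq ?size_rot.
Qed.

Lemma good_single (Q : seq G) w v k : single w -> edge v w -> 0 < k -> k.+1 < size Q -> nth x Q k = w ->
    (nth x Q k.-1 = prev C w /\ nth x Q k.+1 = next C w) \/
    (nth x Q k.-1 = next C w /\ nth x Q k.+1 = prev C w) -> good_end x x Q v.
Proof.
move=> /and3P[_ h1 h2] vw k0 kq kw h; right; exists k; rewrite kw.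
by case: h => -[-> ->].
Qed.

Lemma consecutive_ends v : v \in C ->
  (forall (Q : seq G), longest Q -> Q =i C -> size Q = size C -> next Q =1 next C -> prev Q =1 prev C -> 1 < size C ->
     nth x Q (size C).-1 = v -> nth x Q 0 = next C v ->
     good_end x x Q v /\ good_end x x Q (next C v)) -> False.
Proof.
move=> vC h; have [Q [[lQ memQ szQ nQ pQ] [c0 endQ startQ]]] := turn vC.
have c1 : 1 < size C.
  case: longC => _ + _; case: (C) c0 => [|a [|b s]] //=.
  by rewrite edge_irrefl.
have [h1 h2] := h Q lQ memQ szQ nQ pQ c1 endQ startQ.
apply: (@no_good_ends G C x x longC Q); rewrite ?szQ ?endQ ?startQ //.
- by case: lQ.
- exact: cycle_sorted.
- by rewrite memQ.
Qed.

Lemma attached_next v : v \in C -> edge x v -> ~~ edge x (next C v).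
Proof.
by move=> vC xv; apply/negP => xn; apply: (consecutive_ends vC) => Q *; split; left.
Qed.

(** Replacing the edges from [v] and [v'] to their successors by a link of these
    successors turns the cycle into a path from [v] to [v'] in which the other
    vertices keep their neighbours. *)
Lemma crossing_ends v v' R : v \in C -> v' \in C -> v != v' -> uniq R -> x \notin R ->
    {in R, forall z, z \notin C} -> path (@edge G) (next C v') (rcons R (next C v)) ->
  (forall (Q : seq G), (forall w, w \in C -> w != v -> w != v' -> w != next C v -> w != next C v' ->
     exists k, [/\ 0 < k, k.+1 < size Q, nth x Q k = w &
       (nth x Q k.-1 = prev C w /\ nth x Q k.+1 = next C w) \/
       (nth x Q k.-1 = next C w /\ nth x Q k.+1 = prev C w)]) ->
     good_end x x Q v /\ good_end x x Q v') -> False.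
Proof.
move=> vC v'C vv' uR xR RC pR h.
have [C' [[lC' memC' szC' nC' pC'] [c0 endC' startC']]] := turn v'C.
have uC' : uniq C' by case: lC'.
have vC' : v \in C' by rewrite memC'.
have [p pc cp] : exists2 p, p < size C & nth x C' p = v.
  by exists (index v C'); rewrite ?nth_index // -szC' index_mem.
have pc' : p.+1 < size C.
  rewrite ltn_neqAle pc andbT; apply: contraNneq vv' => e.
  by rewrite -cp -endC' -e.
have cp1 : nth x C' p.+1 = next C v by rewrite -nC' -cp next_at // szC'.
pose Q := rev (take p.+1 C') ++ R ++ drop p.+1 C'.
have sz1 : size (rev (take p.+1 C')) = p.+1 by rewrite size_rev size_takel // szC' ltnW.
have szQ : size Q = size C + size R.
  by rewrite /Q !size_cat sz1 size_drop szC'; clear -pc'; nlia.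
have nthQ1 j : j <= p -> nth x Q j = nth x C' (p - j).
  move=> jp; rewrite /Q nth_cat sz1 ltnS jp nth_rev; last by rewrite -size_rev sz1.
  rewrite size_takel ?szC' 1?ltnW // subSS nth_take // ltnS leq_subr.
  by [].
have nthQ2 j : p < j -> nth x Q (j + size R) = nth x C' j.
  move=> pj; rewrite /Q catA nth_cat size_cat sz1 ltnNge leq_add2r pj /=.
  have -> : j + size R - (p.+1 + size R) = j - p.+1 by clear -pj; nlia.
  by rewrite nth_drop subnKC.
have uQ : uniq Q.
  rewrite /Q (perm_uniq (s2 := R ++ C')); last first.
    rewrite -[in X in perm_eq _ X](cat_take_drop p.+1 C') perm_sym perm_catCA perm_cat2r.
    by rewrite perm_sym perm_rev.
  rewrite cat_uniq uR uC' andbT; apply/hasPn => z; rewrite memC' => zC.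
  by apply/negP => /RC; rewrite zC.
have sC' : sorted (@edge G) C' by apply: cycle_sorted.
have sQ : sorted (@edge G) Q.
  have s1 : sorted (@edge G) (rev (take p.+1 C')).
    rewrite rev_sorted; apply: sub_sorted (take_sorted _ sC') => a b.
    by rewrite edge_sym.
  have s2 : sorted (@edge G) (drop p.+1 C') by apply: drop_sorted.
  have l1 : last x (rev (take p.+1 C')) = next C v'.
    rewrite -nth_last sz1 nth_rev; last by rewrite -size_rev sz1.
    by rewrite size_takel ?szC' 1?ltnW // subnn nth_take.
  move: s1 s2 l1; rewrite /Q (drop_nth x) ?szC' // cp1.
  case: (rev _) sz1 => //= a l _ s1 s2 l1.
  rewrite cat_path s1 l1 -cat_rcons cat_path pR last_rcons.
  by case: (drop _ _) s2.
have [h1 h2] : good_end x x Q v /\ good_end x x Q v'.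
  apply: h => w wC wv wv' wn wn'.
  have wC' : w \in C' by rewrite memC'.
  have [k kc ck] : exists2 k, k < size C & nth x C' k = w.
    by exists (index w C'); rewrite ?nth_index // -szC' index_mem.
  have k0 : k != 0 by apply: contraNneq wn' => e; rewrite -ck e startC'.
  have kp : k != p by apply: contraNneq wv => e; rewrite -ck e cp.
  have kp1 : k != p.+1 by apply: contraNneq wn => e; rewrite -ck e cp1.
  have kl : k != (size C).-1 by apply: contraNneq wv' => e; rewrite -ck e endC'.
  have k0' : 0 < k by rewrite lt0n.
  have kc' : k.+1 < size C.
    rewrite ltn_neqAle kc andbT; apply: contraNneq kl => <-; by [].
  have ew1 : nth x C' k.+1 = next C w by rewrite -nC' -ck next_at // szC'.
  have ew2 : nth x C' k.-1 = prev C w.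
    by rewrite -pC' -ck -{2}(prednK k0') prev_at // szC' prednK.
  have [lt|gt|ekp] := ltngtP k p; last by rewrite ekp eqxx in kp.
    exists (p - k); split.
    - by rewrite subn_gt0.
    - by rewrite szQ; apply: leq_trans (leq_addr _ _); apply: leq_trans pc'; rewrite ltnS ltnS leq_subr.
    - by rewrite nthQ1 ?leq_subr // subKn // ltnW.
    - right; split.
      + rewrite nthQ1; last by rewrite (leq_trans (leq_pred _)) ?leq_subr.
        by rewrite -subnS subKn.
      + have -> : (p - k).+1 = p - k.-1 by clear -lt k0'; nlia.
        by rewrite nthQ1 ?leq_subr // subKn //; clear -lt; nlia.
  exists (k + size R); split.
  - by rewrite ltn_addr.
  - by rewrite szQ -addSn ltn_add2r.
  - by rewrite nthQ2.
  - left; split; last by rewrite -addSn nthQ2 // ltnW.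
    have -> : (k + size R).-1 = k.-1 + size R by clear -k0'; nlia.
    by rewrite nthQ2 //; clear -gt kp1; nlia.
apply: (no_good_ends longC uQ sQ _ _ _ (x0 := x) (x := x)).
- rewrite /Q !mem_cat mem_rev !negb_or xR /=; apply/andP; split.
    by apply: contra xC => /mem_take; rewrite memC'.
  by apply: contra xC => /mem_drop; rewrite memC'.
- by rewrite szQ leq_addr.
- by rewrite szQ ltn_addr // (leq_ltn_trans _ pc').
- by rewrite nthQ1 // subn0 cp.
- rewrite szQ (_ : (size C + size R).-1 = (size C).-1 + size R); last by clear -pc'; nlia.
  by rewrite nthQ2 ?endC' //; clear -pc'; nlia.
Qed.

Lemma single_cycle w : single w -> w \in C. Proof. by case/and3P. Qed.

Lemma single_prev w : single w -> prev C w \in C /\ edge x (prev C w).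
Proof. by case/and3P=> wC xp _; rewrite mem_prev. Qed.

Lemma single_not_attached w : single w -> ~~ edge x w.
Proof.
move=> sw; have [pC xp] := single_prev sw.
by have := attached_next pC xp; rewrite next_prev.
Qed.

Lemma single_indep w w' : single w -> single w' -> ~~ edge w w'.
Proof.
move=> sw sw'; have [->|ne] := eqVneq w w'; first by rewrite edge_irrefl.
have [pC xp] := single_prev sw; have [pC' xp'] := single_prev sw'.
apply/negP => e; apply: (@crossing_ends (prev C w') (prev C w) [::]) => //.
- by apply: contraNneq ne => /(congr1 (next C)); rewrite !next_prev // => ->.
- by rewrite /= !next_prev // e.
- by move=> Q _; split; left.
Qed.

(** After the exchange of [w] and [x], the vertices [w] and [z] lie outside a longest
    cycle. *)
Lemma single_out w z : single w -> z \notin C -> ~~ edge w z.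
Proof.
move=> sw zC; have [->|zx] := eqVneq z x; first by rewrite edge_sym single_not_attached.
case/and3P: (sw) => wC xp xn; have [i [s eqC]] := rot_head wC.
have lC := longest_rot i longC.
have uC' : uniq (rot i C) by rewrite rot_uniq.
move: xp xn; rewrite -(next_rot i uC) -(prev_rot i uC).
have memC := mem_rot i C.
move: (rot i C) eqC lC uC' memC => D -> {i} [uD cD maxD] uD' memD.
have ws : w \notin s by move: uD => /= /andP[].
have xs : x \notin s by apply: contra xC => xs; rewrite -memD inE xs orbT.
have zs : z \notin s by apply: contra zC => zs; rewrite -memD inE zs orbT.
have xw : w != x by apply: contraNneq xC => <-.
case: s uD cD maxD uD' memD ws xs zs => [|y s] uD cD maxD uD' memD ws xs zs.
  by move: cD; rewrite /= edge_irrefl.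
have -> : next (w :: y :: s) w = y by apply: (@next_at _ (w :: y :: s) w uD 0).
have -> : prev (w :: y :: s) w = last y s.
  by rewrite (@prev_first _ (w :: y :: s) w uD) //= -[size s]/(size (y :: s)).-1 nth_last.
move=> xp xn; have lx : longest (x :: y :: s).
  split=> //; first by rewrite /= in uD *; move: uD => /and3P[_ -> ->]; rewrite xs.
  move: cD; rewrite /= !rcons_path xn => /and3P[_ -> _] /=.
  by rewrite edge_sym.
by apply: (dom lx); rewrite inE negb_or ?zx ?zs ?xw ?ws.
Qed.

Lemma hub_not_single v : hub v -> ~~ single v.
Proof.
case/andP=> vC /orP[xv|/existsP[w /andP[sw vw]]]; apply/negP => sv.
  by have := single_not_attached sv; rewrite xv.
by have := single_indep sv sw; rewrite vw.
Qed.

Lemma single_nbr w v : single w -> edge w v -> hub v.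
Proof.
move=> sw wv; have vC : v \in C by apply: contraLR wv => vC; apply: single_out.
by rewrite /hub vC; apply/orP; right; apply/existsP; exists w; rewrite sw edge_sym.
Qed.

Lemma hub_next v : hub v -> ~~ hub (next C v).
Proof.
move=> hv; apply/negP => hn; have vC : v \in C by case/andP: hv.
apply: (consecutive_ends vC) => Q lQ memQ szQ nQ pQ c1 endQ startQ.
have uQ : uniq Q by case: lQ.
have good u : hub u -> good_end x x Q u.
  case/andP=> uC' /orP[xu|/existsP[w /andP[sw uw]]]; first by left.
  have wQ : w \in Q by rewrite memQ single_cycle.
  have [k kc ck] : exists2 k, k < size C & nth x Q k = w.
    by exists (index w Q); rewrite ?nth_index // -szQ index_mem.
  have k0 : 0 < k.
    rewrite lt0n; apply: contraTneq sw => e; rewrite -ck e startQ.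
    exact: hub_not_single.
  have kl : k.+1 < size C.
    rewrite ltn_neqAle kc andbT; apply: contraTneq sw => e; rewrite -ck.
    by rewrite (_ : k = (size C).-1) ?endQ ?hub_not_single // -e.
  apply: (good_single sw uw k0 _ ck); first by rewrite szQ.
  left; split; last by rewrite -nQ -ck next_at // szQ.
  by rewrite -pQ -ck -{2}(prednK k0) prev_at // szQ prednK.
by split; apply: good.
Qed.

Lemma hub_succ v v' : hub v -> hub v' -> v != v' -> ~~ linked C (next C v) (next C v').
Proof.
move=> hv hv' ne; have vC : v \in C by case/andP: hv.
have v'C : v' \in C by case/andP: hv'.
have nlink w w' : single w -> ~~ hub w' -> ~~ linked C w w'.
  move=> sw nh; apply/negP => /linked_single[e|[z [zC wz _]]].
    by rewrite (single_nbr sw e) in nh.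
  by rewrite (negbTE (single_out sw zC)) in wz.
have [sn|nsn] := boolP (single (next C v)); first by apply: nlink (hub_next hv').
have [sn'|nsn'] := boolP (single (next C v')).
  by rewrite linked_sym; apply: nlink (hub_next hv).
apply/negP => lk.
have [R [uR xR RC pR]] : exists R, [/\ uniq R, x \notin R, {in R, forall z, z \notin C} &
    path (@edge G) (next C v') (rcons R (next C v))].
  case: (linked_single lk) => [e|[z [zC e1 e2]]].
    by exists [::]; rewrite /= edge_sym e.
  exists [:: z]; rewrite /= edge_sym e2 edge_sym e1 inE; split=> //.
    apply: contraL (hub_next hv) => /eqP xz; subst z.
    by rewrite /hub mem_next vC edge_sym e1.
  by move=> t; rewrite inE => /eqP->.
apply: (crossing_ends vC v'C ne uR xR RC pR) => Q hQ.
have good u : hub u -> good_end x x Q u.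
  case/andP=> uC' /orP[xu|/existsP[w /andP[sw uw]]]; first by left.
  have wne t : ~~ single t -> w != t by move=> nt; apply: contraNneq nt => <-.
  have [k [k0 kq kw h]] := hQ w (single_cycle sw) (wne _ (hub_not_single hv))
    (wne _ (hub_not_single hv')) (wne _ nsn) (wne _ nsn').
  exact: good_single sw uw k0 kq kw h.
by split; apply: good.
Qed.

End Hubs.

Section Backwards.
Variables (G : sgraph) (C : seq G) (x : G).
Hypotheses (longC : longest C) (xC : x \notin C).
Hypothesis dom : forall C' (y z : G), longest C' -> y \notin C' -> z \notin C' -> ~~ edge y z.

Lemma longest_rev : longest (rev C).
Proof.
case: longC => uC cC mC; split; rewrite ?rev_uniq ?size_rev //.
by rewrite rev_cycle; apply: sub_cycle cC => a b; rewrite edge_sym.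
Qed.

Let uC : uniq C. Proof. by case: longC. Qed.

Lemma prev_rev : prev (rev C) =1 next C.
Proof. by move=> v; rewrite -next_rev ?rev_uniq // revK. Qed.

Lemma single_rev w : single (rev C) x w = single C x w.
Proof. by rewrite /single mem_rev next_rev // prev_rev; congr (_ && _); apply: andbC. Qed.

Lemma hub_rev v : hub (rev C) x v = hub C x v.
Proof.
rewrite /hub mem_rev; congr (_ && (_ || _)).
by apply: eq_existsb => w; rewrite single_rev.
Qed.

Lemma linked_rev u w : linked (rev C) u w = linked C u w.
Proof.
have eo : off (rev C) =2 off C by move=> a b; rewrite /off !mem_rev.
congr (_ || _); apply: eq_existsb => y; congr (_ && _); apply: eq_existsb => z.
by rewrite mem_rev (eq_connect eo).
Qed.

Lemma hub_pred v v' : hub C x v -> hub C x v' -> v != v' -> ~~ linked C (prev C v) (prev C v').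
Proof.
rewrite -!hub_rev -linked_rev -!next_rev // => h1 h2 ne.
by apply: (hub_succ longest_rev _ dom h1 h2 ne); rewrite mem_rev.
Qed.

End Backwards.

(** * Extra vertices *)

Section Extras.
Variables (G : sgraph) (C : seq G) (x x0 : G) (T : {set G}).
Local Notation "c_( k )" := (nth x0 C k).
Local Notation c := (size C).
Hypotheses (tough : tough_over1 G) (uC : uniq C) (xC : x \notin C).
Hypotheses (TC : {subset T <= C}) (T2 : 1 < #|T|).
Hypothesis xT : forall y v, connect (off C) x y -> v \in C -> edge y v -> v \in T.
Hypotheses (T0 : c_(0) \in T) (T_end : c_(c.-1) \notin T).
Hypothesis T_succ : forall k, k.+1 < c -> c_(k) \in T -> c_(k.+1) \notin T.

(** Each vertex of [T] and its successor account for two vertices of the cycle; the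
    extra vertices are the others. *)
Definition extra k := [&& 0 < k, k < c, c_(k.-1) \notin T & c_(k) \notin T].

Lemma count_extra : count extra (iota 0 c) + 2 * #|T| = c.
Proof.
have -> : #|T| = count (fun k => c_(k) \in T) (iota 0 c).
  have -> : #|T| = #|[set v in C | v \in T]|.
    by apply: eq_card => v; rewrite inE; case vT: (v \in T); rewrite ?andbF // (TC vT).
  by rewrite card_cycle // -[in LHS](mkseq_nth x0 C) count_map.
have c0 : 0 < c by case: C TC T2 => // h; rewrite (_ : T = set0) ?cards0 //;
  apply/setP => v; rewrite inE; apply/negbTE/negP => /h.
have -> : count extra (iota 0 c) = count (fun k => extra k.+1) (iota 0 c.-1).
  have -> : iota 0 c = 0 :: iota 1 c.-1 by rewrite -[in LHS](prednK c0).
  by rewrite /= add0n (iotaDl 1 0) count_map; apply: eq_count => k.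
have cS (f : pred nat) n : count f (iota 0 n.+1) = count f (iota 0 n) + f n.
  by rewrite -addn1 iotaD count_cat /= addn0.
have h n : n <= c.-1 -> count (fun k => extra k.+1) (iota 0 n) +
    2 * count (fun k => c_(k) \in T) (iota 0 n.+1) = n.+1 + (c_(n) \in T).
  elim: n => [|n IH] nc; first by rewrite /= T0.
  have n1c : n.+1 < c by rewrite -(prednK c0) ltnS.
  rewrite (cS _ n) [in 2 * _](cS _ n.+1); have := IH (ltnW nc); have := T_succ n1c.
  rewrite /extra /= n1c; case: (c_(n) \in T); case: (c_(n.+1) \in T) => /=;
    try move=> /(_ isT) //; clear; move: (count _ _) (count _ _) => n1 n2; nlia.
have := h c.-1 (leqnn _); rewrite (negbTE T_end) prednK //; nlia.
Qed.

Hypothesis succ_unlinked : forall i j, i.+1 < c -> j.+1 < c -> i != j ->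
  c_(i) \in T -> c_(j) \in T -> ~~ linked C c_(i.+1) c_(j.+1).
Definition before k := (k.+1 == c) || (c_(k.+1) \in T).
Hypothesis pred_unlinked : forall u w, u < c -> w < c -> u != w ->
  before u -> before w -> ~~ linked C c_(u) c_(w).

(** Two first vertices of segments are not linked, and neither are two last ones. *)
Lemma linked_extra u w : u < c -> w < c -> u != w -> c_(u) \notin T -> c_(w) \notin T ->
  linked C c_(u) c_(w) -> (extra u || extra w) && (extra u.+1 || extra w.+1).
Proof.
move=> uc wc uw uT wT lk.
have first k : k < c -> c_(k) \notin T -> ~~ extra k -> 0 < k /\ c_(k.-1) \in T.
  move=> kc kT; have k0 : 0 < k by rewrite lt0n; apply: contraNneq kT => ->.
  by rewrite /extra k0 kc kT andbT /= negbK.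
have last k : k < c -> c_(k) \notin T -> ~~ extra k.+1 -> before k.
  move=> kc kT; rewrite /extra /before /= kT /=.
  by have [//|ne] := eqVneq k.+1 c; rewrite ltn_neqAle ne kc /= negbK.
apply/andP; split; apply: contraTT lk; rewrite negb_or => /andP[nu nw].
  have [u0 u1] := first u uc uT nu; have [w0 w1] := first w wc wT nw.
  rewrite -(prednK u0) -(prednK w0); apply: succ_unlinked; rewrite ?prednK //.
  by apply: contraNneq uw => e; rewrite -(prednK u0) e prednK.
by apply: pred_unlinked => //; apply: last.
Qed.

Lemma extra_seg k : extra k.+1 -> seg C T k.+1 = seg C T k.
Proof. by case/and4P=> _ kc _ kT; rewrite (segS x0) // (negbTE kT) addn0. Qed.

(** Adding [c_(e)] to [T] splits the only segment with more than two vertices; the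
    links that remain possible are between the pieces next to [c_(e)]. *)
Lemma adjacent_extras e : extra e -> extra e.+1 -> (forall k, extra k -> k = e \/ k = e.+1) -> False.
Proof.
move=> ee ee1 only; have /and4P[e0 ec e1T eT] := ee; have /and4P[_ ec1 _ eT1] := ee1.
pose T' := c_(e) |: T.
have eC : c_(e) \in C by rewrite mem_nth.
have inT' k : k < c -> (c_(k) \in T') = (k == e) || (c_(k) \in T).
  by move=> kc; rewrite in_setU1 nth_uniq.
have T'C : {subset T' <= C} by move=> v /setU1P[->//|]; apply: TC.
have c0 : 0 < c by apply: leq_ltn_trans ec.
have T'2 : 1 < #|T'| by apply: leq_trans T2 _; rewrite subset_leq_card // subsetUr.
have endT' : c_(c.-1) \notin T'.
  rewrite inT' ?ltn_predL // negb_or T_end andbT; apply: contraTneq ec1 => <-.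
  by rewrite prednK // ltnn.
have succT' k : k.+1 < c -> c_(k) \in T' -> c_(k.+1) \notin T'.
  move=> kc; rewrite !inT' ?(ltnW kc) // negb_or => /orP[/eqP->|kT].
    by rewrite eT1 andbT neq_ltn ltnSn orbT.
  by rewrite T_succ // andbT; apply: contraNneq e1T => <-.
have xT' y v : connect (off C) x y -> v \in C -> edge y v -> v \in T'.
  by move=> h1 h2 h3; rewrite in_setU1 (xT h1 h2 h3) orbT.
have [u [w [[uc wc uT wT lk] [ne na nb]]]] := @segments_linked G C x0 T' tough uC T'C endT'
  succT' x (seg C T' e.-1) (seg C T' e.+1) T'2 xC xT'.
move: uT wT; rewrite !inT' // !negb_or => /andP[ue uT] /andP[we wT].
have uw : u != w by apply: contraNneq ne => ->.
have key a b : u < c -> w < c -> (a == u) && (b == w) || (a == w) && (b == u) -> a = e.+1 ->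
    extra b.+1 -> False.
  move=> _ _ ab ae /only[be|be]; last first.
    have {}be : b = e by case: be.
    by move: ab; rewrite be ![e == _]eq_sym (negbTE ue) (negbTE we) !andbF.
  have {}be : b = e.-1 by rewrite -be.
  by case/orP: ab na nb => /andP[/eqP<- /eqP<-]; rewrite ae be !eqxx.
have /andP[] := linked_extra uc wc uw uT wT lk.
have only1 k : k != e -> extra k -> k = e.+1 by move=> ke /only[ek|//]; rewrite ek eqxx in ke.
have no2 : extra e.+2 -> False by case/only=> ee2; move/eqP: ee2; clear; nlia.
case/orP=> [/(only1 _ ue) eu|/(only1 _ we) ew]; case/orP=> h.
- by apply: no2; rewrite -eu.
- by apply: (key u w) => //; rewrite !eqxx.
- by apply: (key w u) => //; rewrite !eqxx orbT.
- by apply: no2; rewrite -ew.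
Qed.

(** With at most two extra vertices the toughness fails. If both lie in one
    segment [t, t+, e, e+1], the vertex [e] is added to [T]; in the remaining
    cases only the segments that end with an extra vertex can be linked. *)
Lemma few_extras : c <= 2 * #|T| + 2 -> False.
Proof.
move=> few; have cnt := count_extra.
have [e1 [e2 only]] : exists e1 e2, forall k, extra k -> k = e1 \/ k = e2.
  have : size (filter extra (iota 0 c)) <= 2 by rewrite size_filter; nlia.
  have mem k : extra k -> k \in filter extra (iota 0 c).
    by move=> ek; rewrite mem_filter ek mem_iota; case/and4P: ek.
  case: (filter _ _) mem => [|e1 [|e2 [|? ?]]] // mem _.
  - by exists 0, 0 => k /mem.
  - by exists e1, e1 => k /mem; rewrite inE => /eqP->; left.
  - by exists e1, e2 => k /mem; rewrite !inE => /orP[]/eqP->; [left|right].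
have [[e ee ee1]|nadj] : (exists2 e, extra e & extra e.+1) \/ forall e, extra e -> extra e.+1 -> False.
  have [/hasP[e _ /andP[]]|no] := boolP (has (fun e => extra e && extra e.+1) (iota 0 c)).
    by left; exists e.
  right=> e ee ee1; case/negP: no; apply/hasP; exists e; rewrite ?ee //.
  by rewrite mem_iota; case/and4P: ee.
  apply: (adjacent_extras ee ee1) => k ek.
  by move: (only _ ek) (only _ ee) (only _ ee1); clear; nlia.
have [u [w [[uc wc uT wT lk] [ne na nb]]]] := @segments_linked G C x0 T tough uC TC T_end
  T_succ x (seg C T e1) (seg C T e2) T2 xC xT.
have uw : u != w by apply: contraNneq ne => ->.
have key a b : (a == u) && (b == w) || (a == w) && (b == u) -> extra a -> extra b.+1 -> False.
  move=> ab ea eb; have sb := extra_seg eb.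
  have nab : a != b.+1.
    apply: contraNneq ne => e; rewrite e in ab sb.
    by case/orP: ab => /andP[/eqP<- /eqP<-]; rewrite sb.
  have [[ea1 eb2]|[ea2 eb1]] : (a = e1 /\ b.+1 = e2) \/ (a = e2 /\ b.+1 = e1).
    by move: (only _ ea) (only _ eb) nab; clear; nlia.
    by move: na nb; rewrite -ea1 -eb2 sb; case/orP: ab => /andP[/eqP<- /eqP<-]; rewrite !eqxx.
  by move: na nb; rewrite -ea2 -eb1 sb; case/orP: ab => /andP[/eqP<- /eqP<-]; rewrite !eqxx.
have /andP[] := linked_extra uc wc uw uT wT lk.
case/orP=> h1; case/orP=> h2.
- exact: nadj h1 h2.
- by apply: (key u w) => //; rewrite !eqxx.
- by apply: (key w u) => //; rewrite !eqxx orbT.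
- exact: nadj h1 h2.
Qed.

End Extras.

(** * Neighbourhood of a vertex outside a longest cycle *)

Section Tight.
Variables (G : sgraph) (d : nat).
Hypotheses (tough : tough_over1 G) (deg : forall x : G, d <= degree x).
Hypotheses (order : #|G| <= d.*2 + 5) (d3 : 2 < d).
Hypothesis dom : forall C (y z : G), longest C -> y \notin C -> z \notin C -> ~~ edge y z.
Variables (C : seq G) (x : G).
Hypotheses (longC : longest C) (xC : x \notin C).
Local Notation c := (size C).
Local Notation "c_( k )" := (nth x C k).
Local Notation S := [set v | edge x v].

Let uC : uniq C. Proof. by case: longC. Qed.

Lemma nbr_cycle v : edge x v -> v \in C.
Proof. by apply: contraLR => vC; apply: dom longC xC vC. Qed.

Lemma card_N : d <= #|S|. Proof. exact: deg. Qed.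

Lemma only_x y : connect (off C) x y -> y = x.
Proof.
case/connectP=> -[|z p] /=; first by move=> _ ->.
by case/andP=> /and3P[_ zC xz]; rewrite (negbTE (dom longC xC zC)) in xz.
Qed.

Lemma card_cycle_lt : c < #|G|.
Proof.
have -> : c = #|[set y in C]| by rewrite cardsE; apply/esym/card_uniqP.
rewrite -(cardsC [set y in C]) -addn1 leq_add2l; apply/card_gt0P; exists x.
by rewrite !inE.
Qed.

Section Based.
Hypothesis x0 : edge x c_(0).

Let c0 : 0 < c. Proof. by case: (C) (nbr_cycle x0). Qed.
Let T := [set v | hub C x v].

Lemma hub_of_nbr v : edge x v -> hub C x v.
Proof. by move=> xv; rewrite /hub nbr_cycle // xv. Qed.

Lemma hubs_before u : u < c -> before C x T u -> hub C x (next C c_(u)).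
Proof.
move=> uc; rewrite /before; have [e _|ne /=] := eqVneq u.+1 c.
  by rewrite (_ : u = c.-1) ?next_last ?hub_of_nbr // -e.
by rewrite next_at ?inE // ltn_neqAle ne.
Qed.

(** A shorter cycle would leave at most two extra vertices for the set of hubs. *)
Lemma cycle_long : 2 * #|T| + 2 < c.
Proof.
rewrite ltnNge; apply/negP => few.
have Tsub : {subset T <= C} by move=> v; rewrite inE => /andP[].
have T2 : 1 < #|T|.
  apply: leq_trans (ltnW d3) _; apply: leq_trans card_N _.
  by apply/subset_leq_card/subsetP => v; rewrite !inE; apply: hub_of_nbr.
have xT y v : connect (off C) x y -> v \in C -> edge y v -> v \in T.
  by move=> /only_x-> _ xv; rewrite inE hub_of_nbr.
have hnext := hub_next longC xC.
apply: (few_extras tough uC xC Tsub T2 xT _ _ _ _ _ few (x0 := x)).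
- by rewrite inE hub_of_nbr.
- rewrite inE; apply/negP => /hnext; rewrite next_last // hub_of_nbr //.
- by move=> k kc; rewrite !inE => /hnext; rewrite next_at.
- move=> i j ic jc ij; rewrite !inE => hi hj.
  rewrite -!next_at //; apply: (hub_succ longC xC dom hi hj).
  by rewrite nth_uniq // ltnW.
- move=> u w uc wc uw bu bw.
  have := @hub_pred _ _ _ longC xC dom _ _ (hubs_before uc bu) (hubs_before wc bw).
  rewrite !prev_next //; apply; apply: contraNneq uw => /(congr1 (prev C)).
  by rewrite !prev_next // => /eqP; rewrite nth_uniq.
Qed.

(** The order of the graph leaves no room for a hub that is not a neighbour. *)
Lemma hub_nbr v : hub C x v = edge x v.
Proof.
apply/idP/idP; last exact: hub_of_nbr.
have sub : S \subset T by apply/subsetP => u; rewrite !inE; apply: hub_of_nbr.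
suff /eqP e : S == T by move=> hv; have : v \in T by [rewrite inE]; rewrite -e inE.
by rewrite eqEcard sub; move: cycle_long card_cycle_lt order card_N; nlia.
Qed.

Lemma tight_card : #|S| = d.
Proof.
have <- : T = S by apply/setP => v; rewrite !inE hub_nbr.
have := card_N; rewrite (_ : S = T); last by apply/setP => v; rewrite !inE hub_nbr.
by move: cycle_long card_cycle_lt order; nlia.
Qed.

Lemma tight_cycle : 2 * d + 3 <= c.
Proof.
move: cycle_long; rewrite (_ : T = S) ?tight_card; first by nlia.
by apply/setP => v; rewrite !inE hub_nbr.
Qed.

(** The neighbours of a single are hubs, and it has at least [#|S|] of them. *)
Lemma single_complete w : single C x w -> forall v, edge w v = edge x v.
Proof.
move=> sw; suff /setP e : [set v | edge w v] = S by move=> v; have := e v; rewrite !inE.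
apply/eqP; rewrite eqEcard tight_card deg andbT; apply/subsetP => v; rewrite !inE => wv.
by rewrite -hub_nbr; apply: single_nbr wv.
Qed.

Local Notation ext := (extra C x S).
Local Notation bef := (before C x S).
Local Notation sgl k := (single C x c_(k)).

(** The last vertex of a segment with at least two vertices. *)
Definition last_extra k := ext k && bef k.

Lemma nbr_succ k : k.+1 < c -> edge x c_(k) -> ~~ edge x c_(k.+1).
Proof.
move=> kc xk; rewrite -next_at //; apply: (attached_next longC xC) => //.
by rewrite mem_nth // ltnW.
Qed.

Lemma nbr_end : ~~ edge x c_(c.-1).
Proof.
apply: contraL x0 => xe; rewrite -next_last //; apply: (attached_next longC xC) => //.
by rewrite mem_nth // ltn_predL.
Qed.

Lemma single_at k : k < c -> sgl k = [&& 0 < k, edge x c_(k.-1) & bef k].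
Proof.
move=> kc; rewrite /single mem_nth //=; case: k kc => [|k] kc /=.
  by rewrite prev_first // (negbTE nbr_end).
rewrite prev_at //; congr (_ && _); rewrite /before inE.
have [e|ne] := eqVneq k.+2 c; last by rewrite next_at // ltn_neqAle ne.
by rewrite (_ : k.+1 = c.-1) ?next_last // -e.
Qed.

Lemma extra_single k : ext k -> ~~ sgl k.
Proof. by case/and4P=> _ kc h _; rewrite single_at //; move: h; rewrite inE => /negbTE->; rewrite andbF. Qed.

Lemma extra_next k : k < c -> c_(k) \notin S -> ~~ bef k -> ext k.+1.
Proof.
move=> kc kS; rewrite /before negb_or /extra kS => /andP[ne ->].
by rewrite (ltn_neqAle k.+1 c) ne kc.
Qed.

Lemma not_single k : k < c -> c_(k) \notin S -> ~~ sgl k -> ext k \/ ext k.+1.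
Proof.
move=> kc kS nk; have k0 : 0 < k by rewrite lt0n; apply: contraNneq kS => ->; rewrite inE.
have [pS|pS] := boolP (c_(k.-1) \in S); last by left; rewrite /extra k0 kc pS.
right; apply: extra_next => //; apply: contra nk => bk.
by rewrite single_at // k0 bk; move: pS; rewrite inE => ->.
Qed.

Lemma last_after k : k < c -> c_(k) \notin S -> ~~ sgl k ->
  exists j, [/\ k <= j, last_extra j & seg C S j = seg C S k].
Proof.
have [n] := ubnP (c - k); elim: n k => // n IH k kn kc kS nk.
have [ek|nek] := boolP (ext k.+1).
  have sk := extra_seg ek; have [bk|nbk] := boolP (bef k.+1).
    by exists k.+1; split=> //; apply/andP.
  have /and4P[_ kc1 _ kS1] := ek.
  have kn' : c - k.+1 < n by move: kn kc; clear; nlia.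
  have [j [h1 h2 h3]] := IH k.+1 kn' kc1 kS1 (extra_single ek).
  by exists j; split=> //; [apply: ltnW|rewrite h3].
have [ek|ek] := not_single kc kS nk; last by rewrite ek in nek.
exists k; split=> //; rewrite /last_extra ek; apply: contraR nek; exact: extra_next.
Qed.

Lemma linked_not_single u w : w < c -> c_(w) \notin S -> linked C c_(u) c_(w) -> ~~ sgl u.
Proof.
move=> wc wS lk; apply/negP => su.
case: (linked_single longC dom lk) => [e|[z [zC e _]]].
  by have := single_nbr longC xC dom su e; rewrite hub_nbr; move: wS; rewrite inE => /negbTE->.
by rewrite (negbTE (single_out longC xC dom su zC)) in e.
Qed.

Lemma S_cycle : {subset S <= C}. Proof. by move=> v; rewrite inE; apply: nbr_cycle. Qed.
Lemma S_end : c_(c.-1) \notin S. Proof. by rewrite inE nbr_end. Qed.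
Lemma S_succ k : k.+1 < c -> c_(k) \in S -> c_(k.+1) \notin S.
Proof. by rewrite !inE; apply: nbr_succ. Qed.
Lemma S_nbr y v : connect (off C) x y -> v \in C -> edge y v -> v \in S.
Proof. by move=> /only_x-> _; rewrite inE. Qed.
Lemma S_gt1 : 1 < #|S|. Proof. exact: leq_trans (ltnW d3) card_N. Qed.

(** Linked segments are long, for a segment with one vertex consists of a single,
    whose neighbours all lie in [S].
    Toughness links two segments, and then another pair of segments. *)
Lemma three_lasts : 2 < count last_extra (iota 0 c).
Proof.
have links := @segments_linked G C x S tough uC S_cycle S_end S_succ x.
have [u [w [[uc wc uS wS lk] [ne _ _]]]] := links 0 0 S_gt1 xC S_nbr.
have [u' [w' [[uc' wc' uS' wS' lk'] [ne' na nb]]]] :=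
  links (seg C S u) (seg C S w) S_gt1 xC S_nbr.
have lst k m : k < c -> m < c -> c_(k) \notin S -> c_(m) \notin S -> linked C c_(k) c_(m) ->
    exists2 j, last_extra j & seg C S j = seg C S k.
  move=> kc mc kS mS l; have [j [_ h1 h2]] := last_after kc kS (linked_not_single mc mS l).
  by exists j.
have lsym a b : linked C a b -> linked C b a by rewrite linked_sym.
have [j1 h1 e1] := lst u w uc wc uS wS lk.
have [j2 h2 e2] := lst w u wc uc wS uS (lsym _ _ lk).
have [j3 h3 e3] := lst u' w' uc' wc' uS' wS' lk'.
have [j4 h4 e4] := lst w' u' wc' uc' wS' uS' (lsym _ _ lk').
have three a b k : last_extra a -> last_extra b -> last_extra k ->
    uniq [:: seg C S a; seg C S b; seg C S k] -> 2 < count last_extra (iota 0 c).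
  move=> ha hb hk u3; rewrite -size_filter -[3]/(size [:: a; b; k]).
  apply: uniq_leq_size; first by apply: (@map_uniq _ _ (seg C S)).
  move=> j; rewrite mem_filter mem_iota !inE => /or3P[]/eqP->; rewrite ?ha ?hb ?hk;
  by [case/andP: ha => /and4P[]|case/andP: hb => /and4P[]|case/andP: hk => /and4P[]].
move: ne ne' na nb; rewrite -e1 -e2 -e3 -e4 => n1 n2 n3 n4.
have [e31|n31] := eqVneq (seg C S j3) (seg C S j1).
  apply: (three j1 j2 j4) => //; rewrite /= !inE negb_or n1 -e31 n2 /= andbT.
  by apply: contraNneq n3 => e; rewrite e31 -e !eqxx.
have [e32|n32] := eqVneq (seg C S j3) (seg C S j2).
  apply: (three j1 j2 j4) => //; rewrite /= !inE negb_or n1 -e32 n2 /= !andbT.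
  by apply: contraNneq n4 => e; rewrite e32 -e !eqxx.
by apply: (three j1 j2 j3) => //; rewrite /= !inE negb_or n1 eq_sym n31 eq_sym n32.
Qed.

Lemma hubS : T = S. Proof. by apply/setP => v; rewrite !inE hub_nbr. Qed.

Lemma pred_free u w : u < c -> w < c -> u != w -> bef u -> bef w -> ~~ linked C c_(u) c_(w).
Proof.
move=> uc wc uw bu bw.
have := @hub_pred _ _ _ longC xC dom (next C c_(u)) (next C c_(w)).
rewrite !prev_next //; apply; try by apply: hubs_before; rewrite ?hubS.
apply: contraNneq uw => /(congr1 (prev C)).
by rewrite !prev_next // => /eqP; rewrite nth_uniq.
Qed.

Lemma succ_free i j : i.+1 < c -> j.+1 < c -> i != j -> c_(i) \in S -> c_(j) \in S ->
  ~~ linked C c_(i.+1) c_(j.+1).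
Proof.
move=> ic jc ij; rewrite !inE -!hub_nbr => hi hj; rewrite -!next_at //.
by apply: (hub_succ longC xC dom hi hj); rewrite nth_uniq // ltnW.
Qed.

(** There is at most one such vertex, by [three_lasts] and the order of the graph. *)
Definition inner k := ext k && ~~ bef k.

Lemma count_ext : count ext (iota 0 c) + 2 * d = c.
Proof.
have := @count_extra G C x S uC S_cycle S_gt1; rewrite tight_card; apply.
- by rewrite inE.
- exact: S_end.
- exact: S_succ.
Qed.

Lemma count_inner : count last_extra (iota 0 c) + count inner (iota 0 c) = count ext (iota 0 c).
Proof.
rewrite -[RHS]size_filter -(count_predC bef) !count_filter.
by congr (_ + _); apply: eq_count => k; rewrite /= andbC.
Qed.

Lemma inner_next k : inner k -> [/\ k.+1 < c, c_(k.+1) \notin S & ext k.+1].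
Proof.
case/andP=> ek bk; have /and4P[_ kc _ kS] := ek.
have ek1 := extra_next kc kS bk; split=> //; by case/and4P: ek1.
Qed.

Lemma not_inner_before k : ext k -> ~~ inner k -> bef k.
Proof. by rewrite /inner => ->; rewrite negbK. Qed.

Lemma before_not_extra k : k < c -> bef k -> ~~ ext k.+1.
Proof.
move=> kc; rewrite /before => /orP[/eqP e|kS]; apply/negP => /and4P[_ kc' _].
  by rewrite e ltnn in kc'.
by rewrite kS.
Qed.

Lemma first_S k : k < c -> c_(k) \notin S -> ~~ ext k -> exists2 a, k = a.+1 & edge x c_(a).
Proof.
case: k => [|k] kc kS ek; first by rewrite inE x0 in kS.
exists k => //; move: ek; rewrite /extra kc kS andbT /= negbK.
by rewrite inE.
Qed.

(** An edge between the ends of two long segments, from which the reroutings below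
    start. *)
Definition first_last a q := [&& edge x c_(a), ext a.+2, last_extra q,
  edge c_(a.+1) c_(q) & seg C S a.+1 != seg C S q].

(** Adding the inner vertex, if there is one, to the neighbourhood leaves segments
    with at most two vertices, and toughness links two of them: by [pred_free] and
    [succ_free] a first vertex to a last one. A link through a vertex outside the
    cycle uses up the order of the graph, and [cross_succ] excludes it. *)
Lemma exists_first_last : exists a q, first_last a q.
Proof.
have m3 := three_lasts; have ci := count_inner; have ce := count_ext.
have ltcG := card_cycle_lt.
have uniq_inner k k' : inner k -> inner k' -> k = k'.
  move=> ik ik'; have [//|ne] := eqVneq k k'.
  suff : 1 < count inner (iota 0 c) by move: order; nlia.
  rewrite -size_filter -[2]/(size [:: k; k']); apply: uniq_leq_size; first by rewrite /= inE ne.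
  move=> j; rewrite mem_filter mem_iota !inE => /orP[]/eqP->; rewrite ?ik ?ik' /=;
  by [case/andP: ik => /and4P[]|case/andP: ik' => /and4P[]].
pose T' := S :|: [set v in C | inner (index v C)].
have inT' k : k < c -> (c_(k) \in T') = (c_(k) \in S) || inner k.
  by move=> kc; rewrite in_setU [in X in _ || X]inE mem_nth // index_uniq.
have T'C : {subset T' <= C}.
  by move=> v; rewrite !inE => /orP[/nbr_cycle//|/andP[]].
have T'2 : 1 < #|T'| by apply: leq_trans S_gt1 _; rewrite subset_leq_card // subsetUl.
have cc : c.-1 < c by rewrite ltn_predL.
have T'end : c_(c.-1) \notin T'.
  rewrite inT' // (negbTE S_end) /inner /before prednK // eqxx /= andbF.
  by [].
have T'succ k : k.+1 < c -> c_(k) \in T' -> c_(k.+1) \notin T'.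
  move=> kc; rewrite !inT' ?(ltnW kc) // negb_or => /orP[kS|ik].
    rewrite S_succ //; apply/negP => /andP[/and4P[_ _]]; by rewrite /= kS.
  have [_ -> _] := inner_next ik; apply/negP => ik'.
  by have := uniq_inner _ _ ik ik'; clear; nlia.
have T'nbr y v : connect (off C) x y -> v \in C -> edge y v -> v \in T'.
  by move=> h1 h2 h3; rewrite in_setU (S_nbr h1 h2 h3).
pose e0 := find inner (iota 0 c).
have e0P k : inner k -> k = e0.
  move=> ik; have hk : has inner (iota 0 c).
    by apply/hasP; exists k => //; rewrite mem_iota; case/andP: ik => /and4P[].
  apply: uniq_inner => //; have := nth_find 0 hk; rewrite nth_iota // -[X in _ < X](size_iota 0 c).
  by rewrite -has_find.
have [u [w [[uc wc uT wT lk] [ne na nb]]]] := @segments_linked G C x T' tough uC T'C T'end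
  T'succ x (seg C T' e0.-1) (seg C T' e0.+1) T'2 xC T'nbr.
move: (uT) (wT); rewrite !inT' // !negb_or => /andP[uS uI] /andP[wS wI].
have uw : u != w by apply: contraNneq ne => ->.
have := @linked_extra G C x S _ succ_free pred_free u w uc wc uw uS wS lk.
have nex k : k < c -> ~~ inner k -> ext k -> ext k.+1 -> False.
  by move=> kc nk ek; apply/negP/before_not_extra => //; apply: not_inner_before.
have main u1 w1 : u1 < c -> w1 < c -> u1 != w1 -> c_(u1) \notin S -> c_(w1) \notin S ->
    ~~ inner u1 -> ~~ inner w1 -> seg C T' u1 != seg C T' w1 ->
    ~~ ((seg C T' w1 == seg C T' e0.-1) && (seg C T' u1 == seg C T' e0.+1)) ->
    linked C c_(u1) c_(w1) -> ext u1 -> ext w1.+1 -> exists a q, first_last a q.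
  clear u w uc wc uT wT lk ne na nb uS uI wS wI uw.
  move=> uc wc uw uS wS uI wI ne nab lk eu ew.
  have nw : ~~ ext w1 by apply/negP => h; apply: (nex w1).
  have [a wa xa] := first_S wc wS nw; exists a, u1; rewrite /first_last xa -wa ew.
  have lu : last_extra u1 by rewrite /last_extra eu not_inner_before.
  rewrite lu /=; apply/andP; split; last first.
    apply/eqP => es.
    have [lt|gt|e] := ltngtP u1 w1; last by rewrite e eqxx in uw.
      have ua : u1 < a.
        rewrite ltn_neqAle; apply/andP; split; last by move: lt; rewrite wa.
        by apply: contraNneq uS => ->; rewrite inE.
      suff : seg C S u1 < seg C S w1 by rewrite es ltnn.
      by apply: (@ltn_seg _ C x S u1 a w1) => //; rewrite ?wa ?inE // leqnSn.
    have up t : w1 < t -> t <= u1 -> c_(t) \in S -> False.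
      move=> wt tu tS; suff : seg C S w1 < seg C S u1 by rewrite es ltnn.
      exact: (@ltn_seg _ C x S w1 t u1).
    have [eq1|ne1] := eqVneq w1.+1 u1.
      move: ne; rewrite -eq1 (segS x) ?eq1 // inT' // (negbTE uS) (negbTE uI) addn0.
      by rewrite eqxx.
    have w2u : w1.+2 <= u1 by rewrite ltn_neqAle ne1.
    have iw : inner w1.+1.
      rewrite /inner ew /=; apply/negP => /orP[/eqP e|]; first by move: uc w2u e; clear; nlia.
      exact: up.
    have [_ w2S ew2] := inner_next iw.
    have e0w := e0P _ iw.
    have [eq2|ne2] := eqVneq w1.+2 u1.
      by move: nab; rewrite -e0w /= -eq2 !eqxx.
    have w3u : w1.+3 <= u1 by rewrite ltn_neqAle ne2.
    have : bef w1.+2.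
      apply: not_inner_before ew2 _; apply/negP => iw2.
      by have := uniq_inner _ _ iw iw2; clear; nlia.
    case/orP=> [/eqP e|]; first by move: uc w3u e; clear; nlia.
    by apply: up => //; apply: leqW.
  case: (linked_single longC dom lk) => [|[z [zC uz zw]]]; first by rewrite edge_sym.
  exfalso.
  have zx : z != x by apply: contraNneq uS => ezx; rewrite ezx in uz; rewrite inE edge_sym.
  have c2G : c + 2 <= #|G|.
    have -> : c = #|[set y in C]| by rewrite cardsE; apply/esym/card_uniqP.
    rewrite -(cardsC [set y in C]) leq_add2l; apply/card_gt1P; exists z, x.
    by split; rewrite ?inE.
  have noinner k : ~~ inner k.
    apply/negP => ik; suff : 0 < count inner (iota 0 c) by move: order; nlia.
    by rewrite -has_count; apply/hasP; exists k; rewrite ?mem_iota //; case/andP: ik => /and4P[].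
  have /and4P[u0 _ pS _] := eu; have uc' : u1.-1 < c by apply: leq_ltn_trans (leq_pred _) uc.
  have nu : ~~ ext u1.-1.
    apply/negP => ep; have := noinner u1.-1.
    rewrite /inner ep /= negbK /before prednK // (negbTE uS) orbF => /eqP e.
    by rewrite e ltnn in uc.
  have [b ub xb] := first_S uc' pS nu.
  have {}ub : u1 = b.+2 by rewrite -ub prednK.
  have compH := component_connect xC.
  have br i j : edge x c_(i) -> edge x c_(j) ->
      bridge [set y | connect (off C) x y] 1 c_(i) c_(j).
    move=> xi xj; exists x, [::]; rewrite /= [edge _ x]edge_sym xi xj; split=> //.
    by move=> y; rewrite !inE => /eqP->; rewrite connect0.
  have zH : {in [:: z], forall y, y \notin C /\ y \notin [set y | connect (off C) x y]}.
    move=> y; rewrite inE => /eqP->; split=> //; rewrite inE.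
    by apply/negP => /only_x ezx; rewrite ezx eqxx in zx.
  have uz1 : uniq [:: z] by [].
  have [lt|gt|e] := ltngtP u1 w1; last by rewrite e eqxx in uw.
    have ua : u1 <= a by rewrite -ltnS -wa.
    have aw : a < w1 by rewrite wa.
    have pz : path (@edge G) c_(u1) (rcons [:: z] c_(w1)) by rewrite /= uz zw.
    have bu : b < u1 by rewrite ub.
    have := cross_succ longC compH bu ua aw wc (br _ _ xb xa) uz1 zH pz.
    by rewrite ub wa /=; clear; nlia.
  have wb : w1 <= b.
    have : w1 <= b.+1 by rewrite -ltnS -ub.
    rewrite leq_eqVlt => /orP[/eqP e|//].
    have ew1 : w1.+1 = u1 by rewrite ub e.
    by move: ne; rewrite -ew1 (segS x) ?ew1 // inT' // (negbTE uS) (negbTE uI) addn0 eqxx.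
  have aw : a < w1 by rewrite wa.
  have bu : b < u1 by rewrite ub.
  have pz : path (@edge G) c_(w1) (rcons [:: z] c_(u1)).
    by rewrite /= edge_sym zw edge_sym uz.
  have := cross_succ longC compH aw wb bu uc (br _ _ xa xb) uz1 zH pz.
  by rewrite ub wa /=; clear; nlia.
have lk' : linked C c_(w) c_(u) by rewrite linked_sym.
have wu : w != u by rewrite eq_sym.
case/(_ _)/andP; first by rewrite inE.
case/orP=> e1 /orP[] e2.
- by case: (nex u).
- by apply: (main u w) => //; rewrite andbC.
- by apply: (main w u) => //; rewrite eq_sym.
- by case: (nex w).
Qed.

(** If no neighbour of [x] is followed by a single, each is followed by two vertices
    of a segment, which gives at least [d] extra vertices; there are at most four. *)
Lemma exists_single_large : 4 < d -> exists2 k, k < c & sgl k.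
Proof.
move=> d5; have [/hasP[k]|no] := boolP (has (fun k => sgl k) (iota 0 c)).
  by rewrite mem_iota => /andP[_ kc] sk; exists k.
exfalso; have ce := count_ext; have ltcG := card_cycle_lt.
have : d <= count (fun k => ext k.+2) (iota 0 c).
  rewrite -tight_card.
  have -> : #|S| = count [in S] C.
    rewrite -card_cycle //; apply: eq_card => v.
    by rewrite !inE; case xv: (edge x v); rewrite ?andbF // nbr_cycle.
  rewrite -[X in count _ X](mkseq_nth x C) count_map.
  rewrite -!sum1_count ![\sum_(_ <- _ | _) _]big_mkcond /= big_seq [X in _ <= X]big_seq.
  apply: leq_sum => k; rewrite mem_iota => /andP[_ kc].
  case kS: (c_(k) \in S) => //.
  have k1c : k.+1 < c.
    have : k != c.-1 by apply: contraTneq kS => ->; apply: S_end.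
    by move: kc; clear; nlia.
  have nk : ~~ sgl k.+1 by apply: (hasPn no); rewrite mem_iota.
  case: (not_single k1c (S_succ k1c kS) nk) => [/and4P[_ _]|->//].
  by rewrite /= kS.
have -> : count (fun k => ext k.+2) (iota 0 c) = count ext (iota 2 c).
  by rewrite (iotaDl 2 0) count_map.
have : count ext (iota 2 c) <= count ext (iota 0 (2 + c)) by rewrite iotaD count_cat leq_addl.
rewrite addnC iotaD count_cat add0n (_ : count ext (iota c 2) = 0); last first.
  by rewrite /= /extra ltnn (leq_gtF (leqnSn c)) /= !andbF.
by move: ce order d5 ltcG; clear; nlia.
Qed.

(** ** Rerouting with singles *)

Lemma single_edge k j : k < c -> sgl k -> j < c -> edge x c_(j) -> edge c_(k) c_(j).
Proof. by move=> kc sk jc xj; rewrite single_complete. Qed.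

Let uL : uniq (C ++ [:: x] ++ [::]). Proof. by rewrite cats0 cat_uniq uC /= orbF xC. Qed.
Let nthC k : k < c -> nth x (C ++ [:: x]) k = c_(k). Proof. by move=> kc; rewrite nth_cat kc. Qed.
Let nthx : nth x (C ++ [:: x]) c = x. Proof. by rewrite nth_cat ltnn subnn. Qed.
Let sC : sorted (@edge G) C. Proof. exact: cycle_sorted. Qed.
Let close : edge c_(c.-1) c_(0) * edge c_(0) c_(c.-1).
Proof. by have := cycle_close x longC c0 => e; split; rewrite // edge_sym. Qed.

Ltac walks ps es :=
  have : sumn [seq (hi p - lo p).+1 | p <- ps] <= c by
    [apply: (reroute3 (P := [:: x]) (R := [::]) (x0 := x) longC uL sC isT isT);
     [nums | nums
     | rewrite /= /from /upto /hi /lo /= ?nthx ?nthC ?es //; nlia]];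
  rewrite /= /hi /lo /=; nlia.

(** The next three lemmas reroute through a single, which is adjacent to all
    neighbours of [x], when the first vertex [c_(a.+1)] of a segment is adjacent to
    the last vertex [c_(q)] of another one. *)
Lemma no_single_between a q k : edge x c_(a) -> q.+1 < c -> edge x c_(q.+1) ->
  edge c_(a.+1) c_(q) -> a.+1 < k -> k < q -> sgl k -> False.
Proof.
move=> xa qc xq aq ak kq sk; have kc : k < c by nlia.
move: (sk); rewrite single_at // => /and3P[k0 xk _].
have ka : edge c_(a) c_(k) by rewrite edge_sym single_edge //; nlia.
have qa : edge c_(q) c_(a.+1) by rewrite edge_sym.
have kx : edge c_(k.-1) x by rewrite edge_sym.
walks [:: up q.+1 c.-1; up 0 a; up k q; up a.+1 k.-1; up c c] (close, ka, qa, kx, xq).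
Qed.

Hypothesis single_end : sgl c.-1.

Lemma no_backward_edge a q : edge x c_(a) -> edge x c_(q.+1) -> q < a -> a.+1 < c.-1 ->
  edge c_(a.+1) c_(q) -> False.
Proof.
move=> xa xq qa ac aq; have qa' : edge c_(q) c_(a.+1) by rewrite edge_sym.
have ec : c.-1 < c by nlia.
have la : edge c_(a) c_(c.-1) by rewrite edge_sym single_edge //; nlia.
have lx : edge c_(c.-2) x.
  by move: single_end; rewrite single_at // => /and3P[_ h _]; rewrite edge_sym.
walks [:: up q.+1 a; up c.-1 c.-1; up 0 q; up a.+1 c.-2; up c c] (close, la, qa', lx, xq).
Qed.

Lemma no_free_neighbor a p q b w : a < p -> p < q -> q.+1 < c ->
    edge x c_(a) -> edge x c_(p.+1) -> edge x c_(q.+1) -> edge c_(a.+1) c_(q) ->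
    b < c -> edge x c_(b) -> edge c_(p) c_(b) -> ~~ (a < b <= q) ->
    w < c -> sgl w -> ~~ (a < w <= q) ->
    [\/ w.+1 = b, w = b.+1 | b = 0 /\ w = c.-1] -> False.
Proof.
move=> ap pq qc xa xp xq aq bc xb pb bN wc sw wN cases.
have qa : edge c_(q) c_(a.+1) by rewrite edge_sym.
have ax : edge c_(a) x by rewrite edge_sym.
have qx : edge c_(q.+1) x by rewrite edge_sym.
have wp : edge c_(w) c_(p.+1) by rewrite single_edge //; nlia.
have [ba|qb] : b <= a \/ q < b by nlia.
  case: cases => [wb|wb|[b0 wc1]].
  - have {}wp : edge c_(b.-1) c_(p.+1) by rewrite -wb.
    walks [:: up q.+1 c.-1; up 0 b.-1; up p.+1 q; up a.+1 p; up b a; up c c]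
      (close, wp, qa, pb, ax, xq).
  - rewrite wb in wp.
    walks [:: up p.+1 q; up a.+1 p; dn b 0; dn c.-1 q.+1; up c c; dn a b.+1]
      (close, wp, qa, pb, xa, qx).
  - rewrite wc1 in wp; rewrite b0 in pb.
    walks [:: up q.+1 c.-1; up p.+1 q; up a.+1 p; up 0 a; up c c] (close, wp, qa, pb, ax, xq).
case: cases => [wb|wb|[b0 wc1]]; last by nlia.
- have {}wp : edge c_(b.-1) c_(p.+1) by rewrite -wb.
  walks [:: up q.+1 b.-1; up p.+1 q; up a.+1 p; up b c.-1; up 0 a; up c c]
    (close, wp, qa, pb, ax, xq).
- rewrite wb in wp.
  walks [:: up p.+1 q; up a.+1 p; dn b q.+1; up c c; dn a 0; dn c.-1 b.+1]
    (close, wp, qa, pb, xa, qx).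
Qed.

(** Start the cycle after a single and take the edge of [exists_first_last] with the
    least [a]; let [c_(p)] be the last vertex of the segment of [c_(a.+1)]. Which
    neighbours can [c_(p)] have? By [no_free_neighbor], those in [S] have no single
    next to them and lie between two long segments, hence there are fewer of them
    than long segments. By the choice of [a] the others are [c_(a.+1)], the inner
    vertex, or outside the cycle. In total these are fewer than five. *)
Lemma large_contra : 4 < d -> False.
Proof.
move=> d5; have ce := count_ext; have ci := count_inner; have ltcG := card_cycle_lt.
have cc : c.-1 < c by rewrite ltn_predL.
pose P a := [exists q : 'I_c, first_last a q].
have exP : exists a, P a.
  have [a [q fl]] := exists_first_last; exists a; case/and5P: (fl) => _ _ /andP[/and4P[_ qc _ _] _] _ _.
  by apply/existsP; exists (Ordinal qc).
case: (ex_minnP exP) => a /existsP[[q qc] /= fl] amin.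
have minfl a' q' : first_last a' q' -> a <= a'.
  move=> fl'; apply: amin; apply/existsP.
  have qc' : q' < c by case/and5P: (fl') => _ _ /andP[/and4P[]].
  by exists (Ordinal qc').
case/and5P: (fl) => xa ea lq aq sne; case/andP: (lq) => eq bq.
have nbr_after j : last_extra j -> j.+1 < c /\ edge x c_(j.+1).
  case/andP=> ej bj; have jc : j < c by case/and4P: ej.
  have jne : j != c.-1 by apply: contraL single_end => /eqP <-; apply: extra_single.
  have jc' : j.+1 < c by move: jc jne; clear; nlia.
  split=> //; move: bj; rewrite /before inE => /orP[/eqP e|//].
  by rewrite e ltnn in jc'.
have [qc1 xq] := nbr_after q lq.
have first_lt b : ext b.+2 -> b.+1 < c.-1.
  move=> eb; have := extra_single eb; case/and4P: eb => _ bc _ _.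
  have [->|ne _] := eqVneq b.+2 c.-1; first by rewrite single_end.
  by move: bc ne; clear; nlia.
have fl_lt a' q' : first_last a' q' -> a' < q'.
  case/and5P=> xa' ea' lq' aq' sne'; have [_ xq'] := nbr_after q' lq'.
  rewrite ltnNge; apply/negP; rewrite leq_eqVlt => /orP[/eqP e|lt].
    by case/andP: lq' => /and4P[_ _ _]; rewrite e inE xa'.
  exact: no_backward_edge xa' xq' lt (first_lt _ ea') aq'.
have aq_lt := fl_lt _ _ fl.
have a1c : a.+1 < c by apply: ltn_trans (first_lt _ ea) cc.
have a1S : c_(a.+1) \notin S by case/and4P: ea.
have na1 : ~~ sgl a.+1.
  rewrite single_at //; apply/negP => /and3P[_ _ b]; by have := before_not_extra a1c b; rewrite ea.
have [p [ap lp sp]] := last_after a1c a1S na1.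
case/andP: (lp) => ep bp; have /and4P[_ pc _ pS] := ep.
have [pc1 xp] := nbr_after p lp.
have pq : p < q.
  rewrite ltnNge; apply/negP => qp; case/negP: sne; rewrite eqn_leq leq_seg //=.
  by rewrite -sp leq_seg.
have nosgl k : a < k <= q -> ~~ sgl k.
  move=> /andP[ak kq]; have [->//|ka] := eqVneq k a.+1.
  have [->|kq'] := eqVneq k q; first exact: extra_single.
  apply/negP => sk; apply: (no_single_between xa qc1 xq aq _ _ sk).
    by move: ak ka; clear; nlia.
  by move: kq kq'; clear; nlia.
have [qm qmP qmax] : exists2 qm, last_extra qm & forall j, last_extra j -> j <= qm.
  have exl : exists j, last_extra j by exists q.
  have bnd j : last_extra j -> j <= c by case/andP=> /and4P[_ /ltnW].
  by case: (ex_maxnP exl bnd) => qm h1 h2; exists qm.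
(* The neighbours of [x] after a long segment, except the last such segment. *)
pose isolated k := [&& 0 < k, last_extra k.-1 & k.-1 != qm].
have cisolated : count isolated (iota 0 c) < count last_extra (iota 0 c).
  have qmc : qm < c by case/andP: qmP => /and4P[].
  have e0 : iota 0 c = 0 :: iota 1 c.-1 by rewrite -[in LHS](prednK c0).
  have e1 : iota 0 c = iota 0 c.-1 ++ iota c.-1 1.
    by rewrite -[in LHS](prednK c0) -addn1 iotaD.
  have : count isolated (iota 0 c) <= count (predI (predC1 qm) last_extra) (iota 0 c).
    rewrite {1}e0 /= add0n (iotaDl 1 0) count_map e1 count_cat.
    apply: leq_trans (leq_addr _ _); apply: sub_count => k /=.
    by rewrite /isolated /= andbC.
  move/leq_ltn_trans; apply.
  rewrite -[X in _ < X]size_filter -(count_predC (predC1 qm)) !count_filter.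
  rewrite -[X in X < _]addn0 ltn_add2l -has_count; apply/hasP; exists qm; rewrite ?mem_iota //=.
  by rewrite negbK eqxx qmP.
have nbrS k : k < c -> edge x c_(k) -> edge c_(p) c_(k) -> isolated k.
  move=> kc xk pk.
  have nw w : w < c -> [\/ w.+1 = k, w = k.+1 | k = 0 /\ w = c.-1] -> ~~ sgl w.
    move=> wc cases; apply/negP => sw.
    have wN : ~~ (a < w <= q) by apply/negP => /nosgl; rewrite sw.
    have kN : ~~ (a < k <= q).
      apply/negP => kin; case/negP: wN; case: cases => [wk|wk|[k0 wc1]].
      - have : w != a by apply: contraTneq xa => <-; apply: single_not_attached sw.
        by move: kin; rewrite -wk; clear; nlia.
      - have : w != q.+1 by apply: contraTneq xq => <-; apply: single_not_attached sw.
        by move: kin; rewrite wk; clear; nlia.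
      - by move: kin; rewrite k0; clear; nlia.
    exact: (no_free_neighbor ap pq qc1 xa xp xq aq kc xk pk kN wc sw wN cases).
  have k0 : 0 < k.
    rewrite lt0n; apply/negP => /eqP k0; have := nw c.-1 cc (Or33 _ _ (conj k0 erefl)).
    by rewrite single_end.
  have kp : k.-1 < c by apply: leq_ltn_trans (leq_pred _) kc.
  have kS : c_(k) \in S by rewrite inE.
  have kpS : c_(k.-1) \notin S by apply: contraL kS => h; rewrite -(prednK k0) S_succ // prednK.
  have nkp : ~~ sgl k.-1 by apply: nw => //; constructor 1; rewrite prednK.
  have bkp : bef k.-1 by rewrite /before prednK // kS orbT.
  have ekp : ext k.-1.
    case: (not_single kp kpS nkp) => //; rewrite prednK //.
    by case/and4P=> _ _ _; rewrite kS.
  have k1c : k.+1 < c.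
    have : k != c.-1 by apply: contraTneq xk => ->; apply: nbr_end.
    by move: kc; clear; nlia.
  rewrite /isolated k0 /last_extra ekp bkp /=; apply: contraNneq (nw k.+1 k1c (Or32 _ _ erefl)) => ek.
  apply: contraT => nk1; have [j [kj lj _]] := last_after k1c (S_succ k1c kS) nk1.
  by have := qmax j lj; rewrite -ek; move: kj k0; clear; nlia.
have nbr k : k < c -> edge c_(p) c_(k) -> [|| isolated k, k == a.+1 | inner k].
  move=> kc pk; have [kS|kS] := boolP (c_(k) \in S).
    by rewrite nbrS //; move: kS; rewrite inE.
  have lk : linked C c_(k) c_(p) by rewrite /linked edge_sym pk.
  have nk := linked_not_single pc pS lk.
  have kp : k != p by apply: contraTneq pk => ->; rewrite edge_irrefl.
  have [ek|nek] := boolP (ext k).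
    have [ik|nik] := boolP (inner k); first by rewrite !orbT.
    have := pred_free kc pc kp (not_inner_before ek nik) bp; by rewrite lk.
  have [b kb xb] := first_S kc kS nek; subst k.
  have eb : ext b.+2 by case: (not_single kc kS nk) => // h; rewrite h in nek.
  have bS : c_(b) \in S by rewrite inE.
  have aS : c_(a) \in S by rewrite inE.
  have [es|ns] := eqVneq (seg C S b.+1) (seg C S p).
    have [lt|gt|->] := ltngtP b a; last by rewrite eqxx orbT.
      suff : seg C S b.+1 < seg C S a.+1 by rewrite es sp ltnn.
      apply: (@ltn_seg _ C x S b.+1 a a.+1) => //.
      rewrite ltn_neqAle lt andbT; apply: contraNneq kS => ->.
      by [].
    suff : seg C S a.+1 < seg C S b.+1 by rewrite es sp ltnn.
    apply: (@ltn_seg _ C x S a.+1 b b.+1) => //.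
    rewrite ltn_neqAle gt andbT; apply: contraNneq a1S => ->.
    by [].
  have fb : first_last b p by rewrite /first_last xb eb lp edge_sym pk ns.
  have ab := minfl _ _ fb; have bp' := fl_lt _ _ fb.
  have [eab|neab] := eqVneq a b; first by rewrite -eab eqxx orbT.
  have ab1 : a.+1 < b.
    rewrite ltn_neqAle; apply/andP; split; last by rewrite ltn_neqAle neab.
    by apply: contraNneq a1S => ->.
  suff : seg C S a.+1 < seg C S p by rewrite sp ltnn.
  by apply: (@ltn_seg _ C x S a.+1 b p) => //; apply: ltnW.
have cnbr : count (edge c_(p)) C <= count isolated (iota 0 c) + (1 + count inner (iota 0 c)).
  have -> : count (edge c_(p)) C = count (fun k => edge c_(p) c_(k)) (iota 0 c).
    by rewrite -[X in count _ X](mkseq_nth x C) count_map.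
  have <- : count (pred1 a.+1) (iota 0 c) = 1.
    by rewrite count_uniq_mem ?iota_uniq // mem_iota a1c.
  rewrite -!sum1_count ![\sum_(_ <- _ | _) _]big_mkcond /= -!big_split /= big_seq [X in _ <= X]big_seq.
  apply: leq_sum => k; rewrite mem_iota => /andP[_ kc].
  case e: (edge c_(p) c_(k)) => //; have := nbr k kc e.
  by case: (isolated k); case: (k == a.+1); case: (inner k).
have uS := pS; move: uS; rewrite inE => xpN.
have := deg c_(p); rewrite /degree -(cardsID [set y in C]).
have -> : [set y | edge c_(p) y] :&: [set y in C] = [set y in C | edge c_(p) y].
  by apply/setP => y; rewrite !inE andbC.
rewrite card_cycle //.
have : #|[set y | edge c_(p) y] :\: [set y in C]| + 1 + c <= #|G|.
  have -> : c = #|[set y in C]| by rewrite cardsE; apply/esym/card_uniqP.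
  rewrite -(cardsC [set y in C]) [X in _ <= X]addnC leq_add2r.
  have xo : x \in ~: [set y in C] by rewrite !inE.
  rewrite (cardsD1 x (~: _)) xo addnC leq_add2l; apply/subset_leq_card/subsetP => y.
  rewrite !inE => /andP[yC py]; rewrite yC andbT.
  by apply: contraNneq xpN => exy; rewrite exy in py; rewrite edge_sym.
move: cnbr cisolated ce ci order d5; clear.
by move: (#|_ :\: _|) (count (edge _) _) => n1 n2; nlia.
Qed.

End Based.
End Tight.

(** * Minimum degree three and four *)

(** The ten 2-subsets of [{0, .., 4}], in the order in which the vertices appear in
    the surviving branch of the search. *)
Definition pairs := [:: (0, 1); (2, 3); (0, 4); (1, 2); (0, 3); (1, 4); (0, 2); (1, 3); (2, 4); (3, 4)].
Definition kneser u v :=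
  let p := nth (0, 0) pairs u in let q := nth (0, 0) pairs v in
  [&& p.1 != q.1, p.1 != q.2, p.2 != q.1 & p.2 != q.2].

Definition kneser_leaf (P : seq (seq nat)) (U : seq (nat * nat)) :=
  (U == [::]) && all (fun u => all (fun v => (v \in nbrs P u) == kneser u v) (iota 0 10)) (iota 0 10).

Definition one_row (s : seq nat) (c : nat) := [:: (c, s)].
Definition two_rows (s : seq nat) (c : nat) := [:: (c, s); (c.-1, s)].

Lemma petersen_solved : solve 10 3 9 (one_row [:: 0; 3; 6] 9) [:: 0; 3; 6] kneser_leaf.
Proof. by vm_cast_no_check (erefl true). Qed.

Lemma cubic_solved : solve 11 3 9 (one_row [:: 0; 3; 6] 9) [:: 0; 3; 6] no_leaf &&
  all (fun s => solve 11 3 10 (one_row s 10) s no_leaf) [:: [:: 0; 4; 7]; [:: 0; 3; 7]; [:: 0; 3; 6]].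
Proof. by vm_cast_no_check (erefl true). Qed.

Lemma quartic_solved : solve 13 4 12 (one_row [:: 0; 3; 6; 9] 12) [:: 0; 3; 6; 9] no_leaf.
Proof. by vm_cast_no_check (erefl true). Qed.

Lemma single_solved :
  all (fun n => solve n 4 11 (two_rows [:: 0; 3; 6; 9] 11) [:: 0; 3; 6; 9] no_leaf) [:: 12; 13] &&
  all (fun s => solve 13 4 12 (two_rows s 12) s no_leaf)
    [:: [:: 0; 4; 7; 10]; [:: 0; 3; 7; 10]; [:: 0; 3; 6; 10]].
Proof. by vm_cast_no_check (erefl true). Qed.

Section Small.
Variables (G : sgraph) (d : nat).
Hypotheses (tough : tough_over1 G) (deg : forall x : G, d <= degree x).
Hypotheses (order : #|G| <= d.*2 + 5) (d3 : 2 < d).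
Hypothesis dom : forall C (y z : G), longest C -> y \notin C -> z \notin C -> ~~ edge y z.
Variables (C : seq G) (x : G).
Hypotheses (longC : longest C) (xC : x \notin C).
Local Notation c := (size C).
Local Notation "c_( k )" := (nth x C k).
Hypothesis x0 : edge x c_(0).
Let uC : uniq C. Proof. by case: longC. Qed.
Let C0 : 0 < c. Proof. by rewrite lt0n; apply: contraTneq x0 => /size0nil->; rewrite /= edge_irrefl. Qed.

Definition vertices : seq G := C ++ x :: [seq v <- enum G | (v \notin C) && (v != x)].
Local Notation n := (size vertices).
Local Notation "l_( k )" := (nth x vertices k).
(** The neighbours of [x] as indices, the form in which the search takes them. *)
Definition places := [seq k <- iota 0 c | edge x c_(k)].

Lemma mem_vertices v : v \in vertices.
Proof.
rewrite /vertices mem_cat inE mem_filter mem_enum andbT.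
by case: (v \in C); case: (v == x).
Qed.

Lemma uniq_vertices : uniq vertices.
Proof.
rewrite /vertices cat_uniq uC /= (negbTE xC) /= mem_filter eqxx andbF /= filter_uniq ?enum_uniq //.
by rewrite andbT; apply/hasPn => v; rewrite mem_filter => /andP[/andP[]].
Qed.

Lemma card_vertices : n = #|G|.
Proof.
rewrite -(card_uniqP uniq_vertices); apply: eq_card => v; exact: mem_vertices.
Qed.

Lemma mem_places k : k \in places = (k < c) && edge x c_(k).
Proof. by rewrite mem_filter mem_iota add0n andbC. Qed.

Lemma size_places : size places = d.
Proof.
have xS v : edge x v -> v \in C by apply: nbr_cycle.
rewrite -(tight_card tough deg order d3 dom longC xC x0).
have -> : #|[set v | edge x v]| = #|[set v in C | edge x v]|.
  by apply: eq_card => v; rewrite !inE; case xv: (edge x v); rewrite ?andbF // (xS v xv).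
by rewrite card_cycle // -[in RHS](mkseq_nth x C) count_map size_filter.
Qed.

Lemma hub_row j : j < n -> edge x l_(j) = (j \in places).
Proof.
move=> jn; rewrite mem_places nth_cat; case: ltnP => //= cj; apply/negbTE.
apply: (dom longC) => //; set s := _ :: _.
have : nth x s (j - c) \in s by rewrite mem_nth // -(ltn_add2l c) subnKC // -size_cat.
rewrite inE mem_filter => /predU1P[->//|]; by case/andP=> /andP[].
Qed.

Lemma x_vertex : l_(c) = x. Proof. by rewrite nth_cat ltnn subnn. Qed.

Lemma solve_one s leaf : places = s -> solve #|G| d c (one_row s c) s leaf ->
  exists P U, leaf P U /\ sound x vertices P U.
Proof.
move=> <-; rewrite -card_vertices; apply: solve_sound => //; first exact: uniq_vertices.
  exact: mem_vertices.
move=> r; rewrite inE => /eqP-> j jn /=; rewrite x_vertex; exact: hub_row.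
Qed.

Lemma solve_two s leaf : single C x c_(c.-1) -> places = s -> solve #|G| d c (two_rows s c) s leaf ->
  exists P U, leaf P U /\ sound x vertices P U.
Proof.
move=> sx <-; rewrite -card_vertices.
apply: solve_sound => //; first exact: uniq_vertices.
  exact: mem_vertices.
move=> r; rewrite !inE => /orP[]/eqP-> j jn /=; first by rewrite x_vertex; exact: hub_row.
rewrite nth_cat prednK // leqnn (single_complete tough deg order d3 dom longC xC x0 sx); exact: hub_row.
Qed.

Local Notation lasts := (last_extra C x).

Lemma last_place k : lasts k ->
  [/\ 0 < k, k < c, k \notin places, k.-1 \notin places & k.+1 \in rcons places c].
Proof.
case/andP=> /and4P[k0 kc]; rewrite !inE => n1 n2 b; split=> //.
- by rewrite mem_places kc.
- by rewrite mem_places (leq_ltn_trans (leq_pred k) kc).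
- rewrite mem_rcons inE; case/orP: b => [->//|]; rewrite inE => e.
  rewrite mem_places e andbT -leq_eqVlt.
  by rewrite kc.
Qed.

(** A long segment is followed by a neighbour of [x] or by the end of the list, so
    that three of the gaps have length at least 3. *)
Lemma count_lasts : 2 < count lasts (map predn (rcons places c)).
Proof.
apply: leq_trans (three_lasts tough deg order d3 dom longC xC x0) _.
rewrite -size_filter -(size_filter _ (map _ _)); apply: uniq_leq_size.
  by rewrite filter_uniq ?iota_uniq.
move=> k; rewrite !mem_filter => /andP[lk _]; rewrite lk /=.
by apply/mapP; exists k.+1 => //; case: (last_place lk).
Qed.

Lemma places_sorted : sorted ltn places.
Proof. by apply: sorted_filter (iota_ltn_sorted 0 c) => a b e; apply: ltn_trans. Qed.

Lemma places_lt : all (fun k => k < c) places.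
Proof. by apply/allP => k; rewrite mem_places => /andP[]. Qed.

Lemma places0 : 0 \in places.
Proof. by rewrite mem_places C0. Qed.

Lemma bounds : [/\ 2 * d + 3 <= c, c < #|G| & #|G| <= 2 * d + 5].
Proof.
split; first exact: (tight_cycle tough deg order d3 dom longC xC x0).
  exact: card_cycle_lt longC xC.
by rewrite mul2n.
Qed.

Lemma gap_last j k : j \in places -> j < k -> lasts k.-1 -> j + 3 <= k.
Proof.
move=> js jk /last_place[k0 _ n1 n2 _].
have : j != k.-1 by apply: contraNneq n1 => <-.
have : j != k.-2 by apply: contraNneq n2 => <-.
by nlia.
Qed.

Lemma no_last0 : lasts 0.-1 = false.
Proof. by apply/negP => /last_place[]. Qed.

(** All gaps are long, and the cycle has length 9 or 10. With ten vertices in all the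
    search survives in one graph; the other cases are contradictory. *)
Lemma cubic : d = 3 -> #|G| = 10 /\ exists P U, kneser_leaf P U /\ sound x vertices P U.
Proof.
move=> d_3; have := size_places; rewrite d_3.
have [c9 cn n11] := bounds; rewrite d_3 in c9 n11.
have := (places_sorted, places_lt, places0, count_lasts).
case eP: places => [|a [|p [|q []]]] //= [[[so lt] m0] cl] _.
have a0 : a = 0 by move: m0 so; rewrite !inE; nlia.
subst a; rewrite no_last0 in cl.
have [/andP[lp lq] lc] : (lasts p.-1 && lasts q.-1) /\ lasts c.-1.
  by move: cl; do 3 case: (lasts _).
have gap j k : j \in places -> j < k -> lasts k.-1 -> j + 3 <= k := @gap_last j k.
rewrite eP in gap.
have p3 : 0 + 3 <= p by apply: gap; rewrite ?mem_head //; nlia.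
have q3 : p + 3 <= q by apply: gap; rewrite ?inE ?eqxx ?orbT //; nlia.
have c3 : q + 3 <= c by apply: gap; rewrite ?inE ?eqxx ?orbT //; nlia.
have [c_9|c_10] : c = 9 \/ c = 10 by nlia.
  have [p_3 q_6] : p = 3 /\ q = 6 by nlia.
  have [n10|n_11] : #|G| = 10 \/ #|G| = 11 by nlia.
    split=> //; apply: (solve_one eP); rewrite n10 c_9 p_3 q_6 d_3; exact: petersen_solved.
  have [] : exists P U, no_leaf P U /\ sound x vertices P U; last by move=> ? [? []].
  apply: (solve_one eP); rewrite n_11 c_9 p_3 q_6 d_3.
  by case/andP: cubic_solved.
have [] : exists P U, no_leaf P U /\ sound x vertices P U; last by move=> ? [? []].
apply: (solve_one eP); have -> : #|G| = 11 by nlia.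
rewrite c_10 d_3; case/andP: cubic_solved => _ /allP; apply.
have : [|| (p == 4) && (q == 7), (p == 3) && (q == 7) | (p == 3) && (q == 6)] by nlia.
by case/or3P=> /andP[/eqP-> /eqP->].
Qed.

(** The single at the end accounts for one gap of length 2; the others are long. *)
Lemma quartic_single : d = 4 -> single C x c_(c.-1) -> False.
Proof.
move=> d_4 sx; have := size_places; rewrite d_4.
have [c11 cn n13] := bounds; rewrite d_4 in c11 n13.
have := (places_sorted, places_lt, places0, count_lasts).
case eP: places => [|a [|p [|q [|r []]]]] //= [[[so lt] m0] cl] _.
have a0 : a = 0 by move: m0 so; rewrite !inE; nlia.
subst a; rewrite no_last0 in cl.
have r2 : r.+2 = c.
  have : c.-2 \in places.
    have := sx; rewrite (single_at dom longC xC x0); last by nlia.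
    by case/and3P=> _ e _; rewrite mem_places; apply/andP; split=> //; nlia.
  have : c.-1 \notin places.
    by rewrite mem_places negb_and (nbr_end dom longC xC x0) orbT.
  by rewrite eP !inE; nlia.
have nlc : lasts c.-1 = false.
  by apply/negP => /last_place[_ _ _]; rewrite eP -r2 !inE eqxx !orbT.
rewrite nlc in cl.
have [/andP[lp lq] lr] : (lasts p.-1 && lasts q.-1) /\ lasts r.-1.
  by move: cl; do 3 case: (lasts _).
have gap j k : j \in places -> j < k -> lasts k.-1 -> j + 3 <= k := @gap_last j k.
rewrite eP in gap.
have p3 : 0 + 3 <= p by apply: gap; rewrite ?mem_head //; nlia.
have q3 : p + 3 <= q by apply: gap; rewrite ?inE ?eqxx ?orbT //; nlia.
have r3 : q + 3 <= r by apply: gap; rewrite ?inE ?eqxx ?orbT //; nlia.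
have [] : exists P U, no_leaf P U /\ sound x vertices P U; last by move=> ? [? []].
apply: (solve_two sx eP); rewrite d_4; have /andP[/allP s11 /allP s12] := single_solved.
have [c_11|c_12] : c = 11 \/ c = 12 by nlia.
  have [p_3 [q_6 r_9]] : p = 3 /\ q = 6 /\ r = 9 by nlia.
  rewrite c_11 p_3 q_6 r_9; apply: s11.
  have /orP[/eqP->|/eqP->] // : (#|G| == 12) || (#|G| == 13) by nlia.
have -> : #|G| = 13 by nlia.
rewrite c_12; apply: s12.
have : [|| [&& p == 4, q == 7 & r == 10], [&& p == 3, q == 7 & r == 10] |
  [&& p == 3, q == 6 & r == 10]] by nlia.
by case/or3P=> /and3P[/eqP-> /eqP-> /eqP->].
Qed.

(** A gap of length 2 would enclose a single; four longer gaps have length 3, as the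
    cycle has at most 12 vertices. *)
Lemma quartic_no_single : d = 4 -> (forall k, k < c -> ~~ single C x c_(k)) -> False.
Proof.
move=> d_4 ns; have := size_places; rewrite d_4.
have [c11 cn n13] := bounds; rewrite d_4 in c11 n13.
have := (places_sorted, places_lt, places0).
case eP: places => [|a [|p [|q [|r []]]]] //= [[so lt] m0] _.
have a0 : a = 0 by move: m0 so; rewrite !inE; nlia.
subst a.
have gap j k : j \in places -> k \in rcons places c -> j < k -> j + 3 <= k.
  rewrite mem_rcons inE !mem_places => /andP[jc xj] kP jk.
  have jk1 : j.+1 != k.
    case/predU1P: kP => [kc|/andP[kc xk]].
      by apply: contraTneq xj => e; move: (nbr_end dom longC xC x0); rewrite -kc -e.
    by apply: contraTneq xk => e; rewrite -e (nbr_succ longC xC) // e.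
  have j1c : j.+1 < c by case/predU1P: kP => [<-|/andP[]]; nlia.
  have jk2 : j.+2 != k.
    apply: contraNneq (ns _ j1c) => e; rewrite (single_at dom longC xC x0) // /= xj /before.
    by rewrite e; case/predU1P: kP => [->|/andP[_ xk]]; rewrite ?eqxx // inE xk orbT.
  by nlia.
rewrite eP in gap.
have p3 : 0 + 3 <= p by apply: gap; rewrite ?mem_rcons ?inE ?eqxx ?orbT //; nlia.
have q3 : p + 3 <= q by apply: gap; rewrite ?mem_rcons ?inE ?eqxx ?orbT //; nlia.
have r3 : q + 3 <= r by apply: gap; rewrite ?mem_rcons ?inE ?eqxx ?orbT //; nlia.
have c3 : r + 3 <= c by apply: gap; rewrite ?mem_rcons ?inE ?eqxx ?orbT //; nlia.
have [] : exists P U, no_leaf P U /\ sound x vertices P U; last by move=> ? [? []].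
apply: (solve_one eP); rewrite d_4.
have [n_13 [c_12 [p_3 [q_6 r_9]]]] : #|G| = 13 /\ c = 12 /\ p = 3 /\ q = 6 /\ r = 9 by nlia.
by rewrite n_13 c_12 p_3 q_6 r_9; exact: quartic_solved.
Qed.

End Small.

(** * From a longest cycle to the Petersen graph *)

Definition petersen_list (G : sgraph) (x : G) (L : seq G) := [/\ uniq L, size L = 10, forall v, v \in L &
  forall i j, i < 10 -> j < 10 -> edge (nth x L i) (nth x L j) = kneser i j].

Section Finish.
Variables (G : sgraph) (d : nat).
Hypotheses (tough : tough_over1 G) (deg : forall x : G, d <= degree x).
Hypotheses (order : #|G| <= d.*2 + 5) (d3 : 2 < d).

Lemma dominating (C : seq G) y z : longest C -> y \notin C -> z \notin C -> ~~ edge y z.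
Proof.
exact: no_outside_edge tough deg order _ _ _.
Qed.

Lemma rotate_head (C : seq G) x y : longest C -> x \notin C -> edge x y ->
  exists C', [/\ longest C', x \notin C' & edge x (nth x C' 0)].
Proof.
move=> lC xC xy; have yC : y \in C by apply: contraLR xy => yC; apply: dominating lC xC yC.
have [i [s e]] := rot_head yC; exists (rot i C); split; rewrite ?mem_rot //.
  exact: longest_rot.
by rewrite e.
Qed.

Lemma rotate_single (C : seq G) x w : longest C -> x \notin C -> single C x w ->
  exists C', [/\ longest C', x \notin C', edge x (nth x C' 0) & single C' x (nth x C' (size C').-1)].
Proof.
move=> lC xC sw; have /and3P[wC xp xn] := sw.
have uC : uniq C by case: lC.
have [i [s e]] := rot_end wC; exists (rot i C).
have sw' : single (rot i C) x w by rewrite /single mem_rot wC prev_rot // next_rot // xp.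
have lst : nth x (rot i C) (size (rot i C)).-1 = w by rewrite nth_last e last_rcons.
split; rewrite ?mem_rot ?lst //; first exact: longest_rot.
rewrite -next_last ?rot_uniq ?lst ?next_rot // e; by rewrite size_rcons.
Qed.

(** The case distinction by the minimum degree: up to four the gaps are few enough to
    be searched, above that the rerouting through singles applies. *)
Lemma petersen_of_longest (C : seq G) x : longest C -> x \notin C -> exists L, petersen_list x L.
Proof.
move=> lC xC; have [y xy] : exists y, edge x y.
  have /card_gt0P[y] : 0 < #|[set y | edge x y]| by apply: leq_trans (deg x); nlia.
  by rewrite inE; exists y.
have [C' [{}lC xC' x0]] := rotate_head lC xC xy; move: C' lC xC' x0 => {C y xC xy} C lC xC x0.
have [d_3|[d_4|d5]] : d = 3 \/ d = 4 \/ 4 < d by nlia.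
- have [n10 [P [U [/andP[/eqP U0 /allP PE] [sP _ cP]]]]] := cubic tough deg order d3 dominating lC xC x0 d_3.
  have sL := card_vertices lC xC; have uL := uniq_vertices lC xC.
  exists (vertices C x); split=> //; [by rewrite sL|exact: mem_vertices|].
  move=> i j i10 j10; have := PE i; rewrite mem_iota => /(_ i10)/allP/(_ j).
  rewrite mem_iota => /(_ j10)/eqP <-; apply/idP/idP => [ij|/sP[]//].
  by have := cP i j; rewrite sL n10 U0 !orbF => /(_ i10 j10 ij).
- have [/existsP[k sk]|no] := boolP [exists k : 'I_(size C), single C x (nth x C k)].
    have [C' [lC' xC' x0' sx]] := rotate_single lC xC sk.
    by case: (quartic_single tough deg order d3 dominating lC' xC' x0' d_4 sx).
  case: (quartic_no_single tough deg order d3 dominating lC xC x0 d_4) => k kc.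
  by apply: contra no => sk; apply/existsP; exists (Ordinal kc).
have [k kc sk] := exists_single_large tough deg order d3 dominating lC xC x0 d5.
have [C' [lC' xC' x0' sx]] := rotate_single lC xC sk.
by case: (large_contra tough deg order d3 dominating lC' xC' x0' sx d5).
Qed.

End Finish.

Lemma exists_longest (G : sgraph) : exists C : seq G, longest C.
Proof.
pose P k := [exists s : k.-tuple G, uniq s && cycle (@edge G) s].
have P0 : exists k, P k by exists 0; apply/existsP; exists [tuple].
have Pn k : P k -> k <= #|G|.
  by case/existsP=> s /andP[us _]; rewrite -(size_tuple s) -(card_uniqP us) max_card.
case: (ex_maxnP P0 Pn) => m /existsP[s /andP[us cs]] max.
exists s; split=> // t ut ct; rewrite size_tuple; apply: max.
by apply/existsP; exists (in_tuple t); rewrite ut.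
Qed.

Lemma complete_cycle (G : sgraph) : is_complete G -> 0 < #|G| -> hamiltonian G.
Proof.
move=> /forallP cG n0; have cE (u v : G) : u != v -> edge u v.
  by move=> uv; have /forallP/(_ v)/implyP := cG u; apply.
exists (enum G); split; last by rewrite -cardE.
rewrite /is_cycle -cardE n0 enum_uniq /=.
have := enum_uniq G; rewrite cardE; case: (enum G) => //= u [|v s] // us.
have us' : uniq [:: u, v & s] by [].
rewrite eqSS /= -[_ && _]/(path (@edge G) u (rcons (v :: s) u)) rcons_path.
have -> : path (@edge G) u (v :: s).
  move: us'; rewrite uniq_pairwise => /(pairwise_sorted); apply: sub_sorted => a b; exact: cE.
apply: cE; apply: contraTneq us => /= e; by rewrite -e mem_last.
Qed.

(** The neighbours of a vertex that is not adjacent to all others form a cut. *)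
Lemma degree_gt2 (G : sgraph) : tough_over1 G -> ~~ is_complete G -> forall x : G, 2 < degree x.
Proof.
move=> tough ncG.
have nonadj (u v : G) : u != v -> ~~ edge u v -> 2 < degree u.
  move=> uv nuv; apply: (@tough_cut G tough [set w | edge u w] [set u] u v);
    rewrite ?inE ?edge_irrefl ?eqxx //; first by rewrite eq_sym.
  by move=> y z; rewrite !inE => /eqP-> _ /negbTE->.
move: ncG; rewrite negb_forall => /existsP[a]; rewrite negb_forall => /existsP[b].
rewrite negb_imply => /andP[ab nab] x.
have [y /andP[xy nxy]|adj] := pickP (fun y => (x != y) && ~~ edge x y); first exact: nonadj xy nxy.
apply: leq_trans (nonadj a b ab nab) _.
have -> : degree x = #|[set~ x]|.
  by apply: eq_card => v; rewrite !inE; have := adj v; rewrite eq_sym; case: eqP => [->|_]; rewrite ?edge_irrefl // => /negbFE.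
rewrite cardsC1 -(cardsC1 a); apply/subset_leq_card/subsetP => v; rewrite !inE.
by apply: contraTneq => ->; rewrite edge_irrefl.
Qed.

Lemma min_degree_le (G : sgraph) (x : G) : min_degree G <= degree x.
Proof.
rewrite /min_degree; have := mem_index_enum x.
elim: (index_enum G) => //= y s IH; rewrite inE big_cons => /predU1P[->|/IH]; first exact: geq_minl.
by apply: leq_trans; apply: geq_minr.
Qed.

Lemma min_degree_gt2 (G : sgraph) : 2 < #|G| -> (forall x : G, 2 < degree x) -> 2 < min_degree G.
Proof.
move=> n3 deg; apply: (big_ind (fun m => 2 < m)) => // a b a2 b2; by rewrite leq_min a2.
Qed.

(** Distinct vertices of the Petersen graph have distinct neighbourhoods: a map that
    preserves and reflects edges is injective, and ten vertices make it
    bijective. *)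
Lemma isomorphic_petersen (G : sgraph) (x : G) L : petersen_list x L -> isomorphic G petersen.
Proof.
case=> uL sL allL LE.
pose ends k : {set 'I_5} := [set inord (nth (0, 0) pairs k).1; inord (nth (0, 0) pairs k).2].
pose pr k := nth (0, 0) pairs k.
have pr5 k : k < 10 -> [&& (pr k).1 < 5, (pr k).2 < 5 & (pr k).1 != (pr k).2].
  by move: k; do 10 case => //.
have inordE a b : a < 5 -> b < 5 -> (inord a == inord b :> 'I_5) = (a == b).
  by move=> a5 b5; rewrite -val_eqE /= !inordK.
have card2 k : k < 10 -> #|ends k| == 2.
  by move=> /pr5/and3P[a b ne]; rewrite cards2 inordE // ne.
have lt10 v : index v L < 10 by rewrite -sL index_mem.
pose f (v : G) : petersen := Sub (ends (index v L)) (card2 _ (lt10 v)).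
have fE u v : edge (f u) (f v) = edge u v.
  rewrite /= /petersen_edge /= -{2}[u](nth_index x (allL u)) -{2}[v](nth_index x (allL v)) LE //.
  have /and3P[a1 a2 _] := pr5 _ (lt10 u); have /and3P[b1 b2 _] := pr5 _ (lt10 v).
  rewrite disjoints_subset subUset !sub1set !inE !negb_or !inordE //.
  by rewrite /kneser -andbA.
have fI : injective f.
  move=> u v fuv; have e k : k < 10 -> kneser (index u L) k = kneser (index v L) k.
    by move=> k10; rewrite -!LE // !nth_index // -!fE fuv.
  rewrite -[u](nth_index x (allL u)) -[v](nth_index x (allL v)); congr nth; apply/eqP.
  have /allP/(_ (index u L)) : all (fun i => all (fun j =>
      all (fun k => kneser i k == kneser j k) (iota 0 10) ==> (i == j)) (iota 0 10)) (iota 0 10) by [].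
  rewrite mem_iota => /(_ (lt10 u))/allP/(_ (index v L)); rewrite mem_iota => /(_ (lt10 v)).
  by move/implyP; apply; apply/allP => k; rewrite mem_iota => k10; rewrite e.
exists f; split=> //; apply: inj_card_bij fI _.
have -> : #|petersen| = 'C(5, 2).
  rewrite -[5 in RHS]card_ord -(card_draws 'I_5 2) /petersen /= card_sig cardsE.
  by apply: eq_card => A.
have <- : #|L| = #|G| by apply: eq_card => v; rewrite allL.
by rewrite (card_uniqP uL) sL.
Qed.

(** * Hamiltonicity *)

Import Order.TTheory GRing.Theory Num.Theory.
Local Open Scope ring_scope.

Lemma tough_strict (R : realType) (G : sgraph) : ~~ is_complete G ->
  (1%:E < toughness R G)%E -> tough_over1 G.
Proof.
move=> ncG; have [t [-> tt _]] := toughness_max R ncG; rewrite lte_fin => t1 T T1.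
have := tt T T1; rewrite -(ltr_nat R); apply: lt_le_trans.
by rewrite -[X in X < _]mul1r ltr_pM2r // ltr0n (ltn_trans _ T1).
Qed.

Theorem corollary1 (R : realType) (G : sgraph) (G_nonempty : (0 < #|G|)%N)
    (tough_gt1 : (1%:E < toughness R G)%E)
    (degree_ge : (#|G|%:R - 5) / 2 <= (min_degree G)%:R :> R) :
  hamiltonian G \/ isomorphic G petersen.
Proof.
have [cG|ncG] := boolP (is_complete G); first by left; apply: complete_cycle.
have tough := tough_strict ncG tough_gt1; have deg := degree_gt2 tough ncG.
have order : (#|G| <= (min_degree G).*2 + 5)%N.
  move: degree_ge; rewrite ler_pdivrMr ?ltr0n // lerBlDr -[5]/(5%:R) -[2]/(2%:R) -natrM -natrD.
  by rewrite ler_nat muln2.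
have [x0 _] : exists x : G, x \in G by apply/card_gt0P.
have d3 : (2 < min_degree G)%N.
  apply: min_degree_gt2 => //; apply: leq_trans (deg x0) _; exact: max_card.
have [C longC] := exists_longest G.
have [/existsP[x xC]|full] := boolP [exists x, x \notin C].
  right; have [L] := petersen_of_longest tough (@min_degree_le G) order d3 longC xC.
  exact: isomorphic_petersen.
have CG v : v \in C by move: full; rewrite negb_exists => /forallP/(_ v); rewrite negbK.
have [uC cC _] := longC.
have sC : size C = #|G| by rewrite -(card_uniqP uC); apply: eq_card => v; rewrite CG.
by left; exists C; split=> //; rewrite /is_cycle sC G_nonempty uC cC orbT.
Qed.
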